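(* Let $G=G_{13}$, $H=G\cap\mathrm{SL}(2,\mathbb{C})$, $A=G/H\simeq\mathbb{Z}/2$, and $Y=H\text{-}\mathrm{Hilb}(\mathbb{C}^2)$. The action of $A$ on the exceptional locus of $Y\to\mathbb{C}^2/H$: (a) maps every exceptional curve to itself; (b) pointwise fixes $E(\rho_2)$, $E(\rho_2')$, and $E(\rho_4)$; (c) fixes exactly two points on each of $E(\rho_1')$, $E(\rho_2'')$, $E(\rho_3)$, and $E(\rho_3')$, leaving a single isolated (within the exceptional locus) fixed point on each of $E(\rho_1')$ and $E(\rho_2'')$, given by $V_6(\rho_1')=(T)$ and $V_8(\rho_2'')=(\psi^2,-\varphi^2)$ respectively, where $\omega=e^{2\pi i/3}$, $T=x^5y-xy^5$, $\varphi=(x^2+y^2)^2+4\omega x^2y^2$, $\psi=(x^2+y^2)^2+4\omega^2x^2y^2$.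
   Context: Set $\varepsilon=e^{2\pi i/8}$. $G_{13}\leq\mathrm{GL}(2,\mathbb{C})$ is generated by $\begin{pmatrix}1&0\\0&-1\end{pmatrix}$, $\frac{1}{\sqrt2}\begin{pmatrix}1&-1\\-1&-1\end{pmatrix}$, $\begin{pmatrix}0&\varepsilon\\\varepsilon^7&0\end{pmatrix}$. The subgroup $H=G\cap\mathrm{SL}(2,\mathbb{C})$ (index $2$, binary octahedral) is generated by $\begin{pmatrix}i&0\\0&-i\end{pmatrix}$, $\begin{pmatrix}0&1\\-1&0\end{pmatrix}$, $\frac{1}{\sqrt2}\begin{pmatrix}\varepsilon^7&\varepsilon^7\\\varepsilon^5&\varepsilon\end{pmatrix}$, $\begin{pmatrix}\varepsilon&0\\0&\varepsilon^7\end{pmatrix}$. The group $G$ acts on $\mathbb{C}[x,y]$ by linear substitutions: $\begin{pmatrix}a&b\\c&d\end{pmatrix}$ sends $x\mapsto ax+cy$, $y\mapsto bx+dy$. $Y=H\text{-}\mathrm{Hilb}(\mathbb{C}^2)$ is the unique component of $\mathrm{Hilb}^{|H|}(\mathbb{C}^2)^H$ dominating $\mathbb{C}^2/H$ via the Hilbert--Chow morphism; it is the minimal (crepant) resolution of $\mathbb{C}^2/H$. Its points are the $H$-invariant ideals $I\subset\mathbb{C}[x,y]$ with $\mathbb{C}[x,y]/I\cong\mathbb{C}[H]$ as $H$-modules. $G$ acts on $Y$ by $I\mapsto g\cdot I$, and this factors through $A=G/H$ (the nontrivial element is represented by $x\mapsto\varepsilon x$, $y\mapsto\varepsilon^3y$).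 The exceptional locus consists of the ideals supported at the origin. Let $\mathfrak{m}=(x,y)$ and let $\mathfrak{n}\subset\mathbb{C}[x,y]$ be the ideal generated by the $H$-invariant polynomials vanishing at the origin. For $I$ in the exceptional locus, $\mathfrak{n}\subseteq I\subseteq\mathfrak{m}$ and $V(I):=I/(\mathfrak{m}I+\mathfrak{n})$. For a nontrivial irreducible representation $\rho$ of $H$ with module $V(\rho)$, $E(\rho):=\{I\text{ in the exceptional locus}: V(\rho)\subseteq V(I)\}\simeq\mathbb{P}^1$; these are the irreducible components (''exceptional curves'') of the exceptional locus, and $E(\rho)$, $E(\rho')$ with $\rho\ne\rho'$ meet iff $\rho,\rho'$ are adjacent in the McKay graph of $H$. $V_i(\rho)$ denotes the sum of the $\rho$-summands of the degree-$i$ homogeneous part of $\mathfrak{m}/\mathfrak{n}$. A point of $Y$ ''given by'' an $H$-submodule $W\subseteq\mathfrak{m}/\mathfrak{n}$ is the ideal of $\mathbb{C}[x,y]$ generated by $\mathfrak{n}$ and lifts of $W$; $(f_1,\ldots,f_k)$ denotes the submodule with these generators. Labeling of irreducible representations of $H$: the McKay graph (extended Dynkin diagram of type $E_7$) is the chain $\rho_0-\rho_2-\rho_3-\rho_4-\rho_3'-\rho_2'-\rho_1'$ together with the vertex $\rho_2''$ joined to $\rho_4$; $\rho_0$ is trivial and subscripts are dimensions. ''Isolated within the exceptional locus'' means isolated in the fixed locus of $A$ restricted to the exceptional locus. *)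

(* Defs.v *)
From HB Require Import structures.
From mathcomp Require Import all_boot all_order all_algebra.
From mathcomp Require Import all_fingroup.
From mathcomp Require Import mxrepresentation character.
From mathcomp Require Import complex.
From mathcomp Require Import boolp classical_sets reals trigo.
From mathcomp Require Import mpoly.

Set Implicit Arguments.
Unset Strict Implicit.
Unset Printing Implicit Defensive.

Import Order.TTheory GRing.Theory Num.Theory.
Local Open Scope ring_scope.
Local Open Scope complex_scope.
Local Open Scope classical_set_scope.

Section Ideals.
Variable C : fieldType.
Local Notation S := {mpoly C[2]}.

Definition is_ideal (I : set S) : Prop :=
  [/\ I 0, forall f g, I f -> I g -> I (f + g) & forall f g, I g -> I (f * g)].

Definition ideal_gen (A : set S) : set S := smallest is_ideal A.

Definition maxideal : set S := ideal_gen (range (fun i : 'I_2 => 'X_i)).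

Definition ideal_mul (I J : set S) : set S :=
  ideal_gen [set f * g | f in I & g in J].

(* (a b; c d) sends x |-> a x + c y and y |-> b x + d y: the image of the j-th
   variable is read off the j-th column.  This is a left action. *)
Definition act (g : 'M[C]_2) (f : S) : S :=
  f \mPo [tuple \sum_(i < 2) g i j *: 'X_i | j < 2].

Definition act_ideal (g : 'M[C]_2) (I : set S) : set S := act g @` I.

Definition zero_locus (I : set S) : set ('I_2 -> C) :=
  [set p | forall f, I f -> f.@[p] = 0].

(* The Zariski topology on ideals of colength N.  The ideals J such that b is a
   basis of S/J form an open set on which the coefficients, on b, of the class
   modulo J of a fixed polynomial are regular functions; for b made of monomials
   it is an affine chart with coordinate ring generated by these functions. *)
Definition is_basis_mod N (b : 'I_N -> S) (J : set S) : Prop :=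
  forall f, exists! c : 'rV[C]_N, J (f - \sum_j c 0 j *: b j).

Definition coords_mod k N (b : 'I_N -> S) (fs : 'I_k -> S) (J : set S)
    (c : 'M[C]_(k, N)) : Prop :=
  forall i, J (fs i - \sum_j c i j *: b j).

(* The points of the chart of b at which the regular function P, a polynomial in
   the coordinates of fs_0, ..., fs_(k-1), does not vanish. *)
Definition basic_open k N (b : 'I_N -> S) (fs : 'I_k -> S)
    (P : {mpoly C[k * N]}) : set (set S) :=
  [set J | is_basis_mod b J /\
     exists2 c, coords_mod b fs J c & P.@[fun t => mxvec c 0 t] != 0].

Definition zariski_open N (Y U : set (set S)) : Prop :=
  U `<=` Y /\
  forall I, U I -> exists k (b : 'I_N -> S) (fs : 'I_k -> S) P,
    basic_open b fs P I /\ basic_open b fs P `&` Y `<=` U.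

Definition isolated_in N (Y F : set (set S)) : set (set S) :=
  [set I | F I /\ exists2 U, zariski_open N Y U & U `&` F = [set I]].

End Ideals.

(* A finite group H acting on C^2 through rH; a representation r of H is viewed
   as the left module of column vectors, h acting by v |-> r h *m v. *)
Section HHilb.
Variables (C : fieldType) (gT : finGroupType) (H : {group gT}).
Variable rH : mx_representation C H 2.
Local Notation S := {mpoly C[2]}.

Definition H_invariant_ideal (I : set S) : Prop :=
  is_ideal I /\ forall h, h \in H -> act_ideal (rH h) I = I.

(* S/I is isomorphic to C[H]: there is an equivariant linear surjection from S
   onto the regular module with kernel I. *)
Definition regular_quotient (I : set S) : Prop :=
  exists pi : {linear S -> 'cV[C]_#|H|},
    [/\ forall v, exists f, pi f = v,
        forall f, pi f = 0 <-> I f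
      & forall h f, h \in H -> pi (act (rH h) f) = regular_repr C H h *m pi f].

(* The points of H-Hilb(C^2). *)
Definition HHilb : set (set S) :=
  [set I | H_invariant_ideal I /\ regular_quotient I].

(* The exceptional locus: the ideals supported at the origin. *)
Definition exceptional : set (set S) :=
  [set I | HHilb I /\ zero_locus I = [set fun=> 0]].

(* The ideal n. *)
Definition invariant_ideal : set S :=
  ideal_gen [set f | (forall h, h \in H -> act (rH h) f = f)
                     /\ f.@[fun=> 0] = 0].

Definition is_submodule (M : set S) : Prop :=
  [/\ M 0, forall f g, M f -> M g -> M (f + g), forall c f, M f -> M (c *: f)
    & forall h f, h \in H -> M f -> M (act (rH h) f)].

(* The map induced by u is an isomorphism of V(r) onto a submodule of (M + N)/N.
   As V(r) is a vector space, every linear map to S/N lifts to S. *)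
Definition embeds_by (r : representation C H) (M N : set S)
    (u : {linear 'cV[C]_(rdegree r) -> S}) : Prop :=
  [/\ forall v, M (u v),
      forall h v, h \in H -> N (u (r h *m v) - act (rH h) (u v))
    & forall v, N (u v) -> v = 0].

(* V(I) = I / denomV I. *)
Definition denomV (I : set S) : set S :=
  [set f + g | f in ideal_mul (@maxideal C) I & g in invariant_ideal].

Definition Ecurve (r : representation C H) : set (set S) :=
  [set I | exceptional I /\ exists u, embeds_by (r := r) I (denomV I) u].

(* Submodules of m/n are represented by their preimages in m. *)
Definition submodule_gen (A : set S) : set S :=
  smallest is_submodule (invariant_ideal `|` A).

(* The degree d part of m/n. *)
Definition degree_part (d : nat) : set S :=
  [set f + g | f in [set f | maxideal f /\ f \is d.-homog]
             & g in invariant_ideal].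

(* V_d(r): the sum of the submodules isomorphic to V(r) of the degree d part. *)
Definition Vdeg (d : nat) (r : representation C H) : set S :=
  submodule_gen [set f | exists u v,
    embeds_by (r := r) (degree_part d) invariant_ideal u /\ f = u v].

(* The ideal given by a submodule W of m/n. *)
Definition point_of (W : set S) : set S := ideal_gen (invariant_ideal `|` W).

End HHilb.

Section SLpart.
Variables (C : fieldType) (gT : finGroupType) (G : {group gT}).
Variable rG : mx_representation C G 2.

(* H = G :&: SL(2, C), seen in G. *)
Definition SLpart : {set gT} := [set g in G | \det (rG g) == 1]%SET.

Lemma SLpart_group_set : group_set SLpart.
Proof.
apply/group_setP; split=> [|x y]; first by rewrite inE group1 repr_mx1 det1 eqxx.
rewrite !inE => /andP[Gx /eqP dx] /andP[Gy /eqP dy].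
by rewrite groupM // repr_mxM // det_mulmx dx dy mulr1 eqxx.
Qed.
Canonical SLpart_group := Group SLpart_group_set.

Lemma SLpart_sub : SLpart \subset G.
Proof. by apply/fintype.subsetP=> x; rewrite inE => /andP[]. Qed.

Definition SLrepr : mx_representation C SLpart_group 2 :=
  subg_repr rG SLpart_sub.

(* The action of A = G/H on H-invariant ideals, on which it does not depend on
   the chosen representative of the coset a. *)
Definition actA (a : coset_of SLpart_group) (I : set {mpoly C[2]}) :
    set {mpoly C[2]} :=
  act_ideal (rG (repr a)) I.

(* The fixed locus of A = G/H restricted to the exceptional locus. *)
Definition exc_fixed : set (set {mpoly C[2]}) :=
  [set I | exceptional SLrepr I /\
     forall a, a \in (G / SLpart_group)%g -> actA a I = I].

Definition exc_isolated : set (set {mpoly C[2]}) :=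
  isolated_in #|SLpart_group| (HHilb SLrepr) exc_fixed.

End SLpart.

Inductive E7label :=
  rho_0 | rho_2 | rho_3 | rho_4 | rho_3' | rho_2' | rho_1' | rho_2''.

Definition E7dim (i : E7label) : nat :=
  match i with
  | rho_0 | rho_1' => 1
  | rho_2 | rho_2' | rho_2'' => 2
  | rho_3 | rho_3' => 3
  | rho_4 => 4
  end.

(* rho_0 - rho_2 - rho_3 - rho_4 - rho_3' - rho_2' - rho_1', with rho_2'' joined
   to rho_4. *)
Definition E7neighbours (i : E7label) : seq E7label :=
  match i with
  | rho_0 => [:: rho_2]
  | rho_2 => [:: rho_0; rho_3]
  | rho_3 => [:: rho_2; rho_4]
  | rho_4 => [:: rho_3; rho_3'; rho_2'']
  | rho_3' => [:: rho_4; rho_2']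
  | rho_2' => [:: rho_3'; rho_1']
  | rho_1' => [:: rho_2']
  | rho_2'' => [:: rho_4]
  end.

(* The irreducible representations of H are labelled so that the McKay graph of
   rH is the above one: the multiplicity of V j in V i (x) rH is 1 if j is a
   neighbour of i and 0 otherwise. *)
Definition E7_labelling (C : fieldType) (gT : finGroupType) (H : {group gT})
    (rH : mx_representation C H 2) (V : E7label -> representation C H) :
    Prop :=
  [/\ forall i, mx_irreducible (V i) /\ rdegree (V i) = E7dim i,
      forall i j, mx_rsim (V i) (V j) -> i = j,
      forall r : representation C H,
        mx_irreducible r -> exists i, mx_rsim r (V i),
      forall h, h \in H -> V rho_0 h = 1%:M
    & forall i, mx_rsim (prod_repr (V i) rH)
                  (\big[dadd_grepr/grepr0]_(j <- E7neighbours i) V j)].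

Section G13.
Variable R : realType.
Local Notation C := R[i].

Definition mx2 (a b c d : C) : 'M[C]_2 :=
  \matrix_(i, j) if i == 0 then (if j == 0 then a else b)
                 else (if j == 0 then c else d).

(* exp (2 i pi / n) *)
Definition expi2pi (n : nat) : C :=
  cos (2 * pi / n%:R) +i* sin (2 * pi / n%:R).

Definition epsilon : C := expi2pi 8.
Definition omega : C := expi2pi 3.

(* The abstract finite group G is identified by rG with the subgroup of GL(2, C)
   generated by the three reflections. *)
Definition is_G13 (gT : finGroupType) (G : {group gT})
    (rG : mx_representation C G 2) : Prop :=
  mx_faithful rG /\
  exists s t u : gT,
    [/\ G :=: <<[set s; t; u]%SET>>%g,
        rG s = mx2 1 0 0 (-1),
        rG t = (Num.sqrt 2)^-1%:C *: mx2 1 (-1) (-1) (-1)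
      & rG u = mx2 0 epsilon (epsilon ^+ 7) 0].

Local Notation x := ('X_(0 : 'I_2) : {mpoly C[2]}).
Local Notation y := ('X_(1 : 'I_2) : {mpoly C[2]}).

Definition T13 : {mpoly C[2]} := x ^+ 5 * y - x * y ^+ 5.

Definition phi13 : {mpoly C[2]} :=
  (x ^+ 2 + y ^+ 2) ^+ 2 + (4 * omega) *: (x ^+ 2 * y ^+ 2).

Definition psi13 : {mpoly C[2]} :=
  (x ^+ 2 + y ^+ 2) ^+ 2 + (4 * omega ^+ 2) *: (x ^+ 2 * y ^+ 2).

End G13.

(* Main.v *)
Require Import Defs.
From HB Require Import structures.
From mathcomp Require Import all_boot all_order all_algebra.
From mathcomp Require Import all_fingroup.
From mathcomp Require Import mxrepresentation character.
From mathcomp Require Import complex.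
From mathcomp Require Import boolp classical_sets reals trigo.
From mathcomp Require Import mpoly.
From mathcomp Require Import ring zify.
Import Defs.

Set Implicit Arguments.
Unset Strict Implicit.
Unset Printing Implicit Defensive.

Import Order.TTheory GRing.Theory Num.Theory.
Local Open Scope ring_scope.
Local Open Scope classical_set_scope.

(** The group G is the union of H and of its coset by a scalar matrix c with
    c^2 = -1, the cube of the product of the three reflections (act_G).  So A
    acts on the H-invariant ideals through f(x, y) |-> f(c x, c y), which
    multiplies the forms of degree d by c^d, and the statement is a matter of
    degrees in the graded H-module M = m/n.

    The ideal n is generated by Klein's invariants f8 and f12 = T^2 and contains
    m^18 (invariant_idealE): the recursion of the Koszul complex gives the
    multiplicities of all the representations in the polynomials of degree at
    most 18, hence the invariants up to that degree and the equality of n and m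
    in degree 18.  The points of the exceptional locus are then the submodules N
    of M, stable under x and y, that contain each V i with i <> rho_0 exactly
    dim V i times (exc_of, exceptional_of), and N lies on E(r) when V r occurs
    among its generators (EcurveP).

    These submodules are controlled by a single count.  For a stable subspace A
    of M the Koszul complex of x and y and the McKay graph give
      (sum over the neighbours j of i of mult_j A) + mult_i (soc M)
        = mult_i (x A + y A) + mult_i (A : m),
    where soc M is V rho_2 in degree 17 (colon_count).  Pure arithmetic with this
    identity shows that some dimension vectors are not those of a submodule
    (excludedP), and that some others are those of exactly one submodule, which
    is graded and whose degrees can be computed (chainP).  For each r there is
    such a submodule K_r whose vector is that of a point of the exceptional locus
    minus one V r.  The quotient (K_r : m) / K_r contains V r twice, in degrees l
    and 18 - l, and the points of E(r) are the submodules K_r + V with V a copy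
    of V r there: E(r) is a projective line on which c acts by the diagonal
    matrix (c^l, c^(18 - l)) (pencil_exists, scale_pencil).  This proves (a).
    The degrees (l, 18 - l) are (7, 11) for rho_2 and rho_2', (9, 9) for rho_4,
    (8, 10) for rho_3, rho_3' and rho_2'', and (6, 12) for rho_1'.  In the first
    three cases the two entries are equal and the curve is fixed pointwise; in
    the others they are opposite and the two coordinate points are the fixed
    ones.

    As the curves are parametrized algebraically, no point of a pointwise fixed
    curve is isolated (pencil_nbhs).  The degrees show that the coordinate points
    of E(rho_1'), E(rho_2''), E(rho_3) and E(rho_3') lie on such a curve
    (pencil_meet), except those of degree 6 on E(rho_1') and of degree 8 on
    E(rho_2'').  These are isolated: all the other fixed points contain the copy
    of V r in degree 18 - l (high_in_other), which they do not contain
    (isolated_low).  They are generated by the copy of V r in degree l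
    (low_generates), which is spanned by T, or by psi^2 and phi^2, since these
    spans are stable and too small for any other constituent of M in that degree
    (low_submodule). *)

(** * Subspaces of a vector space *)

Section Subspaces.
Variable K : fieldType.

Definition subspace (L : lmodType K) (P : set L) : Prop :=
  P 0 /\ forall a u v, P u -> P v -> P (a *: u + v).

Lemma ex_vs (L : vectType K) (P : set L) :
  subspace P -> exists U : {vspace L}, forall v, (v \in U) <-> P v.
Proof.
move=> [P0 PD].
pose Q k := exists U : {vspace L}, (forall v, v \in U -> P v) /\ \dim U = k.
have exQ : exists k, `[<Q k>].
  exists 0%N; apply/asboolP; exists 0%VS; rewrite dimv0; split=> // v.
  by rewrite memv0 => /eqP ->.
have bndQ k : `[<Q k>] -> (k <= \dim {:L})%N.
  by move=> /asboolP[U [_ <-]]; rewrite dimvS ?subvf.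
have [k /asboolP[U [UP Uk]] maxk] := ex_maxnP exQ bndQ.
exists U => v; split=> [/UP//|Pv].
have UvP w : w \in (U + <[v]>)%VS -> P w.
  by move=> /memv_addP[u uU [w' /vlineP[a ->] ->]]; rewrite addrC; apply/PD/UP.
have: (\dim (U + <[v]>) <= \dim U)%N.
  by rewrite Uk; apply: maxk; apply/asboolP; exists (U + <[v]>)%VS.
move=> le_dim; have := eqEdim U (U + <[v]>)%VS.
rewrite addvSl le_dim => /eqP ->.
by rewrite -[X in X \in _]add0r memv_add ?mem0v ?memv_line.
Qed.

(** The subspace whose elements satisfy P; it is meaningful only when P is
    closed under linear combinations, as in_vs demands. *)
Definition vs (L : vectType K) (P : set L) : {vspace L} :=
  if pselect (subspace P) is left h then projT1 (cid (ex_vs h)) else 0%VS.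

Lemma in_vs (L : vectType K) (P : set L) v :
  subspace P -> (v \in vs P) <-> P v.
Proof. by rewrite /vs => h; case: pselect => // h'; case: cid. Qed.

Lemma dim_exact (L1 L2 : vectType K) (f : {linear L1 -> L2})
    (U N : {vspace L1}) (W : {vspace L2}) :
    (forall u, (u \in N) <-> (u \in U /\ f u = 0)) ->
    (forall u, u \in U -> f u \in W) ->
    (forall w, w \in W -> exists2 u, u \in U & f u = w) ->
  \dim U = (\dim N + \dim W)%N.
Proof.
move=> kerP fU surjf; rewrite -(limg_ker_dim (linfun f) U).
have -> : (U :&: lker (linfun f))%VS = N.
  apply/vspaceP=> v; rewrite memv_cap memv_ker lfunE /=; apply/idP/idP.
    by move=> /andP[vU /eqP fv0]; apply/kerP.
  by move=> /kerP[-> /= ->].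
suff -> : (linfun f @: U)%VS = W by [].
apply/vspaceP=> v; apply/idP/idP => [/memv_imgP[u uU ->]|/surjf[u uU <-]].
  by rewrite lfunE /= fU.
by apply/memv_imgP; exists u; rewrite ?lfunE.
Qed.

Lemma dim_inj (L1 L2 : vectType K) (f : {linear L1 -> L2})
    (U : {vspace L1}) (W : {vspace L2}) :
    (forall u, u \in U -> f u = 0 -> u = 0) ->
    (forall u, u \in U -> f u \in W) -> (\dim U <= \dim W)%N.
Proof.
move=> injf fU.
rewrite (@dim_exact _ _ f U 0%VS (linfun f @: U)%VS) ?dimv0 ?add0n.
- by apply/dimvS/subvP => _ /memv_imgP[u uU ->]; rewrite lfunE fU.
- move=> u; rewrite memv0; split=> [/eqP ->|[uU /injf ->]] //.
  by rewrite mem0v linear0.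
- by move=> u uU; apply/memv_imgP; exists u; rewrite ?lfunE.
- by move=> w /memv_imgP[u uU ->]; exists u; rewrite ?lfunE.
Qed.

Definition colmx n m (f : 'cV[K]_n -> 'cV[K]_m) : 'M[K]_(m, n) :=
  \matrix_(i, j) f (delta_mx j 0) i 0.

Lemma colmxE n m (f : {linear 'cV[K]_n -> 'cV[K]_m}) v :
  colmx f *m v = f v.
Proof.
rewrite {2}[v]matrix_sum_delta linear_sum /=.
apply/matrixP=> i j; rewrite ord1 {j} !mxE summxE.
by apply: eq_bigr => k _; rewrite big_ord1 linearZ /= !mxE mulrC.
Qed.

Lemma eq_colmx n m (A B : 'M[K]_(m, n)) :
  (forall v : 'cV_n, A *m v = B *m v) -> A = B.
Proof.
move=> eqAB; apply/matrixP => i j.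
by have /matrixP/(_ i 0) := eqAB (delta_mx j 0); rewrite -!colE !mxE.
Qed.

(** A linear relation that is total has a linear section: define it on the
    standard basis. *)
Lemma lin_choice (L : lmodType K) n (R : 'cV[K]_n -> L -> Prop) :
    (forall v, exists u, R v u) ->
    (forall a v v' u u', R v u -> R v' u' -> R (a *: v + v') (a *: u + u')) ->
    R 0 0 ->
  exists f : {linear 'cV[K]_n -> L}, forall v, R v (f v).
Proof.
move=> exR RD R0; have [u Ru] := choice (fun j : 'I_n => exR (delta_mx j 0)).
pose f (v : 'cV[K]_n) := \sum_j v j 0 *: u j.
have lin_f : linear f.
  move=> a v w; rewrite /f scaler_sumr -big_split; apply: eq_bigr => j _ /=.
  by rewrite !mxE scalerDl scalerA.
pose fL := GRing.isLinear.Build _ _ _ _ f lin_f.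
exists (HB.pack f fL : {linear _ -> _}) => v /=.
rewrite /f {1}[v]matrix_sum_delta.
elim/big_ind2 : _ => // [v1 u1 v2 u2 h1 h2|j _].
  by have := RD 1 _ _ _ _ h1 h2; rewrite !scale1r.
rewrite big_ord1 -[X in R X]addr0 -[X in R _ X]addr0; exact: RD.
Qed.

End Subspaces.

(** * Equivariant maps and multiplicities *)

Section Equivariant.
Variables (C : numClosedFieldType) (gT : finGroupType) (H : {group gT}).
Local Notation rep := (mx_representation C H).

Definition hom n (Q : rep n) d (r : rep d) (A : 'M[C]_(n, d)) : Prop :=
  forall h, h \in H -> Q h *m A = A *m r h.

Definition into n d (U : {vspace 'cV[C]_n}) (A : 'M[C]_(n, d)) : Prop :=
  forall v, A *m v \in U.

(** H-modules are spaces of columns on which H acts through a matrix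
    representation, and submodules are stable subspaces. *)
Definition stab n (Q : rep n) (U : {vspace 'cV[C]_n}) : Prop :=
  forall h v, h \in H -> v \in U -> Q h *m v \in U.

Definition HomTo n (Q : rep n) d (r : rep d) U : {vspace 'M[C]_(n, d)} :=
  vs [set A | hom Q r A /\ into U A].

(** By Schur's lemma this is the number of copies of r in U when r is
    irreducible. *)
Definition mult n (Q : rep n) d (r : rep d) U : nat := \dim (HomTo Q r U).

Lemma in_HomTo n (Q : rep n) d (r : rep d) U A :
  (A \in HomTo Q r U) <-> hom Q r A /\ into U A.
Proof.
apply: in_vs; split=> [|a A1 A2 [h1 i1] [h2 i2]].
  by split=> [h Hh|v]; rewrite ?mulmx0 ?mul0mx ?mem0v.
split=> [h Hh|v]; last by rewrite mulmxDl -scalemxAl memvD ?memvZ.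
by rewrite mulmxDr mulmxDl -scalemxAr -scalemxAl h1 ?h2.
Qed.

Lemma HomToS n (Q : rep n) d (r : rep d) (U W : {vspace 'cV[C]_n}) :
  (U <= W)%VS -> (HomTo Q r U <= HomTo Q r W)%VS.
Proof.
move=> /subvP UW; apply/subvP=> A /in_HomTo[hA iA]; apply/in_HomTo.
by split=> // v; apply: UW.
Qed.

Lemma multS n (Q : rep n) d (r : rep d) (U W : {vspace 'cV[C]_n}) :
  (U <= W)%VS -> (mult Q r U <= mult Q r W)%N.
Proof. by move=> /(HomToS Q r)/dimvS. Qed.

Lemma into_delta n d (U : {vspace 'cV[C]_n}) (A : 'M[C]_(n, d)) :
  (forall j, A *m delta_mx j 0 \in U) -> into U A.
Proof.
move=> iA v; rewrite [v]matrix_sum_delta mulmx_sumr; apply: memv_suml => j _.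
by rewrite mulmx_sumr; apply: memv_suml => k _; rewrite ord1 -scalemxAr memvZ.
Qed.

Lemma into_mul n d e U (A : 'M[C]_(n, d)) (B : 'M[C]_(d, e)) :
  into U A -> into U (A *m B).
Proof. by move=> iA v; rewrite -mulmxA. Qed.

Lemma hom_mul n (Q : rep n) d (r : rep d) e (s : rep e) A B :
  hom Q r A -> hom r s B -> hom Q s (A *m B).
Proof. by move=> hA hB h Hh; rewrite mulmxA hA // -!mulmxA hB. Qed.

(** The projection of a matrix onto the equivariant ones. *)
Definition avg n (Q : rep n) d (r : rep d) (A : 'M[C]_(n, d)) :=
  #|H|%:R^-1 *: \sum_(h in H) (Q h *m A *m r h^-1%g).

Lemma cardH_neq0 : #|H|%:R != 0 :> C.
Proof. by rewrite pnatr_eq0 -lt0n cardG_gt0. Qed.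

Lemma avg_hom n (Q : rep n) d (r : rep d) A : hom Q r (avg Q r A).
Proof.
move=> k Hk; rewrite -scalemxAr -scalemxAl; congr (_ *: _).
rewrite mulmx_sumr mulmx_suml [RHS](reindex_inj (mulgI k)) /=.
rewrite [RHS](eq_bigl (mem H)) /= => [|h]; last by rewrite groupMl.
apply: eq_bigr => h Hh; rewrite invMg !repr_mxM ?groupV //.
by rewrite !mulmxA repr_mxKV.
Qed.

Lemma avg_into n (Q : rep n) d (r : rep d) U A :
  stab Q U -> into U A -> into U (avg Q r A).
Proof.
move=> sU iA v; rewrite -scalemxAl memvZ // mulmx_suml.
by apply: memv_suml => h Hh; rewrite -!mulmxA sU.
Qed.

(** The difference is the average of the defects of equivariance of A. *)
Lemma avg_mod n (Q : rep n) d (r : rep d) (D : {vspace 'cV[C]_n}) A :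
    (forall h, h \in H -> into D (Q h *m A - A *m r h)) ->
  into D (avg Q r A - A).
Proof.
move=> hA v.
have -> : avg Q r A - A =
    #|H|%:R^-1 *: \sum_(h in H) ((Q h *m A - A *m r h) *m r h^-1%g).
  rewrite /avg -{2}[A](scalerK cardH_neq0) -scalerBr; congr (_ *: _).
  rewrite scaler_nat -sumr_const -sumrB; apply: eq_bigr => h Hh.
  by rewrite mulmxBl -[A *m _ *m _]mulmxA -repr_mxM ?groupV ?mulgV ?repr_mx1 ?mulmx1.
rewrite -scalemxAl memvZ // mulmx_suml; apply: memv_suml => h Hh.
by rewrite -mulmxA hA.
Qed.

Lemma avg_mul n (Q : rep n) m (P : rep m) d (r : rep d) F A :
  hom P Q F -> F *m avg Q r A = avg P r (F *m A).
Proof.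
move=> hF; rewrite -scalemxAr mulmx_sumr; congr (_ *: _).
by apply: eq_bigr => h Hh; rewrite !mulmxA hF.
Qed.

Lemma avg_id n (Q : rep n) d (r : rep d) A : hom Q r A -> avg Q r A = A.
Proof.
move=> hA; apply/eqP; rewrite -subr_eq0; apply/eqP/eq_colmx => v.
rewrite mul0mx; apply/eqP; rewrite -memv0; apply: avg_mod => h Hh w.
by rewrite hA // subrr mul0mx mem0v.
Qed.

(** Equivariant maps lift through equivariant surjections: average any linear
    lift. *)
Lemma hom_lift n (Q : rep n) m (P : rep m) d (r : rep d) F U B :
    hom P Q F -> stab Q U -> hom P r B ->
    (forall v, exists2 u, u \in U & F *m u = B *m v) ->
  exists A, [/\ hom Q r A, into U A & F *m A = B].
Proof.
move=> hF sU hB liftB.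
have [|a v v' u u' [uU e] [u'U e']||f fP] :=
  @lin_choice C _ d (fun v u => u \in U /\ F *m u = B *m v).
- by move=> v; have [u uU e] := liftB v; exists u.
- by rewrite memvD ?memvZ // !mulmxDr -!scalemxAr e e'.
- by rewrite mem0v !mulmx0.
exists (avg Q r (colmx f)); split; first exact: avg_hom.
  by apply: avg_into => // v; rewrite colmxE; case: (fP v).
rewrite (avg_mul _ _ hF); have -> : F *m colmx f = B.
  by apply: eq_colmx => v; rewrite -mulmxA colmxE; case: (fP v).
exact: avg_id.
Qed.

(** Multiplicities are additive in exact sequences, because equivariant maps
    lift. *)
Lemma mult_exact n (Q : rep n) m (P : rep m) F (U N : {vspace 'cV_n})
    (W : {vspace 'cV_m}) d (r : rep d) :
    hom P Q F -> stab Q U ->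
    (forall u, (u \in N) <-> (u \in U /\ F *m u = 0)) ->
    (forall u, u \in U -> F *m u \in W) ->
    (forall w, w \in W -> exists2 u, u \in U & F *m u = w) ->
  mult Q r U = (mult Q r N + mult P r W)%N.
Proof.
move=> hF sU kerP FU surjF.
apply: (@dim_exact _ _ _ (mulmx F)) => [A|A /in_HomTo[hA iA]|B /in_HomTo[hB iB]].
- split=> [/in_HomTo[hA iA]|[/in_HomTo[hA iA] FA]]; last first.
    by apply/in_HomTo; split=> // v; apply/kerP; rewrite mulmxA FA mul0mx.
  split; first by apply/in_HomTo; split=> // v; have /kerP[] := iA v.
  by apply: eq_colmx => v; rewrite mul0mx -mulmxA; have /kerP[] := iA v.
- apply/in_HomTo; split; first exact: hom_mul hA.
  by move=> v; rewrite -mulmxA; apply: FU.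
- have [v|A [hA iA FA]] := hom_lift hF sU hB; first exact: surjF.
  by exists A => //; apply/in_HomTo.
Qed.

Lemma mult0 n (Q : rep n) d (r : rep d) : mult Q r 0%VS = 0%N.
Proof.
apply/eqP; rewrite dimv_eq0 -subv0; apply/subvP=> A /in_HomTo[_ iA].
rewrite memv0; apply/eqP/eq_colmx => v; rewrite mul0mx.
by apply/eqP; rewrite -memv0.
Qed.

Lemma stab0 n (Q : rep n) : stab Q 0%VS.
Proof. by move=> h v _; rewrite memv0 => /eqP ->; rewrite mulmx0 mem0v. Qed.

Lemma stabf n (Q : rep n) : stab Q fullv.
Proof. by move=> h v _ _; rewrite memvf. Qed.

Lemma stabD n (Q : rep n) U W : stab Q U -> stab Q W -> stab Q (U + W)%VS.
Proof.
move=> sU sW h _ Hh /memv_addP[u uU [w wW ->]].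
by rewrite mulmxDr memv_add ?sU ?sW.
Qed.

Lemma stabI n (Q : rep n) U W : stab Q U -> stab Q W -> stab Q (U :&: W)%VS.
Proof.
by move=> sU sW h v Hh /memv_capP[vU vW]; rewrite memv_cap sU ?sW.
Qed.

Definition img n d (A : 'M[C]_(n, d)) : {vspace 'cV[C]_n} :=
  (linfun (mulmx A) @: fullv)%VS.

Lemma in_img n d (A : 'M[C]_(n, d)) u :
  (u \in img A) <-> exists v : 'cV_d, u = A *m v.
Proof.
split=> [/memv_imgP[v _ ->]|[v ->]]; first by exists v; rewrite lfunE.
by apply/memv_imgP; exists v; rewrite ?memvf ?lfunE.
Qed.

Lemma img_into n d U (A : 'M[C]_(n, d)) : into U A <-> (img A <= U)%VS.
Proof.
split=> [iA|/subvP iA v]; last by apply: iA; apply/in_img; exists v.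
by apply/subvP => _ /in_img[v ->].
Qed.

Lemma stab_img n (Q : rep n) d (r : rep d) A : hom Q r A -> stab Q (img A).
Proof.
move=> hA h _ Hh /in_img[v ->]; apply/in_img; exists (r h *m v).
by rewrite !mulmxA hA.
Qed.

(** Averaging any linear projection gives an equivariant one. *)
Lemma maschke n (Q : rep n) U :
  stab Q U -> exists P, [/\ hom Q Q P, into U P & forall u, u \in U -> P *m u = u].
Proof.
move=> sU; pose P0 : 'M[C]_n := colmx (projv U).
have iP0 : into U P0 by move=> v; rewrite colmxE memv_proj.
have P0id v : v \in U -> P0 *m v = v by move=> vU; rewrite colmxE /= projv_id.
exists (avg Q Q P0); split; [exact: avg_hom|exact: avg_into|] => u uU.
rewrite -scalemxAl mulmx_suml.
rewrite (eq_bigr (fun=> u)) ?sumr_const -?scaler_nat ?scalerA ?mulVf ?scale1r //.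
  exact: cardH_neq0.
move=> h Hh; rewrite -!mulmxA P0id; first by rewrite mulmxA -repr_mxM ?groupV // mulgV repr_mx1 mul1mx.
by apply: sU => //; rewrite groupV.
Qed.

Lemma compl_exists n (Q : rep n) (A B : {vspace 'cV[C]_n}) :
    stab Q A -> stab Q B -> (A <= B)%VS ->
  exists D, [/\ stab Q D, (A + D = B)%VS & (A :&: D = 0)%VS].
Proof.
move=> sA sB /subvP AB; have [P [hP iP Pid]] := maschke sA.
pose D := vs [set v | v \in B /\ P *m v = 0].
have DP v : (v \in D) <-> (v \in B /\ P *m v = 0).
  apply: in_vs; split=> [|a u w [uB Pu] [wB Pw]].
    by split; rewrite ?mem0v ?mulmx0.
  by split; rewrite ?memvD ?memvZ // mulmxDr -scalemxAr Pu Pw scaler0 addr0.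
exists D; split.
- move=> h v Hh /DP[vB Pv]; apply/DP; split; first exact: sB.
  by rewrite mulmxA -hP // -mulmxA Pv mulmx0.
- apply/eqP; rewrite eqEsubv subv_add; apply/andP; split.
    by apply/andP; split; apply/subvP => // v /DP[].
  apply/subvP=> v vB; rewrite -[v](subrK (P *m v)) addrC memv_add //.
  apply/DP; split; first by apply: memvB => //; apply: AB.
  by rewrite mulmxBr [P *m (P *m v)]Pid // subrr.
- apply/eqP; rewrite -subv0; apply/subvP=> v /memv_capP[vA /DP[_ Pv]].
  by rewrite memv0 -[v]Pid // Pv.
Qed.

Lemma mult_add n (Q : rep n) A D d (r : rep d) :
    stab Q A -> stab Q D -> (A :&: D = 0)%VS ->
  mult Q r (A + D)%VS = (mult Q r A + mult Q r D)%N.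
Proof.
move=> sA sD AD0.
have [P [hP iP Pid]] := maschke sD.
have hF : hom Q Q (1%:M - P) by move=> h Hh; rewrite mulmxBr mulmxBl hP // mul1mx mulmx1.
have FD v : v \in D -> (1%:M - P) *m v = 0 by move=> vD; rewrite mulmxBl mul1mx Pid ?subrr.
have F0 v : (1%:M - P) *m v = 0 -> v \in D.
  by rewrite mulmxBl mul1mx => /eqP; rewrite subr_eq0 => /eqP ->.
pose W := (linfun (mulmx (1%:M - P)) @: A)%VS.
have inW w : w \in W <-> exists2 u, u \in A & (1%:M - P) *m u = w.
  split=> [/memv_imgP[u uA ->]|[u uA <-]]; first by exists u; rewrite ?lfunE.
  by apply/memv_imgP; exists u; rewrite ?lfunE.
rewrite (@mult_exact _ Q _ Q (1%:M - P) (A + D)%VS D W) //; first last.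
- move=> _ /inW[u uA <-]; exists u => //.
  by rewrite -[X in X \in _]addr0 memv_add ?mem0v.
- move=> _ /memv_addP[u uA [v vD ->]]; rewrite mulmxDr (FD v vD) addr0.
  by apply/inW; exists u.
- move=> u; split=> [uD|[_ /F0//]]; split; last exact: FD.
  by rewrite -[X in X \in _]add0r memv_add ?mem0v.
- exact: stabD.
rewrite addnC; congr (_ + _)%N.
rewrite [RHS](@mult_exact _ Q _ Q (1%:M - P) A 0%VS W) //.
- by rewrite mult0.
- move=> u; split=> [|[uA /F0 uD]].
    by rewrite memv0 => /eqP ->; rewrite mulmx0 mem0v.
  by rewrite -AD0 memv_cap uA.
- by move=> u uA; apply/inW; exists u.
- by move=> w /inW.
Qed.

End Equivariant.

(** * Irreducible representations *)

Section Irreducible.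
Variables (C : numClosedFieldType) (gT : finGroupType) (H : {group gT}).
Local Notation rep := (mx_representation C H).

Lemma irr_stab d (r : rep d) U :
  mx_irreducible r -> stab r U -> U = 0%VS \/ U = fullv.
Proof.
move=> /mx_irrP[d0 irr] sU; have [P [hP iP Pid]] := maschke sU.
have modK : mxmodule r (kermx P).
  apply/mxmoduleP => h Hh; apply/sub_kermxP.
  by rewrite -mulmxA hP // mulmxA mulmx_ker mul0mx.
have [K0|Kn0] := eqVneq (kermx P) 0; [right|left].
  have freeP : row_free P by rewrite -kermx_eq0 K0.
  apply/vspaceP=> v; rewrite memvf.
  have uP : P \in unitmx by rewrite -row_free_unit.
  by rewrite -[v](mulKVmx uP) iP.
have fullK := irr _ modK Kn0.
have P0 : P = 0.
  by move: fullK; rewrite -sub1mx => /submxP[D e1]; rewrite -[P]mul1mx e1 -mulmxA mulmx_ker mulmx0.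
apply/eqP; rewrite -subv0; apply/subvP=> v /Pid <-.
by rewrite P0 mul0mx mem0v.
Qed.

Lemma irr_inj n (Q : rep n) d (r : rep d) A D :
    mx_irreducible r -> hom Q r A -> stab Q D -> ~ into D A ->
  forall v, A *m v \in D -> v = 0.
Proof.
move=> irr hA sD nD v vD.
pose K := vs [set w : 'cV_d | A *m w \in D].
have inK w : (w \in K) <-> A *m w \in D.
  apply: in_vs; split=> [|a x y xD yD] /=; first by rewrite mulmx0 mem0v.
  by rewrite mulmxDr -scalemxAr memvD ?memvZ.
have sK : stab r K.
  by move=> h w Hh /inK wD; apply/inK; rewrite mulmxA -hA // -mulmxA sD.
have [K0|K1] := irr_stab irr sK.
  by apply/eqP; rewrite -memv0 -K0; apply/inK.
by case: nD => w; apply/inK; rewrite K1 memvf.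
Qed.

Lemma schur_sim d1 d2 (r1 : rep d1) (r2 : rep d2) A :
    mx_irreducible r1 -> mx_irreducible r2 -> hom r1 r2 A -> A <> 0 ->
  mx_rsim r1 r2.
Proof.
move=> irr1 irr2 hA An0.
have Ainj (v : 'cV_d2) : A *m v = 0 -> v = 0.
  move=> Av; apply: (irr_inj irr2 hA (@stab0 _ _ _ _ r1)); last by rewrite Av mem0v.
  move=> iA; apply: An0; apply: eq_colmx => w; rewrite mul0mx.
  by apply/eqP; rewrite -memv0.
have surjA : img A = fullv.
  have [A0|//] := irr_stab irr1 (stab_img hA).
  case: An0; apply: eq_colmx => w; rewrite mul0mx.
  by apply/eqP; rewrite -memv0 -A0; apply/in_img; exists w.
have freeA : row_free A.
  rewrite -kermx_eq0 -submx0; apply/rV_subP=> w /sub_kermxP wA.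
  rewrite submx0; apply/eqP/matrixP => i j; rewrite ord1 mxE.
  have: delta_mx j 0 \in img A by rewrite surjA memvf.
  move=> /in_img[v e]; have := congr1 (mulmx w) e.
  by rewrite -colE mulmxA wA mul0mx => /matrixP/(_ 0 0); rewrite !mxE.
have freeAt : row_free A^T.
  rewrite -kermx_eq0 -submx0; apply/rV_subP=> w /sub_kermxP wA.
  rewrite submx0; apply/eqP; rewrite -[w]trmxK [w^T]Ainj ?trmx0 //.
  by rewrite -[A]trmxK -trmx_mul wA trmx0.
exists A => //; first by rewrite -(eqP freeA) -mxrank_tr (eqP freeAt).
Qed.

Lemma schur_scalar d (r : rep d) A :
  mx_irreducible r -> hom r r A -> exists c, A = c%:M.
Proof.
move=> irr hA; have [d0 _] := (mx_irrP _).1 irr.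
have [|c] := @closed_rootP C (char_poly A) _.
  by rewrite size_char_poly; case: (d) d0.
rewrite -eigenvalue_root_char => /eigenvalueP[w wA wn0].
exists c; apply/eqP; rewrite -subr_eq0; apply/eqP.
have hB : hom r r (A - c%:M).
  by move=> h Hh; rewrite mulmxBr mulmxBl hA // scalar_mxC.
apply: contrapT => Bn0.
have := schur_sim irr irr hB Bn0 => _.
have [B0|B1] := irr_stab irr (stab_img hB).
  apply: Bn0; apply: eq_colmx => v; rewrite mul0mx; apply/eqP.
  by rewrite -memv0 -B0; apply/in_img; exists v.
case/negP: wn0; apply/eqP/matrixP => i j; rewrite ord1 mxE.
have: delta_mx j 0 \in img (A - c%:M) by rewrite B1 memvf.
move=> /in_img[v e]; have := congr1 (mulmx w) e.
rewrite -colE mulmxA mulmxBr wA mul_mx_scalar subrr mul0mx.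
by move=> /matrixP/(_ 0 0); rewrite !mxE.
Qed.

Lemma mult_self d (r : rep d) : mx_irreducible r -> mult r r fullv = 1%N.
Proof.
move=> irr; have [d0 _] := (mx_irrP _).1 irr.
suff -> : mult r r fullv = \dim <[1%:M : 'M[C]_d]>.
  rewrite dim_vline; case: (d) d0 => // k _.
  by rewrite -[1%:M]/(1 : 'M_k.+1) oner_eq0.
congr (\dim _); apply/vspaceP=> A; apply/idP/vlineP => [/in_HomTo[hA _]|[c ->]].
  by have [c ->] := schur_scalar irr hA; exists c; rewrite scalemx1.
apply/in_HomTo; split=> [h Hh|v]; last exact: memvf.
by rewrite scalemx1 scalar_mxC.
Qed.

Lemma mult_other d1 d2 (r1 : rep d1) (r2 : rep d2) :
    mx_irreducible r1 -> mx_irreducible r2 -> ~ mx_rsim r1 r2 ->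
  mult r1 r2 fullv = 0%N.
Proof.
move=> irr1 irr2 nsim; apply/eqP; rewrite dimv_eq0 -subv0.
apply/subvP=> A /in_HomTo[hA _]; rewrite memv0; apply/eqP.
by apply: contrapT => An0; apply/nsim/schur_sim/An0.
Qed.

Lemma mult_img n (Q : rep n) d (r : rep d) d' (r' : rep d') u :
    mx_irreducible r -> hom Q r u -> u <> 0 ->
  mult Q r' (img u) = mult r r' fullv.
Proof.
move=> irr hu un0; apply/esym.
rewrite (@mult_exact _ _ _ _ r _ Q u fullv 0%VS (img u)) ?mult0 //.
- exact: stabf.
- move=> v; rewrite memv0; split=> [/eqP ->|[_ uv]]; first by rewrite memvf mulmx0.
  apply/eqP; apply: (irr_inj irr hu (@stab0 _ _ _ _ Q)); last by rewrite uv mem0v.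
  move=> iu; apply: un0; apply: eq_colmx => w; rewrite mul0mx.
  by apply/eqP; rewrite -memv0.
- by move=> v _; apply/in_img; exists v.
- by move=> _ /in_img[v ->]; exists v; rewrite ?memvf.
Qed.

(** A nonzero stable subspace of least dimension is irreducible; the columns
    of a basis of it carry the representation. *)
Lemma irr_exists n (Q : rep n) U :
    stab Q U -> U <> 0%VS ->
  exists (r : representation C H) u,
    [/\ mx_irreducible r, hom Q r u, into U u & u <> 0].
Proof.
move=> sU Un0.
pose good k := `[<exists W, [/\ stab Q W, (W <= U)%VS, W <> 0%VS & \dim W = k]>].
have exg : exists k, good k by exists (\dim U); apply/asboolP; exists U.
have [k /asboolP[W [sW WU Wn0 dimW]] mink] := ex_minnP exg.
have {}mink W' : stab Q W' -> (W' <= W)%VS -> W' <> 0%VS -> W' = W.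
  move=> sW' W'W nz; apply/eqP; rewrite eqEdim W'W dimW mink //.
  by apply/asboolP; exists W'; split=> //; apply: subv_trans W'W WU.
pose d := \dim W; pose b := vbasis W.
pose B : 'M[C]_(n, d) := \matrix_(i, j) (tnth b j) i 0.
pose L : 'M[C]_(d, n) := \matrix_(i, j) coord b i (delta_mx j 0).
have BE (v : 'cV_d) : B *m v = \sum_j v j 0 *: b`_j.
  apply/matrixP=> i j; rewrite ord1 !mxE summxE; apply: eq_bigr => l _.
  by rewrite !mxE mulrC (tnth_nth 0).
have LE (v : 'cV_n) : L *m v = \col_i coord b i v.
  apply/matrixP=> i j; rewrite ord1 !mxE {2}[v]matrix_sum_delta linear_sum.
  by apply: eq_bigr => l _; rewrite big_ord1 linearZ /= !mxE mulrC.
have iB : into W B.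
  move=> v; rewrite BE; apply: memv_suml => j _; apply/memvZ/vbasis_mem.
  by rewrite mem_nth // size_tuple.
have BL v : v \in W -> B *m (L *m v) = v.
  move=> vW; rewrite BE [RHS](coord_vbasis vW).
  by apply: eq_bigr => j _; rewrite LE mxE.
have LB : L *m B = 1%:M.
  apply: eq_colmx => v; rewrite -mulmxA mul1mx LE BE; apply/matrixP=> i j.
  rewrite ord1 mxE coord_sum_free //; exact: basis_free (vbasisP W).
have QB h : h \in H -> B *m (L *m (Q h *m B)) = Q h *m B.
  move=> Hh; apply: eq_colmx => v; rewrite -!mulmxA.
  by rewrite BL //; apply: sW => //; apply: iB.
pose rf h := L *m (Q h *m B).
have rP : mx_repr H rf.
  split=> [|g h Hg Hh]; first by rewrite /rf repr_mx1 mul1mx.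
  by rewrite /rf repr_mxM // -!mulmxA QB // -!mulmxA.
pose r := MxRepresentation rP.
have hB : hom Q r B by move=> h Hh; rewrite /= QB.
have d0 : (0 < d)%N by rewrite lt0n dimv_eq0; apply/eqP.
exists (Representation r), B; split=> //; last first.
- move=> B0; apply: Wn0; apply/eqP; rewrite -subv0; apply/subvP=> v vW.
  by rewrite memv0 -[v]BL // B0 mul0mx.
- by move=> v; apply: (subvP WU).
apply/mx_irrP; split=> //= M modM Mn0; apply: contrapT => /negP nfull.
pose K := vs [set v : 'cV_d | M *m v = 0].
have inK v : (v \in K) <-> M *m v = 0.
  apply: in_vs; split=> [|a x y /= Mx My] /=; first by rewrite mulmx0.
  by rewrite mulmxDr -scalemxAr Mx My scaler0 addr0.
pose W' := (linfun (mulmx B) @: K)%VS.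
have inW' w : (w \in W') <-> exists2 v, v \in K & w = B *m v.
  split=> [/memv_imgP[v vK ->]|[v vK ->]]; first by exists v; rewrite ?lfunE.
  by apply/memv_imgP; exists v; rewrite ?lfunE.
have sW' : stab Q W'.
  move=> h _ Hh /inW'[v /inK Mv ->]; apply/inW'; exists (r h *m v).
    apply/inK; have /submxP[D e] := mxmoduleP modM h Hh.
    by rewrite mulmxA e -mulmxA Mv mulmx0.
  by rewrite mulmxA (hB h Hh) -mulmxA.
have W'W : (W' <= W)%VS by apply/subvP=> _ /inW'[v _ ->]; apply: iB.
have Binj (v : 'cV_d) : B *m v = 0 -> v = 0.
  by move=> Bv; rewrite -[v]mul1mx -LB -mulmxA Bv mulmx0.
have W'n0 : W' <> 0%VS.
  move=> W'0; case/negP: nfull; rewrite /row_full -mxrank_tr -/(row_free M^T).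
  rewrite -kermx_eq0 -submx0; apply/rV_subP=> w /sub_kermxP wM.
  rewrite submx0; apply/eqP; rewrite -[w]trmxK; suff -> : w^T = 0 by rewrite trmx0.
  apply: Binj; apply/eqP; rewrite -memv0 -W'0; apply/inW'; exists w^T => //.
  by apply/inK; rewrite -[M]trmxK -trmx_mul wM trmx0.
have W'E := mink _ sW' W'W W'n0.
case/eqP: Mn0; apply: eq_colmx => v; rewrite mul0mx; apply/inK.
have /inW'[v' v'K e] : B *m v \in W' by rewrite W'E.
suff -> : v = v' by [].
by rewrite -[v]mul1mx -LB -mulmxA e mulmxA LB mul1mx.
Qed.

Lemma mult_rsim n (Q : rep n) d1 (r1 : rep d1) d2 (r2 : rep d2) U :
  mx_rsim r1 r2 -> mult Q r1 U = mult Q r2 U.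
Proof.
have le d1' (s1 : rep d1') d2' (s2 : rep d2') :
    mx_rsim s1 s2 -> (mult Q s1 U <= mult Q s2 U)%N.
  case=> B _ freeB homB.
  apply: (@dim_inj _ _ _ (mulmxr B)) => [A _ /= AB0|A /in_HomTo[hA iA]] /=.
    by apply: (row_free_inj freeB); rewrite mul0mx.
  apply/in_HomTo; split; last exact: into_mul.
  by apply: hom_mul hA _ => h Hh; apply: homB.
by move=> sim; apply/eqP; rewrite eqn_leq !le //; apply: mx_rsim_sym.
Qed.

Lemma mult_dadd n (Q : rep n) (r1 r2 : representation C H) U :
  mult Q (dadd_grepr r1 r2) U = (mult Q r1 U + mult Q r2 U)%N.
Proof.
pose E := HomTo Q (dadd_grepr r1 r2) U.
pose N := vs [set A | A \in E /\ rsubmx A = 0].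
have inN A : (A \in N) <-> A \in E /\ rsubmx A = 0.
  apply: in_vs; split=> [|a A1 A2 [h1 e1] [h2 e2]]; first by split; rewrite ?mem0v ?linear0.
  by split; rewrite ?memvD ?memvZ // linearP /= e1 e2 scaler0 addr0.
have EP A1 A2 : (row_mx A1 A2 \in E) <-> (A1 \in HomTo Q r1 U) /\ (A2 \in HomTo Q r2 U).
  split=> [/in_HomTo[hA iA]|[/in_HomTo[h1 i1] /in_HomTo[h2 i2]]].
    split; apply/in_HomTo; split.
    + move=> h Hh; have := hA h Hh; rewrite /= mul_mx_row mul_row_block !mulmx0 addr0 add0r.
      by case/eq_row_mx.
    + by move=> v; have := iA (col_mx v 0); rewrite mul_row_col mulmx0 addr0.
    + move=> h Hh; have := hA h Hh; rewrite /= mul_mx_row mul_row_block !mulmx0 addr0 add0r.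
      by case/eq_row_mx.
    + by move=> v; have := iA (col_mx 0 v); rewrite mul_row_col mulmx0 add0r.
  apply/in_HomTo; split=> [h Hh|v].
    by rewrite /= mul_mx_row mul_row_block !mulmx0 addr0 add0r h1 ?h2.
  by rewrite -[v]vsubmxK mul_row_col memvD.
have dN : \dim N = mult Q r1 U.
  rewrite (@dim_exact _ _ _ lsubmx N 0%VS (HomTo Q r1 U)) ?dimv0 //.
  - move=> A; rewrite memv0; split=> [/eqP ->|[/inN[_ rA] lA]].
      by rewrite linear0 mem0v.
    by rewrite -[A]hsubmxK lA rA row_mx0.
  - by move=> A /inN[]; rewrite -{1}[A]hsubmxK => /EP[].
  - move=> A hA; exists (row_mx A 0); last by rewrite /= row_mxKl.
    by apply/inN; split; [apply/EP; rewrite mem0v|rewrite row_mxKr].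
rewrite -dN; apply: (@dim_exact _ _ _ rsubmx) => [A|A|A hA] /=.
- exact: inN.
- by rewrite -{1}[A]hsubmxK => /EP[].
- by exists (row_mx 0 A); [apply/EP; rewrite mem0v|rewrite row_mxKr].
Qed.

Lemma mult_grepr0 n (Q : rep n) U : mult Q (grepr0 : representation C H) U = 0%N.
Proof.
apply/eqP; rewrite dimv_eq0 -subv0; apply/subvP=> A _.
by rewrite memv0; apply/eqP; apply: thinmx0.
Qed.

(** An equivariant map from r to the regular representation is determined by
    one row, which is arbitrary. *)
Lemma mult_regular d (r : rep d) : mult (regular_repr C H) r fullv = d.
Proof.
transitivity (\dim (fullv : {vspace 'rV[C]_d})); last by rewrite dimvf dim_matrix mul1r.
pose o := gring_index H 1%g.
have rowEH (A : 'M[C]_(_, d)) h : h \in H ->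
    row o (regular_repr C H h *m A) = row (gring_index H h) A.
  move=> Hh; rewrite row_mul rowK gring_indexK // mul1g.
  by rewrite -rowE.
rewrite /mult (@dim_exact _ _ _ (row o) _ 0%VS fullv) ?dimv0 //.
- move=> A; rewrite memv0; split=> [/eqP ->|[/in_HomTo[hA _] A0]].
    by rewrite mem0v linear0.
  apply/eqP/row_matrixP => i; rewrite linear0.
  rewrite -(gring_valK i) -rowEH ?enum_valP // hA ?enum_valP //.
  by rewrite row_mul A0 mul0mx.
- by move=> A _; rewrite memvf.
move=> w _; exists (\matrix_i (w *m r (enum_val i))); last first.
  by rewrite /= rowK gring_indexK // repr_mx1 mulmx1.
apply/in_HomTo; split=> [h Hh|v]; last exact: memvf.
apply/row_matrixP => i; rewrite !row_mul !rowK -rowE rowK.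
by rewrite gring_indexK ?groupM ?enum_valP // repr_mxM ?enum_valP // mulmxA.
Qed.

End Irreducible.

(** * Tensor products with a two-dimensional representation *)

Section TensorIndex.
Variable K : fieldType.

Lemma tidx_proof d m (i : 'I_d) (k : 'I_m) : (i * m + k < d * m)%N.
Proof.
by rewrite (leq_trans (n := i.+1 * m)) ?leq_mul2r ?ltn_ord ?orbT // mulSn addnC ltn_add2r.
Qed.

(** The place of the pair (i, k) in the indexing of Kronecker products. *)
Definition tidx d m (i : 'I_d) (k : 'I_m) : 'I_(d * m) :=
  Ordinal (tidx_proof i k).

Lemma tidx0 d m k : tidx (lshift d ord0 : 'I_(1 + d)) k = lshift (d * m) k :> 'I_(m + d * m).
Proof. exact: val_inj. Qed.

Lemma tidxS d m (i : 'I_d) k :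
  tidx (rshift 1 i) k = rshift m (tidx i k) :> 'I_(m + d * m).
Proof. by apply: val_inj; rewrite /= mulSn addnA. Qed.

Lemma trow_idx n1 (A : 'rV[K]_n1) m2 n2 (B : 'M[K]_(m2, n2)) k j l :
  trow A B k (tidx j l) = A 0 j * B k l.
Proof.
elim: n1 A j => [|n1 IH] A; first by case.
rewrite -[n1.+1]/(1 + n1)%N in A * => j; rewrite -(splitK j).
case: (split j) => [j'|j'] /=.
  by rewrite (ord1 j') tidx0 row_mxEl !mxE; congr (A _ _ * _); apply: val_inj.
by rewrite tidxS row_mxEr IH mxE.
Qed.

Lemma tprod_idx m1 n1 (A : 'M[K]_(m1, n1)) m2 n2 (B : 'M[K]_(m2, n2)) i k j l :
  tprod A B (tidx i k) (tidx j l) = A i j * B k l.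
Proof.
elim: m1 A i => [|m1 IH] A; first by case.
rewrite -[m1.+1]/(1 + m1)%N in A * => i; rewrite -(splitK i).
case: (split i) => [i'|i'] /=.
  by rewrite (ord1 i') tidx0 col_mxEu trow_idx mxE.
by rewrite tidxS col_mxEd IH mxE.
Qed.

Lemma sum_tidx (W : zmodType) d m (F : 'I_(d * m) -> W) :
  \sum_t F t = \sum_i \sum_k F (tidx i k).
Proof.
elim: d F => [|d IH] F; first by rewrite !big_ord0.
rewrite -[d.+1]/(1 + d)%N in F *; rewrite [LHS](@big_split_ord _ _ _ m (d * m)) /=.
rewrite [RHS](@big_split_ord _ _ _ 1 d) /= big_ord1; congr (_ + _).
  by apply: eq_bigr => k _; congr F; apply: val_inj.
by rewrite IH; apply: eq_bigr => i _; apply: eq_bigr => k _; rewrite -tidxS.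
Qed.

(** A map defined on a tensor product with an m-dimensional space is a family
    of m maps. *)
Definition blk n d m (k : 'I_m) (B : 'M[K]_(n, d * m)) : 'M[K]_(n, d) :=
  \matrix_(a, j) B a (tidx j k).

Lemma blk_eq n d m (B B' : 'M[K]_(n, d * m)) :
  (forall k, blk k B = blk k B') -> B = B'.
Proof.
move=> eqB; apply/matrixP=> a t.
have m0 : (0 < m)%N by case: m t {B B' eqB} => // -[t]; rewrite muln0.
have dt : (t %/ m < d)%N by rewrite ltn_divLR.
have -> : t = tidx (Ordinal dt) (Ordinal (ltn_pmod t m0)).
  by apply: val_inj; rewrite /= -divn_eq.
by have /matrixP/(_ a (Ordinal dt)) := eqB (Ordinal (ltn_pmod t m0)); rewrite !mxE.
Qed.

Lemma blk_mul n p d m k (A : 'M[K]_(p, n)) (B : 'M[K]_(n, d * m)) :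
  blk k (A *m B) = A *m blk k B.
Proof. by apply/matrixP=> a j; rewrite !mxE; apply: eq_bigr => b _; rewrite !mxE. Qed.

Lemma blk_tprod n d m l (B : 'M[K]_(n, d * m)) (A : 'M[K]_d) (D : 'M[K]_m) :
  blk l (B *m tprod A D) = \sum_k D k l *: (blk k B *m A).
Proof.
apply/matrixP=> a j; rewrite !mxE sum_tidx summxE exchange_big /=.
apply: eq_bigr => k _; rewrite !mxE mulr_sumr; apply: eq_bigr => i _.
by rewrite tprod_idx !mxE mulrA mulrC.
Qed.

Definition unblk n d m (F : 'I_m -> 'M[K]_(n, d)) : 'M[K]_(n, d * m) :=
  \sum_k \sum_(j < d) \matrix_(a, t) (F k a j *+ (t == tidx j k)).

Lemma tidx_inj d m (i i' : 'I_d) (k k' : 'I_m) :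
  (tidx i k == tidx i' k') = (i == i') && (k == k').
Proof.
apply/eqP/andP => [e|[/eqP -> /eqP ->] //].
have m0 : (0 < m)%N by case: m k {k' e} => // -[].
have := congr1 (fun t : 'I_(d * m) => (t %/ m, t %% m)%N) e.
rewrite /= !divnMDl // !modnMDl !divn_small // !modn_small // !addn0.
by case=> ei ek; split; apply/eqP/val_inj.
Qed.

Lemma unblkK n d m (F : 'I_m -> 'M[K]_(n, d)) k : blk k (unblk F) = F k.
Proof.
apply/matrixP=> a j; rewrite !mxE summxE (bigD1 k) //= summxE (bigD1 j) //=.
rewrite !mxE eqxx mulr1n big1 => [|j' nj]; last first.
  by rewrite mxE tidx_inj eq_sym (negPf nj).
rewrite addr0 big1 ?addr0 // => k' nk; rewrite summxE big1 // => j' _.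
by rewrite mxE tidx_inj [k == _]eq_sym (negPf nk) andbF.
Qed.

End TensorIndex.

Section Twist.
Variables (C : numClosedFieldType) (gT : finGroupType) (H : {group gT}).
Local Notation rep := (mx_representation C H).
Variable rH : rep 2.
Hypothesis det_rH : forall h, h \in H -> \det (rH h) = 1.

Lemma det2 (A : 'M[C]_2) : \det A = A 0 0 * A 1 1 - A 0 1 * A 1 0.
Proof.
rewrite (expand_det_row _ 0) !big_ord_recl big_ord0 /cofactor !det_mx11 !mxE /=.
rewrite addr0 expr0 mul1r expr1 mulN1r mulrN.
by congr (_ * A _ _ - A _ _ * A _ _); apply: val_inj.
Qed.

Lemma mod1 m k (a b c d : C) (p q : 'M[C]_(m, k)) : a * d - b * c = 1 ->
  a *: (b *: p + d *: q) - b *: (a *: p + c *: q) = q /\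
  c *: (b *: p + d *: q) - d *: (a *: p + c *: q) = - p.
Proof.
move=> e; split; apply/matrixP=> i j; rewrite !mxE.
  by transitivity ((a * d - b * c) * q i j); [ring|rewrite e mul1r].
by transitivity (- ((a * d - b * c) * p i j)); [ring|rewrite e mul1r].
Qed.

Section One.
Variables (n : nat) (Q : rep n).

(** A vector (f, g) of twist stands for f tensor x + g tensor y, where H acts
    on the linear forms x and y through rH. *)
Definition twist_mx h : 'M[C]_(n + n) :=
  block_mx (rH h 0 0 *: Q h) (rH h 0 1 *: Q h) (rH h 1 0 *: Q h) (rH h 1 1 *: Q h).

Lemma twist_repr : mx_repr H twist_mx.
Proof.
split=> [|g h Hg Hh]; rewrite /twist_mx.
  by rewrite !repr_mx1 !mxE /= !scale1r !scale0r -scalar_mx_block.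
rewrite mulmx_block !repr_mxM // !mxE !big_ord_recl !big_ord0 !addr0.
have -> : lift 0 0 = 1 :> 'I_2 by apply: val_inj.
by congr block_mx; rewrite -!scalemxAl -!scalemxAr !scalerA -scalerDl.
Qed.
Definition twist := MxRepresentation twist_repr.

Definition dbl (A : {vspace 'cV[C]_n}) : {vspace 'cV[C]_(n + n)} :=
  vs [set v | usubmx v \in A /\ dsubmx v \in A].

Lemma in_dbl A v : (v \in dbl A) <-> usubmx v \in A /\ dsubmx v \in A.
Proof.
apply: in_vs; split=> [|a u w [h1 h2] [h3 h4]] /=.
  by rewrite !linear0 !mem0v.
by rewrite !linearP /= !memvD ?memvZ.
Qed.

Lemma stab_dbl A : stab Q A -> stab twist (dbl A).
Proof.
move=> sA h v Hh /in_dbl[uA dA]; apply/in_dbl.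
rewrite /= /twist_mx -[v]vsubmxK mul_block_col col_mxKu col_mxKd.
by rewrite -!scalemxAl !memvD ?memvZ ?sA.
Qed.

Lemma hom_twistP d (r : rep d) f g :
  hom twist r (col_mx f g) <-> forall h, h \in H ->
    f *m r h = rH h 0 0 *: (Q h *m f) + rH h 0 1 *: (Q h *m g) /\
    g *m r h = rH h 1 0 *: (Q h *m f) + rH h 1 1 *: (Q h *m g).
Proof.
split=> hA h Hh; have := hA h Hh; rewrite /= /twist_mx mul_block_col mul_col_mx -!scalemxAl.
  by case/eq_col_mx => <- <-.
by case=> -> ->.
Qed.

(** Since rH has determinant 1 it is self-dual, so that maps from r tensor rH
    to Q correspond to maps from r to Q tensor rH. The symplectic form
    exchanges the two components, which accounts for the sign. *)
Lemma mult_twist d (r : rep d) A :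
  mult Q (prod_repr r rH) A = mult twist r (dbl A).
Proof.
pose F (B : 'M[C]_(n, d * 2)) := col_mx (blk 1 B) (- blk 0 B).
have linF : linear F.
  move=> a u v; rewrite /F scale_col_mx add_col_mx; congr col_mx.
    by apply/matrixP=> i j; rewrite !mxE.
  by apply/matrixP=> i j; rewrite !mxE mulrN opprD.
pose FL : {linear _ -> _} := HB.pack F (GRing.isLinear.Build _ _ _ _ F linF).
have eq1 : lift ord0 ord0 = 1 :> 'I_2 by apply: val_inj.
rewrite /mult (@dim_exact _ _ _ FL _ 0%VS (HomTo twist r (dbl A))) ?dimv0 //.
- move=> B; rewrite memv0; split=> [/eqP ->|[_ FB0]]; first by rewrite mem0v linear0.
  apply/eqP/blk_eq => k; have: F B = col_mx 0 0 by rewrite -[LHS]/(FL B) FB0 col_mx0.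
  case/eq_col_mx => b1 /eqP; rewrite oppr_eq0 => /eqP b0.
  have z l : blk l (0 : 'M[C]_(n, d * 2)) = 0 by apply/matrixP=> i j; rewrite !mxE.
  by rewrite z; case: k => [[|[|//]] kp]; [rewrite -[RHS]b0|rewrite -[RHS]b1]; congr (blk _ B); apply: val_inj.
- move=> B /in_HomTo[hB iB]; apply/in_HomTo; split; last first.
    have iblk k : into A (blk k B).
      apply: into_delta => j.
      have -> : blk k B *m delta_mx j (0 : 'I_1) = B *m delta_mx (tidx j k) 0.
        by rewrite -!colE; apply/matrixP => a b; rewrite !mxE.
      exact: iB.
    move=> v; apply/in_dbl; rewrite mul_col_mx col_mxKu col_mxKd.
    by rewrite mulNmx memvN; split; apply: iblk.
  apply/hom_twistP => h Hh; have := det_rH Hh; rewrite det2 => dh.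
  have bl l : Q h *m blk l B = rH h 0 l *: (blk 0 B *m r h) + rH h 1 l *: (blk 1 B *m r h).
    rewrite -blk_mul hB //= blk_tprod !big_ord_recl big_ord0 addr0.
    by rewrite eq1.
  have [e1 e0] := mod1 (blk 0 B *m r h) (blk 1 B *m r h) dh.
  by rewrite mulmxN !bl mulNmx !scalerN e1 e0.
- move=> B; rewrite -[B]vsubmxK; set f := usubmx B; set g := dsubmx B.
  move=> /in_HomTo[/hom_twistP hB iB].
  exists (unblk (fun k : 'I_2 => if k == 0 then - g else f)); last first.
    by rewrite /= /F !unblkK /= opprK.
  apply/in_HomTo; split; last first.
    have ifg (k : 'I_2) : into A (if k == 0 then - g else f).
      move=> v; have := iB v; rewrite mul_col_mx => /in_dbl.
      by rewrite col_mxKu col_mxKd; case: ifP => _ [] //; rewrite mulNmx memvN.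
    apply: into_delta => t; rewrite -colE.
    have -> : col t (unblk (fun k : 'I_2 => if k == 0 then - g else f)) =
      \sum_k \sum_(j < d) (t == tidx j k)%:R *: col j (if k == 0 then - g else f).
      apply/matrixP=> a b; rewrite /unblk mxE !summxE; apply: eq_bigr => k _.
      rewrite !summxE; apply: eq_bigr => j _; rewrite !mxE.
      by rewrite mulr_natl.
    apply: memv_suml => k _; apply: memv_suml => j _; rewrite memvZ //.
    by rewrite colE ifg.
  move=> h Hh; have := det_rH Hh; rewrite det2 => dh; have [ef eg] := hB h Hh.
  apply: blk_eq => l; rewrite blk_mul /= blk_tprod !big_ord_recl big_ord0 addr0 !unblkK eq1 /=.
  have dh2 : rH h 1 1 * rH h 0 0 - rH h 0 1 * rH h 1 0 = 1 by rewrite [rH h 1 1 * _]mulrC.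
  have [e1 e0] := mod1 (Q h *m g) (Q h *m f) dh2.
  rewrite mulNmx ef eg !scalerN addrC ![_ *: (Q h *m f) + _]addrC.
  case: l => [[|[|//]] lp].
    have -> : Ordinal lp = 0 by apply: val_inj.
    by rewrite /= mulmxN -e0.
  have -> : Ordinal lp = 1 by apply: val_inj.
  by rewrite /= -[LHS]e1.
Qed.

End One.
End Twist.

(** * Representations labelled by the McKay graph *)

Definition lab_code (i : E7label) : nat :=
  match i with
  | rho_0 => 0 | rho_2 => 1 | rho_3 => 2 | rho_4 => 3
  | rho_3' => 4 | rho_2' => 5 | rho_1' => 6 | rho_2'' => 7
  end.

Lemma lab_code_inj : injective lab_code.
Proof. by case; case. Qed.

HB.instance Definition _ := Equality.copy E7label (inj_type lab_code_inj).

Section Family.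
Variables (C : numClosedFieldType) (gT : finGroupType) (H : {group gT}).
Local Notation rep := (mx_representation C H).
Variable rH : rep 2.
Hypothesis det_rH : forall h, h \in H -> \det (rH h) = 1.
Variable V : E7label -> representation C H.
Hypothesis hV : E7_labelling rH V.

Lemma V_irr i : mx_irreducible (V i).
Proof. by case: hV => h _ _ _ _; case: (h i). Qed.

Lemma V_deg i : rdegree (V i) = E7dim i.
Proof. by case: hV => h _ _ _ _; case: (h i). Qed.

Lemma mult_VV i j : mult (V i) (V j) fullv = (i == j).
Proof.
case: hV => _ inj _ _ _; have [<-|nij] := eqVneq i j.
  exact/mult_self/V_irr.
apply: mult_other; try exact: V_irr.
by move=> /inj; apply/eqP.
Qed.

Lemma mult_imgV n (Q : rep n) i j u :
  hom Q (V i) u -> u <> 0 -> mult Q (V j) (img u) = (i == j).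
Proof. by move=> hu u0; rewrite (mult_img _ (V_irr i) hu u0) mult_VV. Qed.

Lemma V_exists n (Q : rep n) U : stab Q U -> U <> 0%VS ->
  exists i, (0 < mult Q (V i) U)%N.
Proof.
move=> sU U0; have [r [u [irr hu iu u0]]] := irr_exists sU U0.
case: hV => _ _ compl _ _; have [i sim] := compl r irr.
exists i; rewrite -(mult_rsim _ _ sim) lt0n dimv_eq0.
apply/eqP => e; apply: u0; apply/eqP; rewrite -memv0 -e.
exact/in_HomTo.
Qed.

Lemma mult_pos n (Q : rep n) d (r : rep d) U : (0 < mult Q r U)%N ->
  exists u, [/\ hom Q r u, into U u & u <> 0].
Proof.
rewrite lt0n dimv_eq0 => n0; have /in_HomTo[hu iu] := memv_pick (HomTo Q r U).
by exists (vpick (HomTo Q r U)); split=> //; apply/eqP; rewrite vpick0.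
Qed.

(** Otherwise a complement of the intersection of U and W in U would contain a
    copy of some V i. *)
Lemma HomTo_sub n (Q : rep n) U W : stab Q U -> stab Q W ->
  (forall i, (HomTo Q (V i) U <= HomTo Q (V i) W)%VS) -> (U <= W)%VS.
Proof.
move=> sU sW UW; have [D [sD defU tiD]] := compl_exists (stabI sU sW) sU (capvSl U W).
apply: contrapT => nUW; have D0 : D <> 0%VS.
  by move=> D0; apply: nUW; rewrite -defU D0 addv0 capvSr.
have [i /mult_pos[u [hu iu u0]]] := V_exists sD D0.
apply: u0; apply: eq_colmx => v; rewrite mul0mx; apply/eqP.
rewrite -memv0 -tiD memv_cap iu andbT.
have uU : into U u by move=> w; rewrite -defU -[_ *m _]add0r memv_add ?mem0v.
have /in_HomTo uHU : hom Q (V i) u /\ into U u by [].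
by have /in_HomTo[_ iW] := subvP (UW i) _ uHU; rewrite memv_cap uU iW.
Qed.

Lemma mult_eq_sub n (Q : rep n) U W : stab Q U -> stab Q W -> (U <= W)%VS ->
  (forall i, mult Q (V i) U = mult Q (V i) W) -> U = W.
Proof.
move=> sU sW UW e; apply/eqP; rewrite eqEsubv UW; apply: (HomTo_sub sW sU) => i.
rewrite -(geq_leqif (dimv_leqif_sup (HomToS Q (V i) UW))).
by rewrite -[leqRHS]/(mult Q (V i) U) e.
Qed.

Lemma mult_big n (Q : rep n) (s : seq E7label) U :
  mult Q (\big[dadd_grepr/grepr0]_(j <- s) V j) U = (\sum_(j <- s) mult Q (V j) U)%N.
Proof.
elim: s => [|j s IH]; first by rewrite !big_nil mult_grepr0.
by rewrite !big_cons mult_dadd IH.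
Qed.

(** The McKay graph computes the multiplicities in a tensor product with rH. *)
Lemma mult_pairs n (Q : rep n) i A :
  mult (twist rH Q) (V i) (dbl A) = (\sum_(j <- E7neighbours i) mult Q (V j) A)%N.
Proof.
rewrite -mult_big -mult_twist //; apply: mult_rsim.
by case: hV => _ _ _ _; apply.
Qed.

Lemma left_inverse n (Q : rep n) d (r : rep d) u : mx_irreducible r ->
  hom Q r u -> u <> 0 -> exists L, hom r Q L /\ L *m u = 1%:M.
Proof.
move=> irr hu u0.
have uinj (v : 'cV_d) : u *m v = 0 -> v = 0.
  move=> uv; apply: (irr_inj irr hu (@stab0 _ _ _ _ Q)); last by rewrite uv mem0v.
  move=> iu; apply: u0; apply: eq_colmx => w; rewrite mul0mx.
  by apply/eqP; rewrite -memv0.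
have: row_free u^T.
  rewrite -kermx_eq0 -submx0; apply/rV_subP=> w /sub_kermxP wu.
  rewrite submx0; apply/eqP; rewrite -[w]trmxK [w^T]uinj ?trmx0 //.
  by rewrite -[u]trmxK -trmx_mul wu trmx0.
case/row_freeP => B uB; have Bu : B^T *m u = 1%:M.
  by rewrite -[u]trmxK -trmx_mul uB trmx1.
exists (avg r Q B^T); split; first exact: avg_hom.
rewrite -scalemxAl mulmx_suml (eq_bigr (fun=> 1%:M)) => [|h Hh].
  by rewrite sumr_const -scaler_nat scalerA mulVf ?cardH_neq0 ?scale1r.
rewrite -!mulmxA hu ?groupV // [B^T *m _]mulmxA Bu mul1mx.
by rewrite -repr_mxM ?groupV // mulgV repr_mx1.
Qed.

Lemma split_off n (Q : rep n) d (r : rep d) u L U :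
    hom Q r u -> into U u -> hom r Q L -> L *m u = 1%:M -> stab Q U ->
  exists U', [/\ stab Q U', forall x, (x \in U') <-> x \in U /\ L *m x = 0,
    (img u + U' = U)%VS & (img u :&: U' = 0)%VS].
Proof.
move=> hu iu hL Lu sU; pose U' := vs [set x | x \in U /\ L *m x = 0].
have inU' x : (x \in U') <-> x \in U /\ L *m x = 0.
  apply: in_vs; split=> [|a y z [yU Ly] [zU Lz]].
    by split; rewrite ?mem0v ?mulmx0.
  by split; rewrite ?memvD ?memvZ // mulmxDr -scalemxAr Ly Lz scaler0 addr0.
exists U'; split=> //.
- move=> h x Hh /inU'[xU Lx]; apply/inU'; split; first exact: sU.
  by rewrite mulmxA -hL // -mulmxA Lx mulmx0.
- apply/eqP; rewrite eqEsubv subv_add; apply/andP; split.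
    by apply/andP; split; [apply/img_into|apply/subvP=> x /inU'[]].
  apply/subvP=> x xU; rewrite -[x](subrK (u *m (L *m x))) addrC memv_add //.
    by apply/in_img; exists (L *m x).
  apply/inU'; split; first by rewrite memvB.
  by rewrite mulmxBr [L *m (u *m _)]mulmxA Lu mul1mx subrr.
- apply/eqP; rewrite -subv0; apply/subvP=> x /memv_capP[/in_img[v ->] /inU'[_]].
  by rewrite mulmxA Lu mul1mx => ->; rewrite mulmx0 mem0v.
Qed.

(** Two stable subspaces with the same multiplicities are isomorphic: match
    the irreducible constituents one by one. *)
Lemma iso_of_mult n (Q : rep n) m (P : rep m) U W :
    stab Q U -> stab P W -> (forall i, mult Q (V i) U = mult P (V i) W) ->
  exists F, [/\ hom P Q F, forall x, x \in U -> F *m x \in W,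
    forall y, y \in W -> exists2 x, x \in U & F *m x = y
    & forall x, x \in U -> F *m x = 0 -> x = 0].
Proof.
have [k] := ubnP (\dim U); elim: k U W => // k IH U W; rewrite ltnS => dU sU sW eUW.
have [U0|/eqP U0] := eqVneq U 0%VS.
  have W0 : W = 0%VS.
    apply: contrapT => Wn0; have [j] := V_exists sW Wn0.
    by rewrite -eUW U0 mult0.
  rewrite U0 W0; exists 0; split.
  - by move=> h Hh; rewrite mulmx0 mul0mx.
  - by move=> x _; rewrite mul0mx mem0v.
  - by move=> y; rewrite memv0 => /eqP ->; exists 0; rewrite ?mem0v ?mulmx0.
  - by move=> x; rewrite memv0 => /eqP.
have [i mi] := V_exists sU U0; have [u [hu iu u0]] := mult_pos mi.
rewrite eUW in mi; have [w [hw iw w0]] := mult_pos mi.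
have [L [hL Lu]] := left_inverse (V_irr i) hu u0.
have [M [hM Mw]] := left_inverse (V_irr i) hw w0.
have [U' [sU' inU' defU tiU]] := split_off hu iu hL Lu sU.
have [W' [sW' inW' defW tiW]] := split_off hw iw hM Mw sW.
have du : (0 < \dim (img u))%N.
  rewrite lt0n dimv_eq0; apply/eqP => e; apply: u0; apply: eq_colmx => v.
  by rewrite mul0mx; apply/eqP; rewrite -memv0 -e; apply/in_img; exists v.
have dU' : (\dim U' < k)%N.
  apply: leq_trans dU; rewrite -defU dimv_disjoint_sum //.
  by rewrite -[X in (X < _)%N]add0n ltn_add2r.
have eUWp j : mult Q (V j) U' = mult P (V j) W'.
  have := eUW j; rewrite -defU -defW !mult_add //; try by [apply: stab_img hu | apply: stab_img hw].
  by rewrite (mult_imgV j hu u0) (mult_imgV j hw w0); apply: addnI.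
have [F [hF FU surjF injF]] := IH U' W' dU' sU' sW' eUWp.
pose G := F *m (1%:M - u *m L) + w *m L.
have Gu (a : 'cV_(rdegree (V i))) : G *m (u *m a) = w *m a.
  rewrite /G mulmxDl -!mulmxA [L *m _]mulmxA Lu mul1mx mulmxBl mul1mx -mulmxA.
  by rewrite [L *m _]mulmxA Lu mul1mx subrr mulmx0 add0r.
have GU' x : x \in U' -> G *m x = F *m x.
  move=> /inU'[_ Lx]; rewrite /G mulmxDl -!mulmxA Lx mulmx0 addr0.
  by rewrite mulmxBl mul1mx -mulmxA Lx mulmx0 subr0.
have splU x : x \in U -> exists2 x', x' \in U' & x = u *m (L *m x) + x'.
  move=> xU; exists (x - u *m (L *m x)); last by rewrite addrC subrK.
  apply/inU'; split; first by rewrite memvB.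
  by rewrite mulmxBr [L *m (u *m _)]mulmxA Lu mul1mx subrr.
have W'W y : y \in W' -> y \in W by move=> /inW'[].
exists G; split.
- move=> h Hh; rewrite /G mulmxDr mulmxDl; congr (_ + _).
    rewrite mulmxA hF // -!mulmxA; congr (_ *m _).
    by rewrite mulmxBr mulmxBl mulmx1 mul1mx -mulmxA -hL // !mulmxA hu.
  by rewrite mulmxA hw // -!mulmxA hL.
- move=> x /splU[x' x'U ->]; rewrite mulmxDr Gu GU' // memvD //; exact/W'W/FU.
- move=> y yW; have y'W : y - w *m (M *m y) \in W'.
    apply/inW'; split; first by rewrite memvB.
    by rewrite mulmxBr [M *m (w *m _)]mulmxA Mw mul1mx subrr.
  have [x' x'U' e] := surjF _ y'W.
  exists (u *m (M *m y) + x').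
    by rewrite memvD //; case/inU': x'U'.
  by rewrite mulmxDr Gu GU' // e addrC subrK.
- move=> x /splU[x' x'U ex] Gx.
  have e : w *m (L *m x) + F *m x' = 0 by rewrite -Gu -GU' // -mulmxDr -ex.
  have Lx0 : L *m x = 0.
    have := congr1 (mulmx M) e; rewrite mulmxDr mulmx0 mulmxA Mw mul1mx.
    by have /inW'[_ ->] := FU _ x'U; rewrite addr0.
  rewrite ex Lx0 mulmx0 add0r; apply: injF => //.
  by rewrite Lx0 mulmx0 add0r in e.
Qed.

End Family.

(** * The Koszul complex *)

Section Koszul.
Variables (C : numClosedFieldType) (gT : finGroupType) (H : {group gT}).
Local Notation rep := (mx_representation C H).
Variable rH : rep 2.
Hypothesis det_rH : forall h, h \in H -> \det (rH h) = 1.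
Variable V : E7label -> representation C H.
Hypothesis hV : E7_labelling rH V.
Variables (n : nat) (Q : rep n) (X Y : 'M[C]_n).
Hypothesis XY : X *m Y = Y *m X.
Hypothesis QX : forall h, h \in H ->
  Q h *m X = (rH h 0 0 *: X + rH h 1 0 *: Y) *m Q h.
Hypothesis QY : forall h, h \in H ->
  Q h *m Y = (rH h 0 1 *: X + rH h 1 1 *: Y) *m Q h.

(** With X and Y the multiplications by x and y, this is the product of A by
    the ideal (x, y). *)
Definition mulV (A : {vspace 'cV[C]_n}) : {vspace 'cV[C]_n} :=
  (linfun (mulmx X) @: A + linfun (mulmx Y) @: A)%VS.

Lemma in_mulV A v :
  (v \in mulV A) <-> exists a b, [/\ a \in A, b \in A & v = X *m a + Y *m b].
Proof.
split=> [/memv_addP[_ /memv_imgP[a aA ->] [_ /memv_imgP[b bA ->] ->]]|[a [b [aA bA ->]]]].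
  by exists a, b; rewrite !lfunE.
by rewrite memv_add //; apply/memv_imgP; [exists a|exists b]; rewrite ?lfunE.
Qed.

Lemma mulV_X (A : {vspace 'cV[C]_n}) (v : 'cV[C]_n) : v \in A -> X *m v \in mulV A.
Proof. by move=> vA; apply/in_mulV; exists v, 0; rewrite mulmx0 addr0 mem0v. Qed.

Lemma mulV_Y (A : {vspace 'cV[C]_n}) (v : 'cV[C]_n) : v \in A -> Y *m v \in mulV A.
Proof. by move=> vA; apply/in_mulV; exists 0, v; rewrite mulmx0 add0r mem0v. Qed.

Lemma mulVS A B : (A <= B)%VS -> (mulV A <= mulV B)%VS.
Proof. by move=> AB; rewrite /mulV addvS ?limgS. Qed.

Lemma stab_mulV A : stab Q A -> stab Q (mulV A).
Proof.
move=> sA h _ Hh /in_mulV[a [b [aA bA ->]]].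
rewrite mulmxDr !mulmxA QX // QY // !mulmxDl -!scalemxAl -!mulmxA.
by rewrite !memvD // memvZ // ?mulV_X ?mulV_Y ?sA.
Qed.

Definition colon (A : {vspace 'cV[C]_n}) : {vspace 'cV[C]_n} :=
  vs [set v | X *m v \in A /\ Y *m v \in A].

Lemma in_colon A v : (v \in colon A) <-> X *m v \in A /\ Y *m v \in A.
Proof.
apply: in_vs; split=> [|a u w [h1 h2] [h3 h4]] /=; first by rewrite !mulmx0 mem0v.
by rewrite !mulmxDr -!scalemxAr !memvD ?memvZ.
Qed.

Lemma stab_colon A : stab Q A -> stab Q (colon A).
Proof.
move=> sA h v Hh /in_colon[Xv Yv]; have Hh' : h^-1%g \in H by rewrite groupV.
have QK w : Q h *m (Q h^-1%g *m w) = w.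
  by rewrite mulmxA -repr_mxM // mulgV repr_mx1 mul1mx.
have QVK w : Q h^-1%g *m (Q h *m w) = w.
  by rewrite mulmxA -repr_mxM // mulVg repr_mx1 mul1mx.
apply/in_colon; split.
  rewrite -[X *m _]QK [Q h^-1%g *m _]mulmxA QX // -mulmxA QVK mulmxDl -!scalemxAl.
  by apply: sA => //; rewrite memvD ?memvZ.
rewrite -[Y *m _]QK [Q h^-1%g *m _]mulmxA QY // -mulmxA QVK mulmxDl -!scalemxAl.
by apply: sA => //; rewrite memvD ?memvZ.
Qed.

Definition soc := colon 0%VS.

Lemma in_soc v : (v \in soc) <-> X *m v = 0 /\ Y *m v = 0.
Proof.
split=> [/in_colon|[Xv Yv]]; first by rewrite !memv0 => -[/eqP -> /eqP ->].
by apply/in_colon; rewrite Xv Yv mem0v.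
Qed.

Lemma hom_mulXY : hom Q (twist rH Q) (row_mx X Y).
Proof.
move=> h Hh; rewrite mul_mx_row QX // QY // /= /twist_mx mul_row_block.
by congr row_mx; rewrite mulmxDl -!scalemxAl -!scalemxAr.
Qed.

Lemma hom_koszul : hom (twist rH Q) Q (col_mx Y (- X)).
Proof.
move=> h Hh; have := det_rH Hh; rewrite det2 => dh.
rewrite /= /twist_mx mul_block_col mul_col_mx -!scalemxAl !mulmxN mulNmx QX // QY //.
rewrite !mulmxDl -!scalemxAl; set p := X *m Q h; set q := Y *m Q h.
have := @mod1 C _ _ (rH h 0 0) (rH h 0 1) (rH h 1 0) (rH h 1 1) p q dh.
by case=> e1 e2; congr col_mx; rewrite scalerN.
Qed.

(** Count V i in the Koszul complex W -> A^2 -> (x, y) A, whose maps are w |->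
    (Y w, - X w) and (f, g) |-> X f + Y g. The middle term is A tensor rH,
    which the McKay graph decomposes; the kernel of the first map is the part
    of the socle in W. Exactness in the middle is a hypothesis. *)
Lemma koszul_count i A W : stab Q A -> stab Q W -> (W <= colon A)%VS ->
    (forall f g, hom (twist rH Q) (V i) (col_mx f g) -> into A f -> into A g ->
       X *m f + Y *m g = 0 -> exists w, [/\ into W w, f = Y *m w & g = - (X *m w)]) ->
  (\sum_(j <- E7neighbours i) mult Q (V j) A + mult Q (V i) (W :&: soc)%VS
    = mult Q (V i) (mulV A) + mult Q (V i) W)%N.
Proof.
move=> sA sW /subvP WA exactW; rewrite -(mult_pairs det_rH hV).
pose N := vs [set v : 'cV[C]_(n + n) | v \in dbl A /\ row_mx X Y *m v = 0].
have inN v : (v \in N) <-> v \in dbl A /\ row_mx X Y *m v = 0.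
  apply: in_vs; split=> [|a u w [h1 e1] [h2 e2]]; first by split; rewrite ?mem0v ?mulmx0.
  by split; rewrite ?memvD ?memvZ // mulmxDr -scalemxAr e1 e2 scaler0 addr0.
rewrite (@mult_exact _ _ _ _ _ _ Q (row_mx X Y) (dbl A) N (mulV A)) //; first last.
- move=> _ /in_mulV[a [b [aA bA ->]]]; exists (col_mx a b); last by rewrite mul_row_col.
  by apply/in_dbl; rewrite col_mxKu col_mxKd.
- move=> v /in_dbl[uA dA]; rewrite -[v]vsubmxK mul_row_col; apply/in_mulV.
  by exists (usubmx v), (dsubmx v).
- exact: stab_dbl.
- exact: hom_mulXY.
pose I := (linfun (mulmx (col_mx Y (- X))) @: W)%VS.
have inI v : (v \in I) <-> exists2 w, w \in W & v = col_mx Y (- X) *m w.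
  split=> [/memv_imgP[w wW ->]|[w wW ->]]; first by exists w; rewrite ?lfunE.
  by apply/memv_imgP; exists w; rewrite ?lfunE.
rewrite (@mult_exact _ _ _ _ Q _ (twist rH Q) (col_mx Y (- X)) W (W :&: soc)%VS I) //; first last.
- by move=> v /inI[w wW ->]; exists w.
- by move=> u uW; apply/inI; exists u.
- move=> u; split=> [/memv_capP[uW /in_soc[Xu Yu]]|[uW]].
    by rewrite mul_col_mx mulNmx Xu Yu oppr0 col_mx0.
  rewrite mul_col_mx -[0]col_mx0 => /eq_col_mx[Yu /eqP].
  rewrite mulNmx oppr_eq0 => /eqP Xu; rewrite memv_cap uW /=.
  exact/in_soc.
- exact: hom_koszul.
suff -> : mult (twist rH Q) (V i) N = mult (twist rH Q) (V i) I by lia.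
rewrite /mult; congr (\dim _); apply/vspaceP=> B; rewrite -[B]vsubmxK.
set f := usubmx B; set g := dsubmx B.
apply/idP/idP => /in_HomTo[hB iB]; apply/in_HomTo; split=> //.
  have ifg v : [/\ f *m v \in A, g *m v \in A & X *m (f *m v) + Y *m (g *m v) = 0].
    have /inN[/in_dbl] := iB v.
    by rewrite mul_col_mx col_mxKu col_mxKd mul_row_col => -[].
  have [||| w [iw ef eg]] := exactW _ _ hB.
  - by move=> v; case: (ifg v).
  - by move=> v; case: (ifg v).
  - by apply: eq_colmx => v; rewrite mulmxDl -!mulmxA mul0mx; case: (ifg v).
  have eB : col_mx f g = col_mx Y (- X) *m w by rewrite mul_col_mx mulNmx -ef -eg.
  move=> v; rewrite -(avg_id hB) eB -(avg_mul _ _ hom_koszul) -mulmxA.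
  by apply/inI; exists (avg Q (V i) w *m v) => //; apply: avg_into.
move=> v; have /inI[w wW e] := iB v; apply/inN; rewrite e; split.
  have /WA/in_colon[Xw Yw] := wW.
  by apply/in_dbl; rewrite mul_col_mx col_mxKu col_mxKd mulNmx memvN.
by rewrite mul_col_mx mul_row_col mulNmx mulmxN !mulmxA XY subrr.
Qed.

End Koszul.

(** * Combinatorics of dimension vectors *)

Definition labels7 := [:: rho_2; rho_3; rho_4; rho_3'; rho_2'; rho_1'; rho_2''].

Lemma nbr_neq i j : j \in E7neighbours i -> (i == j) = false.
Proof. by case: i; case: j. Qed.

(** Dimension vectors are lists of multiplicities indexed by the labels, so
    that the arguments on them are computations. *)
Definition entry (b : seq nat) (i : E7label) : nat := nth 0%N b (lab_code i).
Definition nbr_sum (b : E7label -> nat) i := sumn (map b (E7neighbours i)).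
(** The multiplicity of V i in the socle of m/n, which is V rho_2 in degree
    17. *)
Definition delta2 (i : E7label) : nat := i == rho_2.
Definition lower (b : seq nat) i k := set_nth 0%N b (lab_code i) (entry b i - k)%N.
(** By the Koszul count, a submodule with dimension vector b has at least this
    number of copies of V i among its minimal generators. *)
Definition deficit (b : seq nat) i := ((entry b i).*2 - (nbr_sum (entry b) i + delta2 i))%N.

Definition first_deficient (b : seq nat) : E7label :=
  nth rho_0 labels7 (find (fun i => 0 < deficit b i)%N labels7).
Arguments first_deficient : simpl never.

(** Removing the generators predicted by the deficit leaves a submodule with a
    smaller dimension vector. No submodule has the vector b if repeating this
    step eventually predicts more generators V i than there are copies of V i.
    The fuel bounds the number of steps. *)
Fixpoint excluded fuel (b : seq nat) : bool :=
  if fuel is f.+1 then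
    let i := first_deficient b in
    (i != rho_0) && ((entry b i < deficit b i)%N || excluded f (lower b i (deficit b i)))
  else false.

Definition label_count (c : seq E7label) : seq nat :=
  [seq count_mem i c | i <- rho_0 :: labels7].

(** A chain lists the constituents of a submodule from its last generator to
    its socle. The conditions make each step unique: the larger vector forces
    exactly one new generator V i, and no generator of the smaller submodule
    is a V i. *)
Fixpoint chain_ok (c : seq E7label) : bool :=
  if c is i :: c' then
    [&& i != rho_0, (entry (label_count c) i).*2 == (nbr_sum (entry (label_count c)) i + delta2 i).+1,
        (entry (label_count c') i == 0)%N || excluded 60 (lower (label_count c') i 1) & chain_ok c']
  else true.

Definition tab_at (t : seq (seq nat)) (i : E7label) d : nat :=
  nth 0%N (nth [::] t (lab_code i)) d.

(** The number of V i in degree d of (K : m), computed degree by degree with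
    the Koszul count from the table t of the degrees of K. *)
Definition socdeg (t : seq (seq nat)) i d : nat :=
  if d == 17%N then delta2 i
  else (nbr_sum (fun j => tab_at t j d.+1) i - tab_at t i d.+2)%N.

Fixpoint deg_table (c : seq E7label) : seq (seq nat) :=
  if c is i :: c' then
    let t := deg_table c' in set_nth [::] t (lab_code i) (mkseq (socdeg t i) 18)
  else [::].

Lemma entry_lower b i k j : entry (lower b i k) j = if j == i then (entry b i - k)%N else entry b j.
Proof.
rewrite /entry /lower nth_set_nth /=.
by rewrite -(inj_eq lab_code_inj).
Qed.

Lemma entry_label_count c i : entry (label_count c) i = count_mem i c.
Proof. by case: i. Qed.

Lemma tab_at_cons (i : E7label) c j d : tab_at (deg_table (i :: c)) j d =
  if j == i then (if (d < 18)%N then socdeg (deg_table c) i d else 0%N) else tab_at (deg_table c) j d.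
Proof.
rewrite /tab_at /= nth_set_nth /= (inj_eq lab_code_inj).
case: (j == i) => //; case: ltnP => d18; first by rewrite nth_mkseq.
by rewrite nth_default ?size_mkseq.
Qed.

(** The irreducible constituents of m/n in degrees 0, ..., 17. *)
Definition coinv_table : seq (seq E7label) :=
  [:: [::]; [:: rho_2]; [:: rho_3]; [:: rho_4]; [:: rho_3'; rho_2''];
      [:: rho_4; rho_2']; [:: rho_3; rho_3'; rho_1']; [:: rho_2; rho_2'; rho_4];
      [:: rho_3; rho_3'; rho_2'']; [:: rho_4; rho_4]; [:: rho_3; rho_3'; rho_2''];
      [:: rho_2; rho_2'; rho_4]; [:: rho_3; rho_3'; rho_1']; [:: rho_4; rho_2'];
      [:: rho_3'; rho_2'']; [:: rho_4]; [:: rho_3]; [:: rho_2] ].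

Definition coinv_mult (i : E7label) d : nat := count_mem i (nth [::] coinv_table d).

(** A chain of submodules ending in the common part K_r of the ideals of E(r),
    found by computer; its dimension vector is dimv minus the vector of r. *)
Definition Kchain (r : E7label) : seq E7label :=
  rev ([:: rho_2; rho_3; rho_4; rho_2''; rho_3'; rho_2'] ++
  match r with
  | rho_0 => [::]
  | rho_2 => [:: rho_4; rho_3'; rho_3; rho_4; rho_2''; rho_1'; rho_2'; rho_3'; rho_4; rho_3]
  | rho_3 => [:: rho_4; rho_3'; rho_3; rho_4; rho_2''; rho_1'; rho_2'; rho_3'; rho_4; rho_2]
  | rho_4 => [:: rho_4; rho_3'; rho_3; rho_4; rho_2''; rho_1'; rho_2'; rho_3'; rho_2; rho_3]
  | rho_3' => [:: rho_4; rho_3'; rho_3; rho_4; rho_2''; rho_1'; rho_2'; rho_2; rho_3; rho_4]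
  | rho_2' => [:: rho_4; rho_3'; rho_3; rho_4; rho_2''; rho_1'; rho_2; rho_3; rho_4; rho_3']
  | rho_1' => [:: rho_4; rho_3'; rho_3; rho_4; rho_2''; rho_2; rho_3; rho_4; rho_3'; rho_2']
  | rho_2'' => [:: rho_1'; rho_4; rho_3'; rho_2'; rho_3; rho_4; rho_3'; rho_2; rho_3; rho_4]
  end).

(** The points of E(r) are the lines of a plane of maps from V r, with basis
    in degrees lowdeg r and highdeg r. *)
Definition lowdeg (r : E7label) : nat :=
  match r with
  | rho_0 => 0 | rho_2 | rho_2' => 7 | rho_3 | rho_3' | rho_2'' => 8
  | rho_4 => 9 | rho_1' => 6
  end.
Definition highdeg (r : E7label) : nat := (18 - lowdeg r)%N.

(** The dimension vector of I/n for I in the exceptional locus: m/n contains V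
    i twice as often as the regular representation does. *)
Definition dimv (i : E7label) : nat := if i == rho_0 then 0%N else E7dim i.

Lemma Kchain_ok r : r != rho_0 -> chain_ok (Kchain r).
Proof. by case: r => // _; vm_compute. Qed.

Lemma Kchain_count r i : r != rho_0 -> dimv i = (entry (label_count (Kchain r)) i + (i == r))%N.
Proof. by case: r => // _; case: i; vm_compute. Qed.

Lemma Kchain_excluded r : r != rho_0 ->
  (entry (label_count (Kchain r)) r == 0%N) || excluded 60 (lower (label_count (Kchain r)) r 1).
Proof. by case: r => // _; vm_compute. Qed.

(** As K_r has no generator V r, the Koszul count says that (K_r : m) / K_r
    contains V r twice. *)
Lemma Kchain_nbr_sum r : r != rho_0 ->
  (nbr_sum (entry (label_count (Kchain r))) r + delta2 r = (entry (label_count (Kchain r)) r).*2.+2)%N.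
Proof. by case: r => // _; vm_compute. Qed.

(** The two copies of V r in (K_r : m) / K_r are in degrees lowdeg r and
    highdeg r. *)
Lemma Kchain_socdeg r d : r != rho_0 -> (d < 18)%N ->
  socdeg (deg_table (Kchain r)) r d =
    (tab_at (deg_table (Kchain r)) r d + (d == lowdeg r) + (d == highdeg r))%N.
Proof.
by case: r => // _; do 18?[case: d => [|d]; first by vm_compute].
Qed.

(** * Submodules of m/n and the exceptional curves *)

Section Chain.
Variables (C : numClosedFieldType) (gT : finGroupType) (H : {group gT}).
Local Notation rep := (mx_representation C H).
Variable rH : rep 2.
Hypothesis det_rH : forall h, h \in H -> \det (rH h) = 1.
Variable V : E7label -> representation C H.
Hypothesis hV : E7_labelling rH V.
(** P d is the projection onto the degree d part. *)
Definition degpart n (P : nat -> 'M[C]_n) (U : {vspace 'cV[C]_n}) d : {vspace 'cV[C]_n} :=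
  vs [set v | v \in U /\ P d *m v = v].

Lemma in_deg n (P : nat -> 'M[C]_n) U d v :
  (v \in degpart P U d) <-> v \in U /\ P d *m v = v.
Proof.
apply: in_vs; split=> [|a u w [h1 e1] [h2 e2]]; first by split; rewrite ?mem0v ?mulmx0.
by split; rewrite ?memvD ?memvZ // mulmxDr -scalemxAr e1 e2.
Qed.

Lemma stab_deg n (Q : rep n) (P : nat -> 'M[C]_n) U d :
  (forall d, hom Q Q (P d)) -> stab Q U -> stab Q (degpart P U d).
Proof.
move=> hP sU h v Hh /in_deg[vU e]; apply/in_deg; split; first exact: sU.
by rewrite mulmxA -hP // -mulmxA e.
Qed.

(** What the argument uses of m/n, as a subspace M of a quotient Q of the
    polynomial ring, with multiplications X and Y by the variables and
    projections P d onto the homogeneous parts. *)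
Record coinv_module n (Q : rep n) (X Y : 'M[C]_n) (M : {vspace 'cV[C]_n})
    (P : nat -> 'M[C]_n) : Prop := CoinvModule {
  cm_XY : X *m Y = Y *m X;
  cm_QX : forall h, h \in H -> Q h *m X = (rH h 0 0 *: X + rH h 1 0 *: Y) *m Q h;
  cm_QY : forall h, h \in H -> Q h *m Y = (rH h 0 1 *: X + rH h 1 1 *: Y) *m Q h;
  cm_stabM : stab Q M;
  cm_subM : (mulV X Y M <= M)%VS;
  cm_homM : forall (i : E7label) u, i != rho_0 -> hom Q (V i) u -> into M u;
  cm_koszul : forall (i : E7label) f g, i != rho_0 ->
    hom (twist rH Q) (V i) (col_mx f g) -> X *m f + Y *m g = 0 ->
    exists w, f = Y *m w /\ g = - (X *m w);
  cm_mult0M : mult Q (V rho_0) M = 0%N;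
  cm_soc : forall i : E7label, i != rho_0 -> mult Q (V i) (soc X Y) = delta2 i;
  cm_hP : forall d, hom Q Q (P d);
  cm_PP : forall d e, P d *m P e = if d == e then P d else 0;
  cm_PX : forall d, P d.+1 *m X = X *m P d;
  cm_PY : forall d, P d.+1 *m Y = Y *m P d;
  cm_P0X : P 0%N *m X = 0;
  cm_P0Y : P 0%N *m Y = 0;
  cm_P18 : forall d, (18 <= d)%N -> P d = 0;
  cm_sumP : \sum_(d < 18) P d = 1%:M;
  cm_Psoc : forall v, v \in soc X Y -> P 17%N *m v = v;
  cm_gradedM : forall d v, v \in M -> P d *m v \in M;
  cm_multM : forall (i : E7label) d, i != rho_0 ->
    mult Q (V i) (degpart P M d) = coinv_mult i d
}.

Variables (n : nat) (Q : rep n) (X Y : 'M[C]_n) (M : {vspace 'cV[C]_n}).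
Variable P : nat -> 'M[C]_n.
Hypothesis cm : coinv_module Q X Y M P.

Let XY := cm_XY cm.
Let QX := cm_QX cm.
Let QY := cm_QY cm.
Let homM := cm_homM cm.
Let koszul := cm_koszul cm.
Let mult0M := cm_mult0M cm.
Let mult_soc := cm_soc cm.
Let hP := cm_hP cm.
Let PP := cm_PP cm.
Let PX := cm_PX cm.
Let PY := cm_PY cm.
Let P0X := cm_P0X cm.
Let P0Y := cm_P0Y cm.
Let P18 := cm_P18 cm.
Let sumP := cm_sumP cm.
Let Psoc := cm_Psoc cm.
Let multM := cm_multM cm.

Local Notation mu i U := (mult Q (V i) U).
Local Notation mulV := (mulV X Y).
Local Notation colon := (colon X Y).
Local Notation soc := (soc X Y).
Local Notation deg := (degpart P).

(** The H-stable ideals between n and m, seen in m/n. *)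
Definition sub (N : {vspace 'cV[C]_n}) : Prop :=
  [/\ stab Q N, (N <= M)%VS & (mulV N <= N)%VS].

Lemma mu0 A : (A <= M)%VS -> mu rho_0 A = 0%N.
Proof. by move=> AM; apply/eqP; rewrite -leqn0 -mult0M multS. Qed.

Lemma nbr_sumE (b : E7label -> nat) i : nbr_sum b i = (\sum_(j <- E7neighbours i) b j)%N.
Proof. by rewrite /nbr_sum sumnE big_map. Qed.

(** The Koszul count for the pair formed by A and (A : m). It bounds the
    generators of a submodule N from below, because N is contained in (N : m).
    *)
Lemma colon_count (i : E7label) A : i != rho_0 -> stab Q A ->
  (nbr_sum (fun j => mu j A) i + delta2 i = mu i (mulV A) + mu i (colon A))%N.
Proof.
move=> i0 sA; rewrite nbr_sumE -(mult_soc i0).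
have -> : soc = (colon A :&: soc)%VS.
  apply/esym/capv_idPr/subvP=> v /in_soc[Xv Yv]; apply/in_colon.
  by rewrite Xv Yv mem0v.
apply: (koszul_count det_rH hV XY QX QY) => //; first exact: (stab_colon QX QY).
move=> f g hfg fA gA e; have [w [ef eg]] := koszul i0 hfg e.
exists w; split=> // v; apply/in_colon; split.
  by rewrite mulmxA -[X *m w]opprK -eg mulNmx memvN.
by rewrite mulmxA -ef.
Qed.

Lemma sub_colon N : (mulV N <= N)%VS -> (N <= colon N)%VS.
Proof.
move=> /subvP mN; apply/subvP=> v vN; apply/in_colon.
by split; apply: mN; [apply: mulV_X|apply: mulV_Y].
Qed.

Lemma sub_count (i : E7label) N : i != rho_0 -> sub N ->
  ((mu i N).*2 <= nbr_sum (fun j => mu j N) i + delta2 i + (mu i N - mu i (mulV N)))%N.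
Proof.
move=> i0 [sN _ mN]; have := colon_count i0 sN.
have := multS Q (V i) (sub_colon mN); have := multS Q (V i) mN.
lia.
Qed.

Lemma homTo_neq (i : E7label) A B : (A <= B)%VS -> (mu i A < mu i B)%N ->
  exists u, [/\ hom Q (V i) u, into B u & ~ into A u].
Proof.
move=> AB lt; have: ~~ (HomTo Q (V i) B <= HomTo Q (V i) A)%VS.
  by apply: contraTN lt => /dimvS; rewrite -leqNgt.
move=> /subvPn[u /in_HomTo[hu iu] nu]; exists u; split=> // iA.
by case/negP: nu; apply/in_HomTo.
Qed.

Lemma mult_addV (i : E7label) j A u : stab Q A -> hom Q (V i) u -> ~ into A u ->
  mu j (A + img u)%VS = (mu j A + (i == j))%N.
Proof.
move=> sA hu nu; have u0 : u <> 0.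
  by move=> u0; apply: nu => v; rewrite u0 mul0mx mem0v.
rewrite mult_add ?(mult_imgV hV j hu u0) //; first exact: stab_img hu.
apply/eqP; rewrite -subv0; apply/subvP=> w /memv_capP[vA /in_img[v e]].
rewrite e in vA *; rewrite (irr_inj (V_irr hV i) hu sA nu vA).
by rewrite mulmx0 mem0v.
Qed.

(** Complete reducibility allows the removal of k copies of V i from N while
    keeping D. *)
Lemma remove (i : E7label) k D N : stab Q D -> stab Q N -> (D <= N)%VS ->
    (mu i D + k <= mu i N)%N ->
  exists N', [/\ stab Q N', (D <= N')%VS, (N' <= N)%VS
    & forall j, mu j N = (mu j N' + (if j == i then k else 0))%N].
Proof.
move=> sD; elim: k N => [|k IH] N sN DN le.
  by exists N; split=> // j; case: ifP; rewrite addn0.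
have lti : (mu i D < mu i N)%N by lia.
have [u [hu iu nu]] := homTo_neq DN lti.
have sDu : stab Q (D + img u)%VS by apply/stabD/stab_img/hu.
have DuN : (D + img u <= N)%VS by rewrite subv_add DN; apply/img_into.
have [E [sE defN tiE]] := compl_exists sDu sN DuN.
have sDE : stab Q (D + E)%VS by exact: stabD.
have DEN : (D + E <= N)%VS by rewrite -defN addvS ?addvSl.
have tiD : (D :&: E = 0)%VS.
  by apply/eqP; rewrite -subv0 -tiE capvS ?addvSl.
have muN j : mu j N = (mu j (D + E)%VS + (i == j))%N.
  by rewrite -defN (mult_add _ sDu sE tiE) (mult_addV _ sD hu nu) (mult_add _ sD sE tiD) addnAC.
have [|N' [sN' DN' N'E eN']] := IH _ sDE (addvSl D E).
  by have := muN i; rewrite eqxx; lia.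
exists N'; split=> // [|j]; first exact: subv_trans DEN.
by rewrite muN eN' eq_sym; case: eqP; lia.
Qed.

(** Removing generators from a submodule leaves a submodule. *)
Lemma peel (i : E7label) k N : i != rho_0 -> sub N -> (mu i (mulV N) + k <= mu i N)%N ->
  exists N', [/\ sub N', (mulV N <= N')%VS, (N' <= N)%VS
    & forall j, mu j N = (mu j N' + (if j == i then k else 0))%N].
Proof.
move=> i0 [sN NM mN] le; have [N' [sN' mN' N'N e]] := remove (stab_mulV QX QY sN) sN mN le.
exists N'; split=> //; split=> //; first exact: subv_trans NM.
by apply: (subv_trans _ mN'); apply: mulVS.
Qed.

Lemma eq_nbr_sum b b' i : (forall j, b j = b' j) -> nbr_sum b i = nbr_sum b' i.
Proof. by move=> e; rewrite /nbr_sum (eq_map e). Qed.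

Lemma excludedP f b N : excluded f b -> sub N -> (forall i, mu i N = entry b i) -> False.
Proof.
elim: f b N => //= f IH b N.
set i := first_deficient b; case/andP => i0 h subN eN.
have pos : (0 < deficit b i)%N.
  have hs : has (fun i => 0 < deficit b i)%N labels7.
    apply: contraNT i0 => nh; by rewrite /i /first_deficient hasNfind //.
  exact: (nth_find rho_0 hs).
clearbody i.
have cN := sub_count i0 subN.
rewrite (eq_nbr_sum _ eN) eN in cN; rewrite /deficit in pos h.
case/orP: h => [h|h]; first by lia.
have [|N' [subN' _ _ eN']] := @peel i (deficit b i) N i0 subN.
  by have := multS Q (V i) (let: And3 _ _ mN := subN in mN); rewrite eN /deficit; lia.
apply: (IH _ N' h subN') => j; rewrite entry_lower.
by have := eN' j; rewrite eN /deficit; case: eqP => [->|_]; lia.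
Qed.

Definition graded (U : {vspace 'cV[C]_n}) : Prop := forall d v, v \in U -> P d *m v \in U.

Lemma HomTo_deg k (r : rep k) U d A :
  (A \in HomTo Q r (deg U d)) <-> (A \in HomTo Q r U) /\ P d *m A = A.
Proof.
split=> [/in_HomTo[hA iA]|[/in_HomTo[hA iA] e]].
  split; first by apply/in_HomTo; split=> // v; have /in_deg[] := iA v.
  by apply: eq_colmx => v; rewrite -mulmxA; have /in_deg[] := iA v.
by apply/in_HomTo; split=> // v; apply/in_deg; rewrite mulmxA e.
Qed.

Lemma mult_deg_eq k (r : rep k) U W d :
  HomTo Q r U = HomTo Q r W -> mult Q r (deg U d) = mult Q r (deg W d).
Proof.
move=> e; rewrite /mult; congr (\dim _); apply/vspaceP=> A.
by apply/idP/idP => /HomTo_deg[hA PA]; apply/HomTo_deg; rewrite ?e // -?e.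
Qed.

Lemma HomTo_eq (i : E7label) U W : (U <= W)%VS -> mu i U = mu i W ->
  HomTo Q (V i) U = HomTo Q (V i) W.
Proof.
move=> UW e; apply/eqP; rewrite eqEdim HomToS //=.
by rewrite -[leqRHS]/(mu i U) e.
Qed.

Lemma graded_colon U : graded U -> graded (colon U).
Proof.
move=> gU d v /in_colon[Xv Yv]; apply/in_colon.
by rewrite !mulmxA -PX -PY -!mulmxA; split; apply: gU.
Qed.

(** The Koszul count for the degree d + 1 part of K. If no generator of K is a
    V i, then the degree d + 2 part of (x, y) K contains V i as often as that
    of K. *)
Lemma colon_deg (i : E7label) K (d : nat) : i != rho_0 -> sub K -> graded K ->
    mu i (mulV K) = mu i K -> d != 17%N ->
  nbr_sum (fun j => mu j (deg K d.+1)) i = (mu i (deg K d.+2) + mu i (deg (colon K) d))%N.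
Proof.
move=> i0 [sK KM mK] gK topK d17.
have := colon_count i0 (stab_deg (d := d.+1) hP sK).
have -> : mulV (deg K d.+1) = deg (mulV K) d.+2.
  apply/vspaceP=> v; apply/idP/idP.
    move=> /in_mulV[a [b [/in_deg[aK ea] /in_deg[bK eb] ->]]]; apply/in_deg; split.
      by apply/in_mulV; exists a, b.
    by rewrite mulmxDr !mulmxA PX PY -!mulmxA ea eb.
  move=> /in_deg[/in_mulV[a [b [aK bK ->]]] e]; rewrite -e.
  rewrite mulmxDr !mulmxA PX PY -!mulmxA; apply/in_mulV.
  exists (P d.+1 *m a), (P d.+1 *m b); split=> //; apply/in_deg;
    by rewrite mulmxA PP eqxx; split=> //; apply: gK.
rewrite (mult_deg_eq d.+2 (HomTo_eq mK topK)).
have -> : colon (deg K d.+1) = (deg (colon K) d + soc)%VS.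
  apply/vspaceP=> v; apply/idP/idP.
    move=> /in_colon[/in_deg[Xv eX] /in_deg[Yv eY]].
    rewrite -[v](subrK (P d *m v)) addrC memv_add //.
      apply/in_deg; split; last by rewrite mulmxA PP eqxx.
      by apply/in_colon; rewrite !mulmxA -PX -PY -!mulmxA eX eY.
    by apply/in_soc; rewrite !mulmxBr !mulmxA -PX -PY -!mulmxA eX eY !subrr.
  move=> /memv_addP[a /in_deg[/in_colon[Xa Ya] ea] [b /in_soc[Xb Yb] ->]].
  apply/in_colon; rewrite !mulmxDr Xb Yb !addr0; split; apply/in_deg; split=> //.
    by rewrite mulmxA PX -mulmxA ea.
  by rewrite mulmxA PY -mulmxA ea.
rewrite mult_add ?mult_soc //; first by lia.
- exact/(stab_deg hP)/(stab_colon QX QY).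
- exact/(stab_colon QX QY)/stab0.
apply/eqP; rewrite -subv0; apply/subvP=> v /memv_capP[/in_deg[_ e] /Psoc e'].
by rewrite -e -e' mulmxA PP (negPf d17) mul0mx mem0v.
Qed.

Lemma colon_deg17 (i : E7label) K : i != rho_0 -> mu i (deg (colon K) 17%N) = delta2 i.
Proof.
move=> i0; rewrite -(mult_soc i0); congr (mult Q _ _).
apply/vspaceP=> v; apply/idP/idP => [/in_deg[_ <-]|vS].
  by apply/in_soc; rewrite !mulmxA -PX -PY !P18 // !mul0mx.
apply/in_deg; rewrite Psoc //; split=> //; case/in_soc: vS => Xv Yv.
by apply/in_colon; rewrite Xv Yv mem0v.
Qed.

Lemma mult_deg18 (i : E7label) U d : (18 <= d)%N -> mu i (deg U d) = 0%N.
Proof.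
move=> d18; rewrite -(mult0 Q (V i)); congr (mult Q _ _); apply/vspaceP=> v.
apply/idP/idP; last by rewrite memv0 => /eqP ->; rewrite mem0v.
by move=> /in_deg[_ <-]; rewrite P18 // mul0mx mem0v.
Qed.

Lemma socdegP (i : E7label) K t d : i != rho_0 -> sub K -> graded K -> mu i (mulV K) = mu i K ->
    (forall j d, mu j (deg K d) = tab_at t j d) ->
  mu i (deg (colon K) d) = (if (d < 18)%N then socdeg t i d else 0)%N.
Proof.
move=> i0 subK gK topK gat_t; case: ltnP => d18; last exact: mult_deg18.
rewrite /socdeg; have [->|d17] := eqVneq d 17%N; first exact: colon_deg17.
have := colon_deg i0 subK gK topK d17; rewrite gat_t.
rewrite (eq_nbr_sum i (fun j => gat_t j d.+1)) => ->.
by rewrite addKn.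
Qed.

(** If K had a generator V i, then removing it would give a submodule with an
    excluded dimension vector; there is none either when K contains no V i. *)
Lemma no_top (i : E7label) b K f : i != rho_0 -> sub K -> (forall j, mu j K = entry b j) ->
    (entry b i == 0)%N || excluded f (lower b i 1) ->
  mu i (mulV K) = mu i K.
Proof.
move=> i0 subK eK h; apply/eqP; rewrite eqn_leq multS; last by case: subK.
rewrite leqNgt; apply/negP => lt; case/orP: h => [/eqP b0|h].
  by rewrite eK b0 in lt.
have [|N [subN _ _ eN]] := @peel i 1 K i0 subK; first by rewrite addn1.
apply: (excludedP h subN) => j; rewrite entry_lower -!eK.
by have := eN j; case: eqP => [->|_]; lia.
Qed.

Lemma sub0 : sub 0%VS.
Proof.
split; [exact: stab0|exact: sub0v|].
apply/subvP=> v /in_mulV[a [b []]]; rewrite !memv0 => /eqP -> /eqP -> ->.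
by rewrite !mulmx0 addr0.
Qed.

Lemma sub_addV (i : E7label) K u : i != rho_0 -> sub K -> hom Q (V i) u -> into (colon K) u ->
  sub (K + img u)%VS /\ (mulV (K + img u)%VS <= K)%VS.
Proof.
move=> i0 [sK KM mK] hu iu.
have mKu : (mulV (K + img u)%VS <= K)%VS.
  have /subvP Kc := sub_colon mK.
  have KuC v : v \in (K + img u)%VS -> v \in colon K.
    by move=> /memv_addP[a /Kc aK [_ /in_img[w ->] ->]]; rewrite memvD.
  apply/subvP=> v /in_mulV[a [b [/KuC/in_colon[Xa _] /KuC/in_colon[_ Yb] ->]]].
  exact: memvD.
split=> //; split; first exact/stabD/stab_img/hu.
  by rewrite subv_add KM; apply/img_into/homM/hu.
by apply: subv_trans mKu _; apply: addvSl.
Qed.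

(** Existence, uniqueness and degrees of the submodule with the dimension
    vector of a chain, by induction. Given the submodule K of the shorter
    chain, the Koszul count gives exactly one more V i in (K : m) than in K,
    and adding it gives K'. Conversely a submodule N with the larger dimension
    vector has a generator V i; removing it leaves K by uniqueness, so N lies
    in (K : m) and is K'. *)
Theorem chainP c : chain_ok c -> exists K, [/\ sub K /\ graded K,
  forall i, mu i K = entry (label_count c) i, forall i d, mu i (deg K d) = tab_at (deg_table c) i d
  & forall N, sub N -> (forall i, mu i N = entry (label_count c) i) -> N = K].
Proof.
elim: c => [_|i c IH].
  exists 0%VS; split; first split; first exact: sub0.
  - by move=> d v; rewrite memv0 => /eqP ->; rewrite mulmx0 mem0v.
  - by move=> i; rewrite mult0; case: i.
  - move=> i d; rewrite /tab_at /= !nth_nil; apply/eqP; rewrite -leqn0.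
    have s : (deg 0%VS d <= 0)%VS by apply/subvP=> v /in_deg[].
    by have := multS Q (V i) s; rewrite mult0.
  - move=> N [sN _ _] N0; apply: contrapT => Nn0.
    by have [j] := V_exists hV sN Nn0; rewrite N0; case: j.
have entryE j : entry (label_count (i :: c)) j = (entry (label_count c) j + (i == j))%N.
  by rewrite !entry_label_count /= addnC.
case/and4P => i0 /eqP eqi topc /IH[K [[subK gK] eK gatK uniqK]].
have [sK KM mK] := subK; have topK := no_top i0 subK eK topc.
have nbi : nbr_sum (entry (label_count (i :: c))) i = nbr_sum (entry (label_count c)) i.
  by rewrite /nbr_sum; congr sumn; apply/eq_in_map => j; rewrite entryE => /nbr_neq ->; rewrite addn0.
have mcol : mu i (colon K) = entry (label_count (i :: c)) i.
  have := colon_count i0 sK; rewrite (eq_nbr_sum _ eK) topK eK.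
  by move: eqi; rewrite nbi entryE eqxx; lia.
have lti : (mu i K < mu i (colon K))%N by rewrite mcol entryE eK eqxx addn1.
have [u [hu iu nu]] := homTo_neq (sub_colon mK) lti.
have [subKu mKu] := sub_addV i0 subK hu iu.
set K' := (K + img u)%VS in subKu mKu.
have eK' j : mu j K' = entry (label_count (i :: c)) j by rewrite mult_addV // eK entryE.
have K'c : (K' <= colon K)%VS.
  by rewrite subv_add sub_colon //; apply/img_into.
have homK' : HomTo Q (V i) K' = HomTo Q (V i) (colon K).
  by apply: HomTo_eq => //; rewrite eK'.
have homK'j j : j != i -> HomTo Q (V j) K = HomTo Q (V j) K'.
  move=> ji; apply: HomTo_eq; first exact: addvSl.
  by rewrite eK' eK entryE eq_sym (negPf ji) addn0.
exists K'; split=> //; first split=> //.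
- move=> d _ /memv_addP[a aK [_ /in_img[w ->] ->]]; rewrite mulmxDr memvD //.
    by apply: (subvP (addvSl K (img u))); apply: gK.
  rewrite mulmxA; suff /in_HomTo[_] : P d *m u \in HomTo Q (V i) K' by apply.
  rewrite homK'; apply/in_HomTo; split; first exact: hom_mul hu.
  by move=> v; rewrite -mulmxA; apply: graded_colon.
- move=> j d; rewrite tab_at_cons; have [->|ji] := eqVneq j i.
    rewrite (mult_deg_eq d homK'); exact: socdegP.
  by rewrite -(mult_deg_eq d (homK'j j ji)).
move=> N subN eN; have [sN NM mN] := subN.
have [|N' [subN' mN' N'N eN']] := @peel i 1 N i0 subN.
  have := sub_count i0 subN; rewrite (eq_nbr_sum _ eN) eN eqi -addn1 leq_add2l.
  by rewrite subn_gt0 addn1.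
have N'K : N' = K.
  apply: uniqK => // j; have := eN' j; rewrite eN entryE [j == i]eq_sym.
  by case: eqP => _ /addIn.
have NC : (N <= colon K)%VS.
  rewrite -N'K; apply/subvP=> v vN; apply/in_colon; split; apply: (subvP mN').
    exact: mulV_X.
  exact: mulV_Y.
have homN j : HomTo Q (V j) N = HomTo Q (V j) K'.
  have [->|ji] := eqVneq j i.
    by rewrite homK'; apply: HomTo_eq => //; rewrite eN mcol.
  rewrite -homK'j //; apply/esym/HomTo_eq; first by rewrite -N'K.
  by rewrite eN eK entryE eq_sym (negPf ji) addn0.
have [sK' _ _] := subKu.
apply/eqP; rewrite eqEsubv; apply/andP.
split.
  by apply: (HomTo_sub hV sN sK') => j; rewrite homN.
by apply: (HomTo_sub hV sK' sN) => j; rewrite -homN.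
Qed.

(** Nakayama's lemma: (x, y) is nilpotent on the quotient. *)
Lemma nakayama N E : (mulV E <= E)%VS -> (N <= mulV N + E)%VS -> (N <= E)%VS.
Proof.
move=> /subvP mE NE; pose F k := vs [set v : 'cV[C]_n | forall d, (d < k)%N -> P d *m v = 0].
have inF k v : (v \in F k) <-> forall d, (d < k)%N -> P d *m v = 0.
  apply: in_vs; split=> [d _|a u w hu hw d dk]; first by rewrite mulmx0.
  by rewrite mulmxDr -scalemxAr hu // hw // scaler0 addr0.
have step k : (N <= F k + E)%VS.
  elim: k => [|k IH].
    by apply/subvP=> v _; rewrite -[v]addr0 memv_add ?mem0v //; apply/inF.
  apply: subv_trans NE _; rewrite subv_add addvSr andbT; apply/subvP=> _ /in_mulV[a [b [aN bN ->]]].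
  have /memv_addP[f fF [e eE ->]] := subvP IH _ aN.
  have /memv_addP[g gF [e' e'E ->]] := subvP IH _ bN.
  rewrite !mulmxDr addrACA memv_add //; last first.
    by rewrite memvD //; apply: mE; [apply: mulV_X|apply: mulV_Y].
  apply/inF => -[|d] dk; first by rewrite mulmxDr !mulmxA P0X P0Y !mul0mx addr0.
  rewrite mulmxDr !mulmxA PX PY -!mulmxA.
  by rewrite (inF k f).1 // (inF k g).1 // !mulmx0 addr0.
apply: subv_trans (step 18%N) _; rewrite subv_add subvv andbT; apply/subvP=> v /inF v0.
rewrite -[v]mul1mx -sumP mulmx_suml big1 ?mem0v // => d _; exact: v0.
Qed.

Lemma line_hom i K u A : stab Q K -> hom Q (V i) u -> ~ into K u ->
  A \in HomTo Q (V i) (K + img u)%VS -> exists s, into K (A - s *: u).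
Proof.
move=> sK hu nu hA.
have uK : u \notin HomTo Q (V i) K by apply/negP => /in_HomTo[].
have dimKu : (\dim (HomTo Q (V i) K + <[u]>)%VS = mu i K + 1)%N.
  rewrite dimv_disjoint_sum.
    by rewrite dim_vline; case: eqP uK => // ->; rewrite mem0v.
  apply/eqP; rewrite -subv0; apply/subvP=> v /memv_capP[vK /vlineP[a e]].
  rewrite e in vK *; have [->|a0] := eqVneq a 0; first by rewrite scale0r mem0v.
  by case/negP: uK; rewrite -[u](scalerK a0) memvZ.
have KuS : (HomTo Q (V i) K + <[u]> <= HomTo Q (V i) (K + img u))%VS.
  rewrite subv_add HomToS ?addvSl //= -memvE; apply/in_HomTo; split=> //.
  by apply/img_into; apply: addvSr.
have : A \in (HomTo Q (V i) K + <[u]>)%VS.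
  suff -> : (HomTo Q (V i) K + <[u]>)%VS = HomTo Q (V i) (K + img u)%VS by [].
  apply/eqP; rewrite eqEdim KuS dimKu -[leqLHS]/(mu i (K + img u)%VS).
  by rewrite (mult_addV _ sK hu nu) eqxx /= leqnn.
move=> /memv_addP[k /in_HomTo[_ iK] [_ /vlineP[s ->] ->]].
by exists s; rewrite addrK.
Qed.

Lemma deg_line k K (u : 'M[C]_(n, k)) a d : graded K -> P a *m u = u ->
  deg (K + img u)%VS d = (if d == a then deg K a + img u else deg K d)%VS.
Proof.
move=> gK Pu; apply/vspaceP=> v; apply/idP/idP.
  move=> /in_deg[/memv_addP[l kK [_ /in_img[w ->] ->]] e].
  rewrite -e; have [->|da] := eqVneq d a; rewrite mulmxDr mulmxA.
    rewrite Pu; apply: memv_add; last by apply/in_img; exists w.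
    by apply/in_deg; rewrite mulmxA PP eqxx; split=> //; apply: gK.
  rewrite -Pu !mulmxA PP (negPf da) !mul0mx addr0; apply/in_deg.
  by rewrite mulmxA PP eqxx; split=> //; apply: gK.
have [->|da] := eqVneq d a; last first.
  move=> /in_deg[vK e]; apply/in_deg; split=> //.
  exact: subvP (addvSl _ _) _ vK.
move=> /memv_addP[l /in_deg[kK e] [_ /in_img[w ->] ->]]; apply/in_deg; split.
  by rewrite memv_add //; apply/in_img; exists w.
by rewrite mulmxDr e mulmxA Pu.
Qed.

(** An excess of V i in degrees d and d + 2 over its neighbours in degree d +
    1 contradicts the Koszul count in these degrees, unless there is a
    generator V i in degree d + 2. *)
Lemma top_of_degrees i N d : i != rho_0 -> sub N -> d != 17%N ->
    (nbr_sum (fun j => mu j (deg N d.+1)) i < mu i (deg N d.+2) + mu i (deg N d))%N ->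
  graded N -> (mu i (mulV N) < mu i N)%N.
Proof.
move=> i0 subN d17 lt gN; have [sN NM mN] := subN.
rewrite ltn_neqAle multS // andbT; apply/eqP => top.
have := colon_deg i0 subN gN top d17; apply/eqP; rewrite neq_ltn.
apply/orP; left; apply: leq_trans lt _; rewrite leq_add2l multS //.
apply/subvP=> v /in_deg[vN e]; apply/in_deg; split=> //.
exact: subvP (sub_colon mN) _ vN.
Qed.

(** The submodules I/n for I in the exceptional locus. *)
Definition exc (N : {vspace 'cV[C]_n}) : Prop := sub N /\ forall i, mu i N = dimv i.
Definition on_curve (r : E7label) N : Prop := exc N /\ (mu r (mulV N) < mu r N)%N.

Lemma exc_top N : exc N -> exists2 r, r != rho_0 & on_curve r N.
Proof.
move=> [[sN NM mN] eN]; apply: contrapT => ntop.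
have eqN : mulV N = N.
  apply: (mult_eq_sub hV (stab_mulV QX QY sN) sN mN) => i.
  have [->|i0] := eqVneq i rho_0; first by rewrite !mu0 //; apply: subv_trans NM.
  apply/eqP; rewrite eqn_leq multS //= leqNgt; apply/negP => lt.
  by apply: ntop; exists i.
have : (N <= 0)%VS.
  by apply: nakayama; [case: sub0|rewrite eqN addvSl].
rewrite subv0 => /eqP N0; have := eN rho_2.
by rewrite N0 mult0.
Qed.

(** The curve E(r) as a projective line: its points are the submodules K + img
    (x ua + y ub) for (x : y) in P^1, where ua and ub are homogeneous. *)
Record Epencil (r : E7label) (K : {vspace 'cV[C]_n}) (ua ub : 'M[C]_(n, rdegree (V r))) :
    Prop := EPencil {
  pencil_sub : sub K;
  pencil_graded : graded K;
  pencil_dim : forall i, dimv i = (mu i K + (i == r))%N;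
  pencil_deg : forall i d, mu i (deg K d) = tab_at (deg_table (Kchain r)) i d;
  pencil_homa : hom Q (V r) ua;
  pencil_homb : hom Q (V r) ub;
  pencil_dega : P (lowdeg r) *m ua = ua;
  pencil_degb : P (highdeg r) *m ub = ub;
  pencil_free : forall x y, into K (x *: ua + y *: ub) -> x = 0 /\ y = 0;
  pencilE : forall N, on_curve r N <->
    exists x y, (x != 0) || (y != 0) /\ N = (K + img (x *: ua + y *: ub))%VS
}.

Lemma homD k (r : rep k) x y ua ub : hom Q r ua -> hom Q r ub ->
  hom Q r (x *: ua + y *: ub).
Proof.
by move=> ha hb h Hh; rewrite mulmxDr mulmxDl -!scalemxAr -!scalemxAl ha // hb.
Qed.

Lemma intoD k (U : {vspace 'cV[C]_n}) x y (ua ub : 'M[C]_(n, k)) :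
  into U ua -> into U ub -> into U (x *: ua + y *: ub).
Proof. by move=> ia ib v; rewrite mulmxDl -!scalemxAl memvD // memvZ. Qed.

Lemma img_mod k K (u w : 'M[C]_(n, k)) : into K (u - w) -> (K + img u = K + img w)%VS.
Proof.
have le (a b : 'M[C]_(n, k)) : into K (a - b) -> (K + img a <= K + img b)%VS.
  move=> iab; rewrite subv_add addvSl /=; apply/subvP=> _ /in_img[v ->].
  by rewrite -[a](subrK b) mulmxDl memv_add //; apply/in_img; exists v.
move=> iuw; apply/eqP; rewrite eqEsubv !le // => v.
by rewrite -opprB mulNmx memvN.
Qed.

Lemma dim_add2 (L : vectType C) (E : {vspace L}) (a b : L) :
    (forall x y, x *: a + y *: b \in E -> x = 0 /\ y = 0) ->
  \dim (E + <[a]> + <[b]>)%VS = (\dim E + 2)%N.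
Proof.
move=> free; have line (W : {vspace L}) u : u \notin W -> \dim (W + <[u]>)%VS = (\dim W + 1)%N.
  move=> uW; rewrite dimv_disjoint_sum.
    by rewrite dim_vline; case: eqP uW => // ->; rewrite mem0v.
  apply/eqP; rewrite -subv0; apply/subvP=> v /memv_capP[vW /vlineP[s e]].
  rewrite e in vW *; have [->|s0] := eqVneq s 0; first by rewrite scale0r mem0v.
  by case/negP: uW; rewrite -[u](scalerK s0) memvZ.
rewrite !line ?addn1 ?addn2 //.
  apply/negP => aE; have [|/eqP] := free 1 0; first by rewrite scale1r scale0r addr0.
  by rewrite oner_eq0.
apply/negP => /memv_addP[e eE [_ /vlineP[s ->] eb]].
have [|_ /eqP] := free (- s) 1; last by rewrite oner_eq0.
by rewrite scale1r eb scaleNr addrC addrK.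
Qed.

(** Let K be the submodule of the chain of r. If N is a point of E(r), then
    removing one generator V r from N leaves a submodule with the dimension
    vector of K, which is K by uniqueness; thus N lies in (K : m). The Koszul
    count gives two more V r in (K : m) than in K, one in each of the degrees
    lowdeg r and highdeg r, and any line in this plane of maps gives a point
    of E(r). *)
Theorem pencil_exists (r : E7label) : r != rho_0 ->
  exists K ua ub, @Epencil r K ua ub.
Proof.
move=> r0; have [K [[subK gK] eK gatK uniqK]] := chainP (Kchain_ok r0).
have [sK KM mK] := subK; have topK := no_top r0 subK eK (Kchain_excluded r0).
have dimK i : dimv i = (mu i K + (i == r))%N by rewrite eK (Kchain_count i r0).
have colK d : (d < 18)%N -> mu r (deg (colon K) d) =
    (mu r (deg K d) + (d == lowdeg r) + (d == highdeg r))%N.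
  by move=> d18; rewrite (socdegP d r0 subK gK topK gatK) d18 Kchain_socdeg // gatK.
have mcol : mu r (colon K) = (mu r K + 2)%N.
  have := colon_count r0 sK; rewrite (eq_nbr_sum _ eK) topK eK Kchain_nbr_sum //.
  by rewrite -addnn -addn2 -addnA => /addnI <-.
have dS d : (deg K d <= deg (colon K) d)%VS.
  apply/subvP=> v /in_deg[vK e]; apply/in_deg; split=> //.
  exact: subvP (sub_colon mK) _ vK.
have d18 : (lowdeg r < 18)%N /\ (highdeg r < 18)%N by case: (r) r0.
have [ua [ha ia na]] : exists u, [/\ hom Q (V r) u, into (deg (colon K) (lowdeg r)) u
    & ~ into (deg K (lowdeg r)) u].
  apply: homTo_neq => //; rewrite colK; last by case: d18.
  by rewrite eqxx addn1 addSn ltnS leq_addr.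
have Pa : P (lowdeg r) *m ua = ua.
  by apply: eq_colmx => v; rewrite -mulmxA; have /in_deg[] := ia v.
have iac : into (colon K) ua by move=> v; have /in_deg[] := ia v.
have naK : ~ into K ua.
  by move=> iK; apply: na => v; apply/in_deg; rewrite mulmxA Pa.
(* when both copies of V r are in the same degree, ub is chosen outside K + img ua *)
pose Ka := if lowdeg r == highdeg r then (deg K (highdeg r) + img ua)%VS
  else deg K (highdeg r).
have sKa : stab Q Ka.
  rewrite /Ka; case: ifP => _; last exact: stab_deg.
  by apply: stabD; [exact: stab_deg|exact: stab_img ha].
have [ub [hb ib nb']] : exists u, [/\ hom Q (V r) u, into (deg (colon K) (highdeg r)) u
    & ~ into Ka u].
  apply: homTo_neq.
    rewrite /Ka; case: eqP => [<-|_] //; rewrite subv_add dS; exact/img_into.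
  rewrite colK; last by case: d18.
  rewrite /Ka eqxx [_ == lowdeg r]eq_sym; case: eqP => [e|_].
    by rewrite (mult_addV _ (stab_deg (d := highdeg r) hP sK) ha) ?eqxx -?e // !addn1.
  by rewrite addn0 addn1.
have Pb : P (highdeg r) *m ub = ub.
  by apply: eq_colmx => v; rewrite -mulmxA; have /in_deg[] := ib v.
have ibc : into (colon K) ub by move=> v; have /in_deg[] := ib v.
have intoP d k (u : 'M[C]_(n, k)) : into K u -> into K (P d *m u).
  by move=> iu v; rewrite -mulmxA; apply: gK.
have scal x k (u : 'M[C]_(n, k)) : into K (x *: u) -> x = 0 \/ into K u.
  move=> iu; have [->|x0] := eqVneq x 0; [by left|right] => v.
  by rewrite -[u](scalerK x0) -scalemxAl memvZ.
have free x y : into K (x *: ua + y *: ub) -> x = 0 /\ y = 0.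
  move=> iK; have [e|ne] := eqVneq (lowdeg r) (highdeg r); last first.
    have := intoP (lowdeg r) _ _ iK; rewrite mulmxDr -!scalemxAr Pa -{1}Pb mulmxA PP (negPf ne).
    rewrite mul0mx scaler0 addr0 => /scal[x0|//]; split=> //.
    move: iK; rewrite x0 scale0r add0r => /scal[//|iub].
    by case: nb' => v; rewrite /Ka (negPf ne); apply/in_deg; rewrite mulmxA Pb.
  have y0 : y = 0.
    apply/eqP; apply: contrapT => /negP y0; apply: nb' => v.
    rewrite /Ka e eqxx -[ub](scalerK y0) -[y *: ub](addKr (x *: ua)).
    rewrite -scalemxAl memvZ // mulmxDl addrC; apply: memv_add.
      apply/in_deg; split; first exact: iK.
      by rewrite mulmxA mulmxDr -!scalemxAr Pb -{1}e Pa.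
    by apply/in_img; exists (- x *: v); rewrite -scalemxAr mulNmx scaleNr -scalemxAl.
  by move: iK; rewrite y0 scale0r addr0 => /scal[->|//].
have spanE : (HomTo Q (V r) K + <[ua]> + <[ub]>)%VS = HomTo Q (V r) (colon K).
  apply/eqP; rewrite eqEdim dim_add2 => [|x y /in_HomTo[_ /free//]].
  rewrite -[leqLHS]/(mu r (colon K)) mcol leqnn andbT !subv_add HomToS ?sub_colon //=.
  by rewrite -!memvE; apply/andP; split; apply/in_HomTo.
exists K, ua, ub; split=> // N; split; last first.
  move=> [x [y [xy ->]]]; set u := x *: ua + y *: ub.
  have hu : hom Q (V r) u by exact: homD.
  have nu : ~ into K u by move=> /free[x0 y0]; rewrite x0 y0 eqxx in xy.
  have [subN mN] := sub_addV r0 subK hu (intoD x y iac ibc).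
  have eN j : mu j (K + img u)%VS = dimv j.
    by rewrite (mult_addV _ sK hu nu) dimK eq_sym.
  split; first by split.
  apply: leq_ltn_trans (multS _ _ mN) _.
  by rewrite (mult_addV _ sK hu nu) eqxx addn1.
move=> [[subN eN] top]; have [sN NM mN] := subN.
have [|N' [subN' mN' N'N eN']] := @peel r 1 N r0 subN; first by rewrite addn1.
have N'K : N' = K.
  apply: uniqK => // j; have := eN' j; rewrite eN (Kchain_count j r0).
  by case: eqP => _ /addIn.
rewrite N'K in N'N mN' eN'.
have lt : (mu r K < mu r N)%N by rewrite eN' eqxx addn1.
have [u [hu iu nu]] := homTo_neq N'N lt.
have defN : N = (K + img u)%VS.
  apply/esym; apply: (mult_eq_sub hV _ sN) => //.
  - exact/stabD/stab_img/hu.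
  - by rewrite subv_add N'N; apply/img_into.
  - by move=> j; rewrite (mult_addV _ sK hu nu) eN' eq_sym; case: eqP.
have NC : (N <= colon K)%VS.
  apply/subvP=> v vN; apply/in_colon; split; apply: (subvP mN').
    exact: mulV_X.
  exact: mulV_Y.
have : u \in HomTo Q (V r) (colon K).
  by apply/in_HomTo; split=> // v; apply: (subvP NC).
rewrite -spanE => /memv_addP[_ /memv_addP[k /in_HomTo[_ ik] [_ /vlineP[x ->] ->]] [_ /vlineP[y ->] eu]].
rewrite -addrA in eu.
exists x, y; split.
  apply/negPn/negP; rewrite negb_or !negbK => /andP[/eqP x0 /eqP y0].
  by apply: nu; rewrite eu x0 y0 !scale0r !addr0.
by rewrite defN; apply: img_mod; rewrite eu addrK.
Qed.

Lemma pencil_nz r K ua ub x y : @Epencil r K ua ub -> (x != 0) || (y != 0) ->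
  ~ into K (x *: ua + y *: ub).
Proof. by move=> pK xy /(pencil_free pK)[x0 y0]; rewrite x0 y0 eqxx in xy. Qed.

Lemma pencil_inj r K ua ub x y x' y' : @Epencil r K ua ub ->
    (x != 0) || (y != 0) -> (x' != 0) || (y' != 0) ->
    (into (K + img (x *: ua + y *: ub))%VS (x' *: ua + y' *: ub)) ->
  exists s, x' = s * x /\ y' = s * y.
Proof.
move=> pK xy xy' iN; have [sK _ _] := pencil_sub pK.
have hu a b := homD a b (pencil_homa pK) (pencil_homb pK).
have hA : x' *: ua + y' *: ub \in HomTo Q (V r) (K + img (x *: ua + y *: ub))%VS.
  by apply/in_HomTo; split=> //; apply: hu.
have [s] := line_hom sK (hu x y) (pencil_nz pK xy) hA.
rewrite scalerDr opprD addrACA !scalerA -!scalerBl => /(pencil_free pK)[e1 e2].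
by exists s; split; apply/eqP; rewrite -subr_eq0; apply/eqP.
Qed.

(** The action on the quotient of the scalar matrix c. *)
Definition Zmx (c : C) : 'M[C]_n := \sum_(d < 18) c ^+ d *: P d.

Lemma Zmx_deg c k d (u : 'M[C]_(n, k)) : (d < 18)%N -> P d *m u = u -> Zmx c *m u = c ^+ d *: u.
Proof.
move=> d18 Pu; rewrite /Zmx mulmx_suml (bigD1 (Ordinal d18)) //= -scalemxAl Pu big1 ?addr0 //.
move=> e ne; rewrite -scalemxAl -Pu mulmxA PP.
have -> : (e == d :> nat) = false by apply: negbTE; apply: contraNneq ne => e1; apply/eqP/val_inj.
by rewrite mul0mx scaler0.
Qed.

Lemma lowhigh18 r : r != rho_0 -> (lowdeg r < 18)%N /\ (highdeg r < 18)%N.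
Proof. by case: r. Qed.

Lemma Zmx_pencil r K ua ub c x y : r != rho_0 -> @Epencil r K ua ub ->
  Zmx c *m (x *: ua + y *: ub) = (x * c ^+ lowdeg r) *: ua + (y * c ^+ highdeg r) *: ub.
Proof.
move=> r0 pK; have [l18 h18] := lowhigh18 r0.
rewrite mulmxDr -!scalemxAr (Zmx_deg _ l18 (pencil_dega pK)).
by rewrite (Zmx_deg _ h18 (pencil_degb pK)) !scalerA.
Qed.

Lemma Zmx_graded U c v : graded U -> v \in U -> Zmx c *m v \in U.
Proof.
move=> gU vU; rewrite /Zmx mulmx_suml; apply: memv_suml => d _.
by rewrite -scalemxAl memvZ // gU.
Qed.

(** The scalar c multiplies ua by c^lowdeg and ub by c^highdeg. *)
Lemma pencil_fixed r K ua ub c x y : r != rho_0 -> @Epencil r K ua ub -> c != 0 ->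
    (x != 0) || (y != 0) ->
  (forall v, v \in (K + img (x *: ua + y *: ub))%VS ->
      Zmx c *m v \in (K + img (x *: ua + y *: ub))%VS) <->
  [\/ c ^+ lowdeg r = c ^+ highdeg r, x = 0 | y = 0].
Proof.
move=> r0 pK c0 xy; set u := x *: ua + y *: ub; split=> [fixN|h].
  have iN : into (K + img u)%VS (x * c ^+ lowdeg r *: ua + y * c ^+ highdeg r *: ub).
    move=> v; rewrite -(Zmx_pencil c x y r0 pK) -mulmxA; apply: fixN.
    by apply: subvP (addvSr _ _) _ _; apply/in_img; exists v.
  have nz : (x * c ^+ lowdeg r != 0) || (y * c ^+ highdeg r != 0).
    by rewrite !mulf_eq0 !expf_eq0 (negPf c0) !andbF !orbF.
  have [s [e1 e2]] := pencil_inj pK xy nz iN.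
  have [x0|x0] := eqVneq x 0; first by constructor 2.
  have [y0|y0] := eqVneq y 0; first by constructor 3.
  constructor 1; rewrite mulrC in e1; rewrite mulrC in e2.
  by rewrite (mulIf x0 e1) (mulIf y0 e2).
move=> v /memv_addP[k kK [_ /in_img[w ->] ->]]; rewrite mulmxDr memv_add //.
  exact: Zmx_graded (pencil_graded pK) kK.
apply/in_img; rewrite mulmxA (Zmx_pencil c x y r0 pK); case: h => [e|x0|y0].
- exists (c ^+ lowdeg r *: w); rewrite -e -scalemxAr scalemxAl; congr (_ *m _).
  by rewrite scalerDr !scalerA ![_ * c ^+ _]mulrC.
- exists (c ^+ highdeg r *: w); rewrite /u x0 mul0r !scale0r !add0r.
  by rewrite -scalemxAr scalemxAl scalerA mulrC.
- exists (c ^+ lowdeg r *: w); rewrite /u y0 mul0r !scale0r !addr0.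
  by rewrite -scalemxAr scalemxAl scalerA mulrC.
Qed.

Lemma pencil_exc r K ua ub x y : @Epencil r K ua ub -> (x != 0) || (y != 0) ->
  on_curve r (K + img (x *: ua + y *: ub))%VS.
Proof. by move=> pK xy; apply/(pencilE pK); exists x, y. Qed.

Lemma pencil_a r K ua ub : @Epencil r K ua ub -> on_curve r (K + img ua)%VS.
Proof.
move=> pK; have := @pencil_exc r K ua ub 1 0 pK; rewrite scale1r scale0r addr0.
by apply; rewrite oner_eq0.
Qed.

Lemma pencil_b r K ua ub : @Epencil r K ua ub -> on_curve r (K + img ub)%VS.
Proof.
move=> pK; have := @pencil_exc r K ua ub 0 1 pK; rewrite scale1r scale0r add0r.
by apply; rewrite oner_eq0 orbT.
Qed.

Lemma pencil_na r K ua ub : @Epencil r K ua ub -> ~ into K ua.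
Proof.
move=> pK; have := @pencil_nz r K ua ub 1 0 pK; rewrite scale1r scale0r addr0.
by apply; rewrite oner_eq0.
Qed.

Lemma pencil_nb r K ua ub : @Epencil r K ua ub -> ~ into K ub.
Proof.
move=> pK; have := @pencil_nz r K ua ub 0 1 pK; rewrite scale1r scale0r add0r.
by apply; rewrite oner_eq0 orbT.
Qed.

Lemma pencil_ab r K ua ub : @Epencil r K ua ub -> ~ into (K + img ua)%VS ub.
Proof.
move=> pK iN; have [sK _ _] := pencil_sub pK.
have hA : ub \in HomTo Q (V r) (K + img ua)%VS.
  by apply/in_HomTo; split=> //; apply: pencil_homb pK.
have [s] := line_hom sK (pencil_homa pK) (pencil_na pK) hA.
rewrite -[ub]scale1r -scaleNr addrC => /(pencil_free pK)[_ /eqP].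
by rewrite oner_eq0.
Qed.

Lemma graded_line k K (u : 'M[C]_(n, k)) a : graded K -> P a *m u = u -> graded (K + img u)%VS.
Proof.
move=> gK Pu d _ /memv_addP[l lK [_ /in_img[w ->] ->]].
have e : P d *m (u *m w) = (if d == a then u else 0) *m w.
  by rewrite -{1}Pu !mulmxA PP; case: eqP => [->|_]; rewrite ?Pu ?mul0mx.
rewrite mulmxDr e memv_add ?gK //; apply/in_img.
by case: eqP => [_|_]; [exists w|exists 0; rewrite mul0mx mulmx0].
Qed.

(** The multiplicity of V j in degree d of K_r plus a copy of V r in degree a.
    *)
Definition shift_degs r a j d : nat := (tab_at (deg_table (Kchain r)) j d + ((j == r) && (d == a)))%N.

(** The degrees of a homogeneous point of E(r) may force it to have a
    generator V r', and then it lies on E(r'). *)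
Lemma pencil_meet r K ua ub u a r' d : @Epencil r K ua ub -> r' != rho_0 -> d != 17%N ->
    on_curve r (K + img u)%VS -> hom Q (V r) u -> P a *m u = u -> ~ into K u ->
    (nbr_sum (fun j => shift_degs r a j d.+1) r' < shift_degs r a r' d.+2 + shift_degs r a r' d)%N ->
  on_curve r' (K + img u)%VS.
Proof.
move=> pK r0' d17 [excN _] hu Pu nu lt; split=> //; have [subN _] := excN.
have [sK _ _] := pencil_sub pK; have gK := pencil_graded pK.
have gm j e : mu j (deg (K + img u)%VS e) = shift_degs r a j e.
  rewrite (deg_line _ gK Pu) /shift_degs -(pencil_deg pK).
  have [->|ne] := eqVneq e a; last by rewrite andbF addn0.
  rewrite andbT mult_addV //; first by rewrite eq_sym.
    exact: stab_deg.
  by move=> iu; apply: nu => v; have /in_deg[] := iu v.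
apply: (top_of_degrees r0' subN d17); last exact: graded_line Pu.
by rewrite (eq_nbr_sum _ (fun j => gm j d.+1)) !gm.
Qed.

(** A point N of E(i) is K_i plus a copy of V i, so that all its copies of V r
    lie in K_i, whose degrees are known. *)
Lemma on_curve_other r i N : r != rho_0 -> i != rho_0 -> r != i -> on_curve i N ->
  exists2 K, (K <= N)%VS & HomTo Q (V r) K = HomTo Q (V r) N /\
    forall d, mu r (deg K d) = tab_at (deg_table (Kchain i)) r d.
Proof.
move=> r0 i0 ri hN; have [K [ua [ub pK]]] := pencil_exists i0.
have /(pencilE pK)[x [y [_ defN]]] := hN.
exists K; first by rewrite defN addvSl.
split; last by move=> d; exact: (pencil_deg pK r d).
apply: HomTo_eq; first by rewrite defN addvSl.
have [[_ eN] _] := hN; rewrite eN (pencil_dim pK) (negPf ri).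
by rewrite addn0.
Qed.

(** The submodule K_i already contains all the V r of degree highdeg r. *)
Lemma high_in_other r i K ua ub N : r \in [:: rho_1'; rho_2''] -> @Epencil r K ua ub ->
  i != rho_0 -> r != i -> on_curve i N -> into N ub.
Proof.
move=> hr pK i0 ri hN; have r0 : r != rho_0 by case: (r) hr.
have [Ki KiN [_ dKi]] := on_curve_other r0 i0 ri hN.
have KiM : (Ki <= M)%VS by apply: subv_trans KiN _; case: hN => [[[]]].
have dS : (deg Ki (highdeg r) <= deg M (highdeg r))%VS.
  by apply/subvP=> v /in_deg[vK e]; apply/in_deg; split=> //; apply: (subvP KiM).
have e1 : mu r (deg Ki (highdeg r)) = mu r (deg M (highdeg r)).
  by rewrite dKi multM //; case: (r) hr ri => // _; case: (i) i0 => //; vm_compute.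
have : ub \in HomTo Q (V r) (deg M (highdeg r)).
  apply/HomTo_deg; split; last exact: pencil_degb pK.
  by apply/in_HomTo; split; [exact: pencil_homb pK|exact: homM (pencil_homb pK)].
rewrite -(HomTo_eq dS e1) => /HomTo_deg[/in_HomTo[_ iK] _] v.
exact: subvP KiN _ (iK v).
Qed.

(** The submodule K_i contains no V r of degree lowdeg r. *)
Lemma low_notin_other r i K ua ub : r \in [:: rho_1'; rho_2''] -> @Epencil r K ua ub ->
  i != rho_0 -> r != i -> ~ on_curve i (K + img ua)%VS.
Proof.
move=> hr pK i0 ri hN; have r0 : r != rho_0 by case: (r) hr.
have [Ki KiN [eK dKi]] := on_curve_other r0 i0 ri hN.
have := dKi (lowdeg r); have -> : tab_at (deg_table (Kchain i)) r (lowdeg r) = 0%N.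
  by case: (r) hr ri => // _; case: (i) i0 => //; vm_compute.
move/eqP; rewrite (mult_deg_eq _ eK) dimv_eq0 -subv0 => /subvP m0.
have : ua \in HomTo Q (V r) (deg (K + img ua)%VS (lowdeg r)).
  apply/HomTo_deg; split; last exact: pencil_dega pK.
  apply/in_HomTo; split; first exact: pencil_homa pK.
  by apply/img_into; apply: addvSr.
move=> /m0; rewrite memv0 => /eqP ua0; apply: (pencil_na pK) => v.
by rewrite ua0 mul0mx mem0v.
Qed.

(** The submodule K + img ua lies on no other curve, so that its generators
    are copies of V r; as K has no such generator, there is only one, and
    Nakayama's lemma applies. *)
Lemma low_generates r K ua ub N : r \in [:: rho_1'; rho_2''] -> @Epencil r K ua ub ->
  (mulV N <= N)%VS -> into N ua -> (K + img ua <= N)%VS.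
Proof.
move=> hr pK mN iN; have r0 : r != rho_0 by case: (r) hr.
have [exN _] := pencil_a pK; have [[sKu KuM mKu] eKu] := exN.
have [sK KM mK] := pencil_sub pK.
have ha := pencil_homa pK.
apply: nakayama => //; apply: (subv_trans (y := mulV (K + img ua) + img ua)%VS); last first.
  by rewrite addvS //; apply/img_into.
have sW : stab Q (mulV (K + img ua) + img ua)%VS.
  by apply: stabD; [exact: (stab_mulV QX QY)|exact: (stab_img ha)].
apply: (HomTo_sub hV sKu sW) => i; have [->|i0] := eqVneq i rho_0.
  suff -> : HomTo Q (V rho_0) (K + img ua)%VS = 0%VS by rewrite sub0v.
  by apply/eqP; rewrite -dimv_eq0 -/(mult Q (V rho_0) _) (mu0 KuM).
have [->|ir] := eqVneq i r; last first.
  apply: (subv_trans (y := HomTo Q (V i) (mulV (K + img ua)))); last exact/HomToS/addvSl.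
  suff -> : HomTo Q (V i) (mulV (K + img ua)) = HomTo Q (V i) (K + img ua)%VS by [].
  apply: HomTo_eq => //; apply/eqP; rewrite eqn_leq multS //= leqNgt; apply/negP => lt.
  by apply: (low_notin_other hr pK i0 _ (conj exN lt)); rewrite eq_sym.
apply/subvP=> A hA; have [s iK] := line_hom sK ha (pencil_na pK) hA.
have eK j : mu j K = entry (label_count (Kchain r)) j.
  by apply: (@addIn (j == r)); rewrite -(pencil_dim pK) (Kchain_count j r0).
have topK := no_top r0 (pencil_sub pK) eK (Kchain_excluded r0).
have : A - s *: ua \in HomTo Q (V r) K.
  apply/in_HomTo; split=> //; move/in_HomTo: hA => [hA _].
  by have := homD 1 (- s) hA ha; rewrite scale1r scaleNr.
rewrite -(HomTo_eq mK topK) => /in_HomTo[_ iKm]; move/in_HomTo: hA => [hA _].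
apply/in_HomTo; split=> // v; rewrite -[A](subrK (s *: ua)) mulmxDl memv_add //.
  have mS : (mulV K <= mulV (K + img ua))%VS by apply: mulVS; exact: addvSl.
  exact: (subvP mS) _ (iKm v).
by rewrite -scalemxAl memvZ //; apply/in_img; exists v.
Qed.

End Chain.

(** * Homogeneous parts and linear substitutions *)

Section Polynomials.
Variable C : fieldType.
Local Notation S := {mpoly C[2]}.
Local Notation hpart := (@pihomog 2 C mdeg).
Implicit Types f g a b : S.

Lemma mcoeff_hpart d f m : (hpart d f)@_m = if mdeg m == d then f@_m else 0.
Proof.
have ef := congr1 (mcoeff m) (mpolyE f); rewrite raddf_sum /= in ef; rewrite ef.
rewrite pihomogE raddf_sum /= big_mkcond /=.
transitivity (\sum_(m' <- msupp f) if mdeg m == d then (f@_m' *: 'X_[m'])@_m else 0 : C).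
  apply: eq_bigr => m' _; rewrite mcoeffZ mcoeffX.
  have [->|ne] := eqVneq m' m; first by [].
  by rewrite mulr0; case: ifP; case: ifP.
by case: ifP => // _; rewrite big1.
Qed.

Lemma hpart_sum d I (r : seq I) (P : pred I) (F : I -> S) :
  hpart d (\sum_(i <- r | P i) F i) = \sum_(i <- r | P i) hpart d (F i).
Proof. exact: linear_sum. Qed.

Lemma hpart_eq f g : (forall d, hpart d f = hpart d g) -> f = g.
Proof.
move=> e; apply/mpolyP=> m; have := congr1 (mcoeff m) (e (mdeg m)).
by rewrite !mcoeff_hpart eqxx.
Qed.

Lemma hpart_homM d e g f : g \is e.-homog ->
  hpart d (g * f) = if (e <= d)%N then g * hpart (d - e) f else 0.
Proof.
move=> hg; rewrite {1}(pihomog_partitionE (leqnn (mmeasure mdeg f))).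
rewrite mulr_sumr linear_sum /=; case: leqP => [ed|de]; last first.
  apply: big1 => j _; apply: pihomog_ne0 (dhomogM hg (pihomogP _ _ _)).
  by rewrite neq_ltn orbC (leq_trans de) ?leq_addr.
have [lt|ge] := ltnP (d - e) (mmeasure mdeg f).
  rewrite (bigD1 (Ordinal lt)) //= big1 => [|j nj]; last first.
    apply: pihomog_ne0 (dhomogM hg (pihomogP _ _ _)).
    apply: contraNneq nj => ej; apply/eqP/val_inj => /=; lia.
  rewrite addr0 pihomog_dE //; have := dhomogM hg (pihomogP mdeg (d - e) f).
  by rewrite subnKC.
rewrite big1 => [|j _]; last first.
  apply: pihomog_ne0 (dhomogM hg (pihomogP _ _ _)).
  by have := ltn_ord j; lia.
suff -> : hpart (d - e) f = 0 by rewrite mulr0.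
apply/mpolyP=> m; rewrite mcoeff_hpart mcoeff0; case: eqP => // em.
by apply/memN_msupp_eq0; apply: contraL ge => /msize_mdeg_lt; rewrite em -ltnNge.
Qed.

Lemma hpartK d e f : hpart d (hpart e f) = if d == e then hpart d f else 0.
Proof.
apply/mpolyP=> m; rewrite !mcoeff_hpart; have [->|ne] := eqVneq d e.
  by rewrite mcoeff_hpart; do ?case: eqP.
by rewrite mcoeff0; case: eqP => // ->; rewrite (negPf ne).
Qed.

Lemma homX (i : 'I_2) : ('X_i : S) \is 1%N.-homog.
Proof. by rewrite dhomogX /= mdeg1. Qed.

Lemma hpartX d (i : 'I_2) f : hpart d.+1 ('X_i * f) = 'X_i * hpart d f.
Proof. by rewrite (hpart_homM _ _ (homX i)) /= subSS subn0. Qed.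

Lemma hpartX0 (i : 'I_2) f : hpart 0 ('X_i * f) = 0.
Proof. by rewrite (hpart_homM _ _ (homX i)). Qed.

(** The power m^k, described by the vanishing of homogeneous parts. *)
Definition mpow k f : Prop := forall d, (d < k)%N -> hpart d f = 0.

Lemma mpow_coeff k f : (forall m, (mdeg m < k)%N -> f@_m = 0) <-> mpow k f.
Proof.
split=> [h d dk|h m mk].
  by apply/mpolyP=> m; rewrite mcoeff_hpart mcoeff0; case: eqP => // e; apply: h; rewrite e.
by have := congr1 (mcoeff m) (h _ mk); rewrite mcoeff_hpart eqxx mcoeff0.
Qed.

Lemma mpow_ideal k : is_ideal (mpow k).
Proof.
split=> [d _|f g hf hg d dk|f g hg d dk]; first by rewrite linear0.
  by rewrite linearD /= hf // hg // addr0.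
rewrite (pihomog_partitionE (leqnn (mmeasure mdeg f))) mulr_suml linear_sum.
apply: big1 => j _ /=; rewrite (hpart_homM _ _ (pihomogP _ _ _)); case: ifP => // _.
by rewrite hg ?mulr0 // (leq_ltn_trans _ dk) // leq_subr.
Qed.

Lemma mpowX k (i : 'I_2) f : mpow k f -> mpow k.+1 ('X_i * f).
Proof.
by move=> h [_|d dk]; [rewrite hpartX0|rewrite hpartX h ?mulr0].
Qed.

Lemma mpow1 f : mpow 1 f <-> f@_0%MM = 0.
Proof.
split=> [/mpow_coeff h|h]; first by apply: h; rewrite mdeg0.
by apply/mpow_coeff => m; rewrite ltnS leqn0 mdeg_eq0 => /eqP ->.
Qed.

Lemma coefXM (i : 'I_2) f m : ('X_i * f)@_m = if m i == 0%N then 0 else f@_(m - U_(i))%MM.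
Proof.
case: eqP => [mi0|/eqP mi].
  rewrite [f]mpolyE mulr_sumr raddf_sum big1 // => m' _ /=.
  rewrite -scalerAr mcoeffZ -mpolyXD mcoeffX; case: eqP => [e|_]; last by rewrite mulr0.
  by move: mi0; rewrite -e mnmDE mnm1E eqxx.
have e := mcoeffMX f U_(i)%MM (m - U_(i))%MM; rewrite addmC submK 1?mulrC in e; first exact: e.
by apply/mnm_lepP => j; rewrite mnm1E; case: eqP => // <-; rewrite lt0n.
Qed.

Lemma divX (i : 'I_2) f : (forall m : 'X_{1..2}, m i = 0%N -> f@_m = 0) -> exists g, f = 'X_i * g.
Proof.
move=> h; exists (\sum_(m <- msupp f) f@_m *: 'X_[m - U_(i)]).
rewrite {1}[f]mpolyE mulr_sumr; apply: eq_big_seq => m mf.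
rewrite -scalerAr -mpolyXD addmC submK //; apply/mnm_lepP => j; rewrite mnm1E.
case: eqP => // <-; rewrite lt0n; apply: contraL mf => /eqP mi0.
by rewrite -mcoeff_eq0 h.
Qed.

Lemma X_neq0 (i : 'I_2) : ('X_i : S) != 0.
Proof. by apply/eqP => /mpolyP/(_ U_(i)%MM); rewrite mcoeffXU eqxx mcoeff0 => /eqP; rewrite oner_eq0. Qed.

Local Notation x := ('X_(0 : 'I_2) : S).
Local Notation y := ('X_(1 : 'I_2) : S).

Lemma ord2 (i : 'I_2) : i = 0 \/ i = 1.
Proof. by case: i => [[|[|//]] ?]; [left|right]; apply: val_inj. Qed.

(** Exactness of the Koszul complex of x and y on polynomials. *)
Lemma koszul_xy f g : y * g = x * f -> exists k, g = x * k /\ f = y * k.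
Proof.
move=> e; have [m m0|k ek] := @divX 0 g; last first.
  exists k; split=> //; apply: (mulfI (X_neq0 0)).
  by rewrite -e ek mulrCA.
have := congr1 (mcoeff (m + U_(1))%MM) e; rewrite !coefXM !mnmDE !mnm1E /= m0 add0n.
by rewrite addn1 /= addmK.
Qed.

Lemma mpow1_split f : f@_0%MM = 0 -> exists a b, f = x * a + y * b.
Proof.
move=> f0; pose f1 := \sum_(m <- msupp f | m 0 == 0%N) f@_m *: 'X_[m].
have c1 m : f1@_m = if m 0 == 0%N then f@_m else 0.
  have ef := congr1 (mcoeff m) (mpolyE f); rewrite raddf_sum /= in ef; rewrite ef.
  rewrite /f1 raddf_sum /= big_mkcond /=.
  transitivity (\sum_(m' <- msupp f) if m 0 == 0%N then (f@_m' *: 'X_[m'])@_m else 0 : C).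
    apply: eq_bigr => m' _; rewrite mcoeffZ mcoeffX; have [->|ne] := eqVneq m' m; first by [].
    by rewrite mulr0; case: ifP; case: ifP.
  by case: ifP => // _; rewrite big1.
have [m m0|a ea] := @divX 0 (f - f1).
  by rewrite mcoeffB c1 m0 subrr.
have [m m1|b eb] := @divX 1 f1.
  rewrite c1; case: eqP => // m0; suff -> : m = 0%MM by [].
  by apply/mnmP => j; rewrite mnm0E; case: (ord2 j) => ->.
by exists a, b; rewrite -ea -eb subrK.
Qed.

Section Act.

Lemma act1 f : act 1%:M f = f.
Proof.
rewrite /act -[RHS]comp_mpoly_id; congr (f \mPo _); apply: eq_from_tnth => j.
rewrite !tnth_mktuple (bigD1 j) //= mxE eqxx scale1r big1 ?addr0 // => i nij.
by rewrite mxE (negPf nij) scale0r.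
Qed.

Lemma actD (g : 'M[C]_2) f1 f2 : act g (f1 + f2) = act g f1 + act g f2.
Proof. exact: comp_mpolyD. Qed.

Lemma actZ (g : 'M[C]_2) c f : act g (c *: f) = c *: act g f.
Proof. exact: comp_mpolyZ. Qed.

Lemma actM (g : 'M[C]_2) f1 f2 : act g (f1 * f2) = act g f1 * act g f2.
Proof. exact: rmorphM. Qed.

Lemma actX (g : 'M[C]_2) (j : 'I_2) : act g 'X_j = \sum_(i < 2) g i j *: 'X_i.
Proof. by rewrite /act comp_mpolyXU -tnth_nth tnth_mktuple. Qed.

Lemma act_is_linear (g : 'M[C]_2) : linear (act g).
Proof. by move=> c u v; rewrite actD actZ. Qed.

Lemma act_sum (g : 'M[C]_2) I (r : seq I) (P : pred I) (F : I -> S) :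
  act g (\sum_(i <- r | P i) F i) = \sum_(i <- r | P i) act g (F i).
Proof. exact: raddf_sum. Qed.

Lemma act0 (g : 'M[C]_2) : act g 0 = 0.
Proof. exact: comp_mpoly0. Qed.

Lemma act_eq (F1 F2 : {rmorphism S -> S}) : (forall c, F1 c%:MP = F2 c%:MP) ->
  (forall j : 'I_2, F1 'X_j = F2 'X_j) -> F1 =1 F2.
Proof.
move=> eC eX f; rewrite [f]mpolyE !rmorph_sum; apply: eq_bigr => m _ /=.
rewrite -mul_mpolyC !rmorphM /= eC; congr (_ * _).
by rewrite mpolyXE_id !rmorph_prod; apply: eq_bigr => j _ /=; rewrite !rmorphXn /= eX.
Qed.

Lemma act_mul (g h : 'M[C]_2) f : act (g *m h) f = act g (act h f).
Proof.
apply: (@act_eq (comp_mpoly _) (comp_mpoly _ \o comp_mpoly _)) => [c|j] /=.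
  by rewrite !comp_mpolyC.
rewrite -/(act _ _) -/(act h _) -/(act g _) !actX act_sum.
transitivity (\sum_(i < 2) \sum_k (g k i * h i j) *: ('X_k : S)).
  by rewrite exchange_big; apply: eq_bigr => k _; rewrite mxE scaler_suml.
apply: eq_bigr => i _; rewrite actZ actX scaler_sumr.
by apply: eq_bigr => k _; rewrite scalerA mulrC.
Qed.

Lemma act_homog (g : 'M[C]_2) d f : f \is d.-homog -> act g f \is d.-homog.
Proof.
move=> /dhomogP hf; rewrite /act comp_mpolyE big_seq; apply: rpred_sum => m mf.
have dm : d = (m ord0 + m (lift ord0 ord0))%N.
  by rewrite -(hf m mf) /= mdegE !big_ord_recl big_ord0 addn0.
rewrite rpredZ // dm !big_ord_recl !big_ord0 mulr1.
have hl i : (tnth [tuple \sum_(i < 2) g i j *: ('X_i : S) | j < 2] i) \is 1%N.-homog.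
  by rewrite tnth_mktuple; apply: rpred_sum => k _; rewrite rpredZ ?homX.
by apply: dhomogM; rewrite -[X in X.-homog]mul1n; apply: dhomogMn.
Qed.

(** The action is by linear substitutions, so it preserves degrees. *)
Lemma act_hpart (g : 'M[C]_2) d f : act g (hpart d f) = hpart d (act g f).
Proof.
have -> : act g f = \sum_(j < mmeasure mdeg f) act g (hpart j f).
  by rewrite -act_sum -(pihomog_partitionE (leqnn (mmeasure mdeg f))).
rewrite hpart_sum.
have [lt|ge] := ltnP d (mmeasure mdeg f).
  rewrite (bigD1 (Ordinal lt)) //= big1 => [|j nj]; last first.
    apply: pihomog_ne0 (act_homog g (pihomogP mdeg j f)).
    by apply: contraNneq nj => ej; apply/eqP/val_inj.
  by rewrite addr0; apply/esym/pihomog_dE/act_homog; apply: pihomogP.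
rewrite big1 => [|j _]; last first.
  apply: pihomog_ne0 (act_homog g (pihomogP mdeg j f)).
  by have := ltn_ord j; lia.
suff -> : hpart d f = 0 by rewrite act0.
apply/mpolyP=> m; rewrite mcoeff_hpart mcoeff0; case: eqP => // em.
by apply/memN_msupp_eq0; apply: contraL ge => /msize_mdeg_lt; rewrite em -ltnNge.
Qed.

Lemma act_scalar c d f : f \is d.-homog -> act (c%:M : 'M[C]_2) f = c ^+ d *: f.
Proof.
move=> /dhomogP hf; rewrite /act comp_mpolyE [X in _ = _ *: X](mpolyE f) scaler_sumr.
apply: eq_big_seq => m mf; rewrite scalerA [c ^+ d * _]mulrC -scalerA; congr (_ *: _).
have hl i : tnth [tuple \sum_(i < 2) (c%:M : 'M[C]_2) i j *: ('X_i : S) | j < 2] i = c *: 'X_i.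
  rewrite tnth_mktuple (bigD1 i) //= mxE eqxx big1 ?addr0 // => k nk.
  by rewrite mxE (negPf nk) scale0r.
rewrite (eq_bigr (fun i => c ^+ m i *: 'X_i ^+ m i)) => [|i _]; last by rewrite hl exprZn.
by rewrite scaler_prod -mpolyXE_id prodrXr -mdegE (hf m mf).
Qed.

End Act.

End Polynomials.

(** * Quotients of the polynomial ring in coordinates *)

Section Quotient.
Variables (C : numClosedFieldType) (gT : finGroupType) (H : {group gT}).
Local Notation S := {mpoly C[2]}.
Local Notation rep := (mx_representation C H).
Local Notation hpart := (@pihomog 2 C mdeg).
Variable rH : rep 2.

Lemma ideal_sub (J : set S) : is_ideal J ->
  [/\ J 0, forall f g, J f -> J g -> J (f + g), forall c f, J f -> J (c *: f),
      forall f g, J f -> J g -> J (f - g) & forall f g, J g -> J (f * g)].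
Proof.
move=> [J0 JD JM]; have JZ c f : J f -> J (c *: f).
  by move=> Jf; rewrite -mul_mpolyC; apply: JM.
by split=> // f g Jf Jg; rewrite -scaleN1r; apply/JD/JZ.
Qed.

(** A polynomial modulo J is determined by its coefficients in degrees less
    than D. *)
Lemma quot_exists (J : set S) D : is_ideal J -> (forall f, mpow D f -> J f) ->
  exists n (p : {linear S -> 'cV[C]_n}),
    (forall v, exists f, p f = v) /\ (forall f, p f = 0 <-> J f).
Proof.
move=> /ideal_sub[J0 JD JZ JB _] JT.
pose W : vectType C := {ffun 'X_{1..2 < D} -> C^o}.
pose p0 (f : S) : W := [ffun m : 'X_{1..2 < D} => f@_m].
have lin0 : linear p0.
  by move=> c f g; apply/ffunP=> m; rewrite !ffunE mcoeffD mcoeffZ.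
pose U : {vspace W} := vs [set w | exists2 f, J f & p0 f = w].
have inU w : (w \in U) <-> exists2 f, J f & p0 f = w.
  apply: in_vs; split=> [|a u v [f Jf <-] [g Jg <-]].
    by exists 0 => //; apply/ffunP=> m; rewrite !ffunE mcoeff0.
  by exists (a *: f + g); [apply/JD => //; apply: JZ|rewrite lin0].
have surj0 w : exists f, p0 f = w.
  exists (\sum_m w m *: 'X_[m]); apply/ffunP=> m; rewrite ffunE raddf_sum /=.
  rewrite (bigD1 m) //= mcoeffZ mcoeffX eqxx mulr1 big1 ?addr0 // => m' nm.
  by rewrite mcoeffZ mcoeffX -bmeqP (negPf nm) mulr0.
pose b := vbasis (U^C)%VS.
pose q (w : W) : 'cV[C]_(\dim (U^C)%VS) := \col_i coord b i (w - projv U w).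
have linq : linear q.
  move=> c u v; apply/matrixP=> i j; rewrite !mxE -linearP.
  by congr (coord b i _); rewrite linearP /= scalerBr opprD addrACA.
have ker_q w : q w = 0 <-> w \in U.
  split=> [e|wU]; last by apply/matrixP=> i j; rewrite !mxE projv_id // subrr linear0.
  have wC := memv_projC U w; rewrite -[w](subrK (projv U w)).
  rewrite (coord_vbasis wC) big1 ?add0r ?memv_proj // => i _.
  by have /matrixP/(_ i 0) := e; rewrite !mxE => ->; rewrite scale0r.
have surjq v : exists w, q w = v.
  have wC : \sum_i v i 0 *: b`_i \in (U^C)%VS.
    apply: memv_suml => i _; apply/memvZ/vbasis_mem.
    by rewrite mem_nth // size_tuple.
  exists (\sum_i v i 0 *: b`_i); apply/matrixP=> i j; rewrite !mxE ord1.
  set w := (X in coord b i X); have -> : w = \sum_i v i 0 *: b`_i.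
    rewrite /w; suff -> : projv U (\sum_i v i 0 *: b`_i) = 0 by rewrite subr0.
    apply/eqP; rewrite -memv_ker lker_proj //.
  by rewrite coord_sum_free //; apply: basis_free (vbasisP _).
exists (\dim (U^C)%VS).
have linp : linear (q \o p0) by move=> c f g; rewrite /= lin0 linq.
pose qp : S -> 'cV[C]_(\dim (U^C)%VS) := q \o p0.
pose pL : {linear S -> 'cV[C]_(\dim (U^C)%VS)} := HB.pack qp (GRing.isLinear.Build _ _ _ _ qp linp).
exists pL; split=> /=.
  by move=> v; have [w <-] := surjq v; have [f <-] := surj0 w; exists f.
move=> f; split=> [/ker_q/inU[g Jg e]|Jf]; last by apply/ker_q/inU; exists f.
rewrite -[f](subrK g); apply: JD => //; apply/JT/mpow_coeff => m mD.
have /ffunP/(_ (BMultinom mD)) := e; rewrite !ffunE /= => e'.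
by rewrite mcoeffB e' subrr.
Qed.

Lemma induced n (p : {linear S -> 'cV[C]_n}) (J : set S) (T : S -> S) :
    (forall v, exists f, p f = v) -> (forall f, p f = 0 <-> J f) ->
    linear T -> (forall f, J f -> J (T f)) ->
  exists A : 'M[C]_n, forall f, p (T f) = A *m p f.
Proof.
move=> surj ker linT JT; pose TL : {linear S -> S} := HB.pack T (GRing.isLinear.Build _ _ _ _ T linT).
have [v||| g gP] := @lin_choice C _ n (fun v u => forall f, p f = v -> p (TL f) = u).
- have [f ef] := surj v; exists (p (TL f)) => f' ef'.
  apply/eqP; rewrite -subr_eq0 -!linearB; apply/eqP/ker; apply: JT.
  by apply/ker; rewrite linearB ef ef' subrr.
- move=> a v v' u u' hu hu' f ef; have [k ek] := surj v.
  have e' : p (f - a *: k) = v' by rewrite linearB linearZ /= ek ef addrC addKr.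
  have eT : TL (f - a *: k) = TL f - a *: TL k by rewrite linearB linearZ.
  by rewrite -(hu _ ek) -(hu' _ e') eT linearB linearZ /= addrC subrK.
- by move=> f ef; apply/ker/JT/ker.
by exists (colmx g) => f; rewrite colmxE (gP (p f) f).
Qed.

(** The quotient of the polynomial ring by a homogeneous stable ideal J, in
    coordinates: p is the projection, Q, X, Y and P d are the maps induced by
    the group, by the multiplications by x and y, and by the projections onto
    homogeneous parts. *)
Record quot_mod (J : set S) n (p : {linear S -> 'cV[C]_n}) (Q : rep n)
    (X Y : 'M[C]_n) (P : nat -> 'M[C]_n) : Prop := QuotMod {
  qm_surj : forall v, exists f, p f = v;
  qm_ker : forall f, p f = 0 <-> J f;
  qm_act : forall h f, h \in H -> p (act (rH h) f) = Q h *m p f;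
  qm_X : forall f, p ('X_0 * f) = X *m p f;
  qm_Y : forall f, p ('X_1 * f) = Y *m p f;
  qm_P : forall d f, p (hpart d f) = P d *m p f
}.

Lemma quot_mod_exists (J : set S) D : is_ideal J ->
    (forall h f, h \in H -> J f -> J (act (rH h) f)) ->
    (forall d f, J f -> J (hpart d f)) -> (forall f, mpow D f -> J f) ->
  exists n p Q X Y P, @quot_mod J n p Q X Y P.
Proof.
move=> idJ JH Jh JT; have [J0 JD JZ JB JM] := ideal_sub idJ.
have [n [p [surj ker]]] := quot_exists idJ JT.
have ind T := induced surj ker (T := T).
have linX (i : 'I_2) : linear (fun f : S => 'X_i * f).
  by move=> a u v; rewrite mulrDr scalerAr.
have linh d : linear (hpart d) by move=> a u v; rewrite linearP.
have [X eX] := ind (fun f => 'X_0 * f) (linX 0) (fun f => JM _ f).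
have [Y eY] := ind (fun f => 'X_1 * f) (linX 1) (fun f => JM _ f).
have [P eP] := choice (fun d => ind (hpart d) (linh d) (Jh d)).
have [Qf eQ] : exists Qf : gT -> 'M[C]_n, forall h, h \in H ->
    forall f, p (act (rH h) f) = Qf h *m p f.
  have ex h : exists A : 'M[C]_n, h \in H -> forall f, p (act (rH h) f) = A *m p f.
    have [Hh|nH] := boolP (h \in H); last by exists 0.
    have [A eA] := ind (act (rH h)) (act_is_linear _) (JH h ^~ Hh).
    by exists A.
  by have [Qf hQf] := choice ex; exists Qf.
have rQ : mx_repr H Qf.
  split=> [|g h Hg Hh]; apply: eq_colmx => v; have [f <-] := surj v.
    by rewrite -eQ // repr_mx1 act1 mul1mx.
  by rewrite -eQ ?groupM // repr_mxM // act_mul eQ // eQ // mulmxA.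
exists n, p, (MxRepresentation rQ), X, Y, P; split=> // h f Hh.
exact: eQ.
Qed.

Section Theory.
Variables (J : set S) (n : nat) (p : {linear S -> 'cV[C]_n}) (Q : rep n).
Variables (X Y : 'M[C]_n) (P : nat -> 'M[C]_n).
Hypothesis qm : quot_mod J p Q X Y P.

Let surj := qm_surj qm.

Lemma qm_eq f g : p f = p g <-> J (f - g).
Proof.
split=> [e|/(qm_ker qm)]; first by apply/(qm_ker qm); rewrite linearB e subrr.
by rewrite linearB => /eqP; rewrite subr_eq0 => /eqP.
Qed.

Definition proj_image (J' : set S) : {vspace 'cV[C]_n} :=
  vs [set v | exists2 f, J' f & p f = v].

Lemma in_proj_image (J' : set S) v : J' 0 -> (forall f g, J' f -> J' g -> J' (f + g)) ->
    (forall c f, J' f -> J' (c *: f)) ->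
  (v \in proj_image J') <-> exists2 f, J' f & p f = v.
Proof.
move=> J0 JD JZ; apply: in_vs; split=> [|a _ _ [f Jf <-] [g Jg <-]].
  by exists 0; rewrite ?linear0.
by exists (a *: f + g); [apply/JD => //; apply: JZ|rewrite linearP].
Qed.

Lemma qm_XY : X *m Y = Y *m X.
Proof.
apply: eq_colmx => v; have [f <-] := surj v; rewrite -!mulmxA.
by rewrite -!(qm_X qm, qm_Y qm) mulrCA.
Qed.

Lemma qm_QX h : h \in H -> Q h *m X = (rH h 0 0 *: X + rH h 1 0 *: Y) *m Q h.
Proof.
move=> Hh; apply: eq_colmx => v; have [f <-] := surj v; rewrite -!mulmxA.
rewrite -(qm_X qm) -!(qm_act qm) // actM actX mulmxDl -!scalemxAl.
rewrite -(qm_X qm) -(qm_Y qm) -!linearZ -linearD; congr (p _).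
rewrite !big_ord_recl big_ord0 addr0 mulrDl -!scalerAl.
by congr (_ + rH h _ _ *: ('X_ _ * _)); apply: val_inj.
Qed.

Lemma qm_QY h : h \in H -> Q h *m Y = (rH h 0 1 *: X + rH h 1 1 *: Y) *m Q h.
Proof.
move=> Hh; apply: eq_colmx => v; have [f <-] := surj v; rewrite -!mulmxA.
rewrite -(qm_Y qm) -!(qm_act qm) // actM actX mulmxDl -!scalemxAl.
rewrite -(qm_X qm) -(qm_Y qm) -!linearZ -linearD; congr (p _).
rewrite !big_ord_recl big_ord0 addr0 mulrDl -!scalerAl.
by congr (_ + rH h _ _ *: ('X_ _ * _)); apply: val_inj.
Qed.

Lemma qm_hP d : hom Q Q (P d).
Proof.
move=> h Hh; apply: eq_colmx => v; have [f <-] := surj v; rewrite -!mulmxA.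
by rewrite -(qm_P qm) -!(qm_act qm) // -(qm_P qm) act_hpart.
Qed.

Lemma qm_PP d e : P d *m P e = if d == e then P d else 0.
Proof.
apply: eq_colmx => v; have [f <-] := surj v; rewrite -!mulmxA.
rewrite -!(qm_P qm) hpartK; case: eqP => _; first by rewrite -(qm_P qm).
by rewrite linear0 mul0mx.
Qed.

Lemma qm_PX d : P d.+1 *m X = X *m P d.
Proof.
apply: eq_colmx => v; have [f <-] := surj v; rewrite -!mulmxA.
by rewrite -(qm_X qm) -!(qm_P qm) hpartX (qm_X qm).
Qed.

Lemma qm_PY d : P d.+1 *m Y = Y *m P d.
Proof.
apply: eq_colmx => v; have [f <-] := surj v; rewrite -!mulmxA.
by rewrite -(qm_Y qm) -!(qm_P qm) hpartX (qm_Y qm).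
Qed.

Lemma qm_P0X : P 0%N *m X = 0.
Proof.
apply: eq_colmx => v; have [f <-] := surj v; rewrite -!mulmxA.
by rewrite -(qm_X qm) -!(qm_P qm) hpartX0 linear0 mul0mx.
Qed.

Lemma qm_P0Y : P 0%N *m Y = 0.
Proof.
apply: eq_colmx => v; have [f <-] := surj v; rewrite -!mulmxA.
by rewrite -(qm_Y qm) -!(qm_P qm) hpartX0 linear0 mul0mx.
Qed.

Section Bounded.
Variable D : nat.
Hypothesis JD : forall f, mpow D f -> J f.

Lemma qm_PD d : (D <= d)%N -> P d = 0.
Proof.
move=> Dd; apply: eq_colmx => v; have [f <-] := surj v.
rewrite -(qm_P qm) mul0mx; apply/(qm_ker qm)/JD => e eD.
by rewrite hpartK; case: eqP => // ed; move: Dd; rewrite -ed leqNgt eD.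
Qed.

Lemma qm_sumP : \sum_(d < D) P d = 1%:M.
Proof.
apply: eq_colmx => v; have [f <-] := surj v; rewrite mulmx_suml mul1mx.
transitivity (p (\sum_(d < D) hpart d f)).
  by rewrite linear_sum; apply: eq_bigr => d _; rewrite -(qm_P qm).
apply/qm_eq/JD => e eD; rewrite linearB /= hpart_sum (bigD1 (Ordinal eD)) //=.
rewrite hpartK eqxx big1 ?addr0 ?subrr // => j nj; rewrite hpartK.
by case: eqP => // ej; case/eqP: nj; apply: val_inj.
Qed.

End Bounded.
End Theory.
End Quotient.

(** * The ideal of Klein's invariants *)

Section Klein.
Variable C : numClosedFieldType.
Local Notation S := {mpoly C[2]}.
Local Notation hpart := (@pihomog 2 C mdeg).
Local Notation x := ('X_(0 : 'I_2) : S).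
Local Notation y := ('X_(1 : 'I_2) : S).
Implicit Types f g a b : S.

Definition f8 : S := x ^+ 8 + 14%:R * (x ^+ 4 * y ^+ 4) + y ^+ 8.
Definition e12 : S := x ^+ 6 * y ^+ 6.
Definition f12 : S := (x ^+ 5 * y - x * y ^+ 5) ^+ 2.

(** The square of the sextic T, written so as to show that f8 and f12 generate
    the same ideal as f8 and x^6 y^6. *)
Lemma f12E : f12 = x ^+ 2 * y ^+ 2 * f8 - 16%:R * e12.
Proof. rewrite /f12 /f8 /e12; ring. Qed.

Lemma homXn (i : 'I_2) k : ('X_i ^+ k : S) \is k.-homog.
Proof. by rewrite -[X in X.-homog]mul1n; apply/dhomogMn/homX. Qed.

Lemma f8_hom : f8 \is 8.-homog.
Proof.
rewrite /f8 !rpredD ?homXn // mulr_natl rpredMn //.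
exact: (dhomogM (homXn 0 4) (homXn 1 4)).
Qed.

Lemma e12_hom : e12 \is 12.-homog.
Proof. exact: (dhomogM (homXn 0 6) (homXn 1 6)). Qed.

Lemma f8_peel0 a b : f8 * a = x * b -> exists a', a = x * a' /\ f8 * a' = b.
Proof.
move=> e; have [m m0|a' ea] := @divX C 0 a; last first.
  by exists a'; split=> //; apply: (mulfI (@X_neq0 C 0)); rewrite -e ea mulrCA.
have e8 : x * (b - (x ^+ 7 + 14%:R * (x ^+ 3 * y ^+ 4)) * a) = a * 'X_[U_(1%R) *+ 8].
  rewrite -mpolyXn mulrBr -e /f8; ring.
have := congr1 (mcoeff (U_(1%R) *+ 8 + m)%MM) e8; rewrite mcoeffMX coefXM.
by rewrite mnmDE mulmnE mnm1E /= mul0n m0 /= => <-.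
Qed.

Lemma f8_peel1 a b : f8 * a = y * b -> exists a', a = y * a' /\ f8 * a' = b.
Proof.
move=> e; have [m m0|a' ea] := @divX C 1 a; last first.
  by exists a'; split=> //; apply: (mulfI (@X_neq0 C 1)); rewrite -e ea mulrCA.
have e8 : y * (b - (y ^+ 7 + 14%:R * (x ^+ 4 * y ^+ 3)) * a) = a * 'X_[U_(0%R) *+ 8].
  rewrite -mpolyXn mulrBr -e /f8; ring.
have := congr1 (mcoeff (U_(0%R) *+ 8 + m)%MM) e8; rewrite mcoeffMX coefXM.
by rewrite mnmDE mulmnE mnm1E /= mul0n m0 /= => <-.
Qed.

Lemma f8_peel k l a b : f8 * a = x ^+ k * y ^+ l * b -> exists a', f8 * a' = b.
Proof.
elim: k a => [|k IH] a; last first.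
  by rewrite exprS -!mulrA => /f8_peel0[a' [_ e]]; apply: (IH a'); rewrite e !mulrA.
elim: l a => [|l IH] a; first by rewrite !expr0 !mul1r => e; exists a.
rewrite expr0 mul1r exprS -mulrA => /f8_peel1[a' [_ e]].
by apply: (IH a'); rewrite e expr0 mul1r.
Qed.

Lemma f8_neq0 : f8 != 0.
Proof.
apply/eqP => f0; have [a [e1 _]] : exists a, 1 = x * a /\ f8 * a = 0.
  by apply: f8_peel0; rewrite f0 mul0r mulr0.
have := congr1 (hpart 0) e1; rewrite hpartX0 pihomog_dE ?dhomog1 //.
by move/eqP; rewrite oner_eq0.
Qed.

(** Powers of x and y can be cancelled modulo f8 (f8_peel), so f8 divides b;
    but b has no part of degree at least 8. *)
Lemma f8_coprime a b : (forall d, (8 <= d)%N -> hpart d b = 0) ->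
  f8 * a = e12 * b -> b = 0 /\ a = 0.
Proof.
move=> hb e; have [a' ea'] := f8_peel e.
have a'0 : a' = 0.
  apply: hpart_eq => d; rewrite linear0; apply/eqP.
  have := hpart_homM (d + 8) a' f8_hom; rewrite leq_addl addnK ea' hb ?leq_addl //.
  by move/esym/eqP; rewrite mulf_eq0 (negPf f8_neq0) orFb; apply.
have b0 : b = 0 by rewrite -ea' a'0 mulr0.
split=> //; move/eqP: e; rewrite b0 mulr0 mulf_eq0 (negPf f8_neq0).
by move/eqP.
Qed.

(** The ideal n, by invariant_idealE.  Writing m^18 as a summand makes the
    quotient visibly finite-dimensional. *)
Definition klein_ideal : set S :=
  [set f | exists a b c, mpow 18 c /\ f = f8 * a + e12 * b + c].

Lemma klein_is_ideal : is_ideal klein_ideal.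
Proof.
have [m0 mD mM] := @mpow_ideal C 18; split.
- by exists 0, 0, 0; rewrite !mulr0 !addr0.
- move=> _ _ [a [b [c [hc ->]]]] [a' [b' [c' [hc' ->]]]].
  by exists (a + a'), (b + b'), (c + c'); split; [apply: mD|ring].
- move=> f _ [a [b [c [hc ->]]]].
  by exists (f * a), (f * b), (f * c); split; [apply: mM|ring].
Qed.

Lemma mpow_hpart k d f : mpow k f -> mpow k (hpart d f).
Proof. by move=> h e ek; rewrite hpartK; case: eqP => // _; apply: h. Qed.

Lemma klein_hpart d f : klein_ideal f -> klein_ideal (hpart d f).
Proof.
have [k0 kD kM] := klein_is_ideal.
move=> [a [b [c [hc ->]]]]; rewrite !linearD /=; apply: (kD _ _); last first.
  by exists 0, 0, (hpart d c); rewrite !mulr0 !add0r; split=> //; apply: mpow_hpart.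
rewrite (hpart_homM _ _ f8_hom) (hpart_homM _ _ e12_hom); apply: (kD _ _); case: ifP => _ //.
  by exists (hpart (d - 8) a), 0, 0; split; [case: (@mpow_ideal C 18)|ring].
by exists 0, (hpart (d - 12) b), 0; split; [case: (@mpow_ideal C 18)|ring].
Qed.

Definition hsub d e a : S := if (e <= d)%N then hpart (d - e) a else 0.

Lemma klein_homog d f : (d < 18)%N -> klein_ideal f ->
  exists a b, hpart d f = f8 * hsub d 8 a + e12 * hsub d 12 b.
Proof.
move=> d18 [a [b [c [hc ->]]]]; exists a, b; rewrite !linearD /= hc // addr0.
rewrite (hpart_homM _ _ f8_hom) (hpart_homM _ _ e12_hom) /hsub.
by case: ifP => _; case: ifP => _; rewrite ?mulr0.
Qed.

(** If x f = f8 A + e12 B and y f = f8 A' + e12 B' then f8 (y A - x A') = e12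
    (x B' - y B), where the last factor has degree less than 8. By coprimality
    both sides vanish, and the exactness of the Koszul complex of x and y
    shows that x divides A and B. *)
Lemma klein_socle d f : (d < 17)%N -> hpart d f = f ->
  klein_ideal (x * f) -> klein_ideal (y * f) -> klein_ideal f.
Proof.
move=> d17 hf /(klein_homog (d := d.+1) d17) [a [b exf]] /(klein_homog (d := d.+1) d17)[a' [b' eyf]].
rewrite !hpartX hf in exf eyf.
set A := hsub _ _ a in exf; set B := hsub _ _ b in exf.
set A' := hsub _ _ a' in eyf; set B' := hsub _ _ b' in eyf.
have e : f8 * (y * A - x * A') = e12 * (x * B' - y * B).
  transitivity (f8 * (y * A - x * A') - (y * (x * f) - x * (y * f))); first by ring.
  rewrite exf eyf; ring.
have degB (c : S) k j : (8 <= k)%N -> hpart k ('X_j * hsub d.+1 12 c) = 0.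
  case: k => // k k7; rewrite hpartX /hsub; case: ifP => _; last by rewrite pihomog0 mulr0.
  by rewrite hpartK; case: eqP => [ek|_]; [lia|rewrite mulr0].
have [k k8|eB eA] := f8_coprime _ e; first by rewrite linearB /= !degB // subr0.
have [k [eA' eAk]] := koszul_xy (subr0_eq eA).
have [l [eB' eBl]] := koszul_xy (esym (subr0_eq eB)).
exists k, l, 0; split; first by case: (@mpow_ideal C 18).
apply: (mulfI (@X_neq0 C 0)); rewrite exf eA' eB'; ring.
Qed.

End Klein.

(** * The invariants of H *)

Fixpoint sym_pair d : seq nat * seq nat :=
  if d is e.+1 then
    let: (a, b) := sym_pair e in
    (b, [seq (nbr_sum (entry b) i - entry a i)%N | i <- rho_0 :: labels7])
  else ([::], [:: 1%N]).

(** The multiplicities in the homogeneous polynomials of degree d, by the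
    recursion of the Koszul complex: the sum over the neighbours in degree d +
    1 is the sum of the multiplicities in degrees d and d + 2. *)
Definition sym_mult d (i : E7label) : nat := entry (sym_pair d).2 i.

Section Invariants.
Variables (C : numClosedFieldType) (gT : finGroupType) (H : {group gT}).
Local Notation rep := (mx_representation C H).
Local Notation S := {mpoly C[2]}.
Local Notation hpart := (@pihomog 2 C mdeg).
Local Notation x := ('X_(0 : 'I_2) : S).
Local Notation y := ('X_(1 : 'I_2) : S).
Local Notation f8 := (f8 C).
Local Notation e12 := (e12 C).
Local Notation f12 := (f12 C).
Variable rH : rep 2.
Hypothesis det_rH : forall h, h \in H -> \det (rH h) = 1.
Variable V : E7label -> representation C H.
Hypothesis hV : E7_labelling rH V.

Section Graded.
Variables (J : set S) (n : nat) (p : {linear S -> 'cV[C]_n}) (Q : rep n).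
Variables (X Y : 'M[C]_n) (P : nat -> 'M[C]_n).
Hypothesis qm : quot_mod rH J p Q X Y P.
Local Notation qdeg d := (degpart P fullv d).

Lemma in_qdeg d v : (v \in qdeg d) <-> exists f, hpart d f = f /\ p f = v.
Proof.
split=> [/in_deg[_ e]|[f [e <-]]].
  have [f ef] := qm_surj qm v; exists (hpart d f).
  by rewrite hpartK eqxx (qm_P qm) ef.
by apply/in_deg; rewrite memvf -(qm_P qm) e.
Qed.

Lemma stab_qdeg d : stab Q (qdeg d).
Proof. by apply: (stab_deg (qm_hP qm)); apply: stabf. Qed.

Lemma qdeg_mulV d : mulV X Y (qdeg d) = qdeg d.+1.
Proof.
apply/vspaceP=> v; apply/idP/idP.
  move=> /in_mulV[_ [_ [/in_qdeg[a [ea <-]] /in_qdeg[b [eb <-]] ->]]].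
  apply/in_qdeg; exists (x * a + y * b).
  by rewrite linearD /= !hpartX ea eb linearD /= (qm_X qm) (qm_Y qm).
move=> /in_qdeg[f [ef <-]].
have [a [b e]] : exists a b, f = x * a + y * b.
  apply: mpow1_split; apply/mpow1 => -[|//] _.
  by rewrite -ef hpartK.
rewrite -ef e linearD /= !hpartX linearD /= (qm_X qm) (qm_Y qm); apply/in_mulV.
exists (p (hpart d a)), (p (hpart d b)); split=> //; apply/in_qdeg;
  by eexists; split; last reflexivity; rewrite hpartK eqxx.
Qed.

Definition no_degree d : Prop := forall f, J f -> hpart d f = 0.

(** In degrees where J has no element, the Koszul complex of x and y is exact
    and the socle is zero. *)
Lemma qdeg_count i d : no_degree d.+1 -> no_degree d.+2 ->
  (\sum_(j <- E7neighbours i) mult Q (V j) (qdeg d.+1)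
    = mult Q (V i) (qdeg d.+2) + mult Q (V i) (qdeg d))%N.
Proof.
move=> nJ1 nJ2; have cap0 : (qdeg d :&: soc X Y = 0)%VS.
  apply/eqP; rewrite -subv0; apply/subvP=> v /memv_capP[/in_qdeg[f [ef <-]] /in_soc[]].
  rewrite -(qm_X qm) -(qm_Y qm) => /(qm_ker qm)/nJ1; rewrite hpartX ef => /eqP.
  by rewrite mulf_eq0 (negPf (@X_neq0 C 0)) => /eqP -> _; rewrite linear0 mem0v.
rewrite -(qdeg_mulV d.+1).
have := @koszul_count _ _ _ _ det_rH _ hV _ Q X Y (qm_XY qm) (qm_QX qm) (qm_QY qm) i
  (qdeg d.+1) (qdeg d).
rewrite cap0 mult0 addn0; apply; try exact: stab_qdeg.
  apply/subvP=> v /in_qdeg[f [ef <-]]; apply/in_colon.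
  by rewrite -(qm_X qm) -(qm_Y qm); split; apply/in_qdeg; eexists; (split; last reflexivity);
     rewrite hpartX ef.
move=> f g _ fA gA e.
pose R (v : 'cV[C]_(rdegree (V i))) (w : 'cV[C]_n) :=
  [/\ w \in qdeg d, f *m v = Y *m w & g *m v = - (X *m w)].
have [v|a v v' w w' [h1 h2 h3] [h4 h5 h6]||w wP] := @lin_choice C _ _ R.
- have /in_qdeg[a [ea pa]] := fA v; have /in_qdeg[b [eb pb]] := gA v.
  have /(qm_ker qm)/nJ2 : p (x * a + y * b) = 0.
    by rewrite linearD /= (qm_X qm) (qm_Y qm) pa pb !mulmxA -mulmxDl e mul0mx.
  rewrite linearD /= !hpartX ea eb => e0.
  have [|k [ek1 ek2]] := @koszul_xy C a (- b).
    by apply/eqP; rewrite -subr_eq0 mulrN -opprD oppr_eq0 addrC e0.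
  exists (p (hpart d k)); split.
  - by apply/in_qdeg; exists (hpart d k); rewrite hpartK eqxx.
  - by rewrite -(qm_Y qm) -hpartX -ek2 ea pa.
  - by rewrite -(qm_X qm) -hpartX -ek1 linearN /= eb linearN opprK pb.
- split; first by rewrite memvD ?memvZ.
    by rewrite !mulmxDr -!scalemxAr h2 h5.
  by rewrite !mulmxDr -!scalemxAr h3 h6 opprD scalerN.
- by split; rewrite ?mem0v ?mulmx0 ?oppr0.
exists (colmx w); split; first by move=> v; rewrite colmxE; case: (wP v).
  by apply: eq_colmx => v; rewrite -mulmxA colmxE; case: (wP v).
by apply: eq_colmx => v; rewrite mulNmx -mulmxA colmxE; case: (wP v).
Qed.

Lemma qdeg_count0 i : no_degree 1 ->
  (\sum_(j <- E7neighbours i) mult Q (V j) (qdeg 0) = mult Q (V i) (qdeg 1))%N.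
Proof.
move=> nJ; have := @koszul_count _ _ _ _ det_rH _ hV _ Q X Y (qm_XY qm) (qm_QX qm)
  (qm_QY qm) i (qdeg 0) 0%VS.
rewrite cap0v mult0 !addn0 qdeg_mulV; apply; [exact: stab_qdeg|exact: stab0|exact: sub0v|].
move=> f g _ fA gA e.
suff h (v : 'cV[C]_(rdegree (V i))) : f *m v = 0 /\ g *m v = 0.
  exists 0; split; first by move=> v; rewrite mul0mx mem0v.
    by apply: eq_colmx => v; rewrite mulmx0 mul0mx; case: (h v).
  by apply: eq_colmx => v; rewrite mulmx0 oppr0 mul0mx; case: (h v).
have /in_qdeg[a [ea pa]] := fA v; have /in_qdeg[b [eb pb]] := gA v.
have /(qm_ker qm)/nJ : p (x * a + y * b) = 0.
  by rewrite linearD /= (qm_X qm) (qm_Y qm) pa pb !mulmxA -mulmxDl e mul0mx.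
rewrite linearD /= !hpartX ea eb => e0.
have [|k [ek1 ek2]] := @koszul_xy C a (- b).
  by apply/eqP; rewrite -subr_eq0 mulrN -opprD oppr_eq0 addrC e0.
have a0 : a = 0 by rewrite -ea ek2 hpartX0.
have b0 : b = 0 by rewrite -eb -[b]opprK ek1 linearN /= hpartX0 oppr0.
by rewrite -pa -pb a0 b0 !linear0.
Qed.

Lemma V0_id h : h \in H -> V rho_0 h = 1%:M.
Proof. by case: hV => _ _ _ h1 _; apply: h1. Qed.

Definition ones : 'rV[C]_(rdegree (V rho_0)) := const_mx 1.

Lemma ones_surj : exists e : 'cV[C]_(rdegree (V rho_0)), ones *m e = 1%:M.
Proof.
have d0 : (0 < rdegree (V rho_0))%N by rewrite (V_deg hV).
exists (delta_mx (Ordinal d0) 0); rewrite -colE; apply/matrixP=> i j.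
by rewrite !mxE !ord1.
Qed.

Lemma inv_hom v : (forall h, h \in H -> Q h *m v = v) -> hom Q (V rho_0) (v *m ones).
Proof. by move=> hv h Hh; rewrite V0_id // mulmx1 mulmxA hv. Qed.

Lemma inv_neq0 (v : 'cV[C]_n) : v *m ones = 0 -> v = 0.
Proof.
have [e he] := ones_surj => v0.
by rewrite -[v]mulmx1 -[1%:M]he mulmxA v0 mul0mx.
Qed.

Lemma inv_into (U : {vspace 'cV[C]_n}) (v : 'cV[C]_n) : into U (v *m ones) <-> v \in U.
Proof.
split=> [iv|vU w].
  by have [e he] := ones_surj; rewrite -[v]mulmx1 -[1%:M]he mulmxA; apply: iv.
by rewrite -mulmxA [ones *m w]mx11_scalar mul_mx_scalar memvZ.
Qed.

Lemma hom0_inv A h (v : 'cV[C]_(rdegree (V rho_0))) : hom Q (V rho_0) A -> h \in H -> Q h *m (A *m v) = A *m v.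
Proof. by move=> hA Hh; rewrite mulmxA hA // V0_id // mulmx1. Qed.

Lemma act_deg0 h f : hpart 0 f = f -> act (rH h) f = f.
Proof.
move=> e; have -> : f = f@_0%MM *: 1.
  apply/mpolyP=> m; rewrite -{1}e mcoeff_hpart mcoeffZ mcoeff1 mdeg_eq0.
  by case: eqP => [->|_]; rewrite ?mulr1 ?mulr0.
by rewrite actZ /act comp_mpoly1.
Qed.

Lemma deg0_const f : hpart 0 f = f -> f = f@_0%MM *: 1.
Proof.
move=> e; apply/mpolyP=> m; rewrite -{1}e mcoeff_hpart mcoeffZ mcoeff1 mdeg_eq0.
by case: eqP => [->|_]; rewrite ?mulr1 ?mulr0.
Qed.

Lemma qdeg0 i : no_degree 0 -> mult Q (V i) (qdeg 0) = (i == rho_0).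
Proof.
move=> nJ; have h0 : hpart 0 (1 : S) = 1 by rewrite pihomog_dE // dhomog1.
have p1 : p 1 <> 0.
  by move=> /(qm_ker qm)/nJ/eqP; rewrite h0 oner_eq0.
have hu : hom Q (V rho_0) (p 1 *m ones).
  by apply: inv_hom => h Hh; rewrite -(qm_act qm) // act_deg0.
have -> : qdeg 0 = img (p 1 *m ones).
  apply/vspaceP=> v; apply/idP/idP; last first.
    have h1 : p 1 \in qdeg 0 by apply/in_qdeg; exists 1.
    by move=> /in_img[w ->]; apply: (inv_into (qdeg 0) (p 1)).2 h1 w.
  move=> /in_qdeg[f [ef <-]]; rewrite (deg0_const ef) linearZ /=.
  have [e he] := ones_surj; apply/in_img; exists (f@_0%MM *: e).
  by rewrite -scalemxAr -mulmxA he mulmx1.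
rewrite (mult_imgV hV i hu) 1?eq_sym // => /inv_neq0; exact: p1.
Qed.

End Graded.

Section Truncation.
Variables (n : nat) (p : {linear S -> 'cV[C]_n}) (Q : rep n).
Variables (X Y : 'M[C]_n) (P : nat -> 'M[C]_n).
Hypothesis qm : quot_mod rH (mpow 19) p Q X Y P.
Local Notation qdeg d := (degpart P fullv d).

Lemma trunc_no_degree d : (d < 19)%N -> no_degree (mpow 19) d.
Proof. by move=> d19 f; apply. Qed.

Lemma trunc_eq0 d f : (d < 19)%N -> hpart d f = f -> p f = 0 -> f = 0.
Proof. by move=> d19 e /(qm_ker qm) h; rewrite -e h. Qed.

Lemma trunc_mult d i : (d < 19)%N -> mult Q (V i) (qdeg d) = sym_mult d i.
Proof.
have pairE e : (sym_pair e.+1).1 = (sym_pair e).2 by rewrite /=; case: (sym_pair e).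
have recE e i' : sym_mult e.+2 i' = (nbr_sum (sym_mult e.+1) i' - sym_mult e i')%N.
  rewrite /sym_mult -(pairE e); set q := sym_pair e.+1.
  have -> : (sym_pair e.+2).2 = [seq (nbr_sum (entry q.2) j - entry q.1 j)%N | j <- rho_0 :: labels7].
    rewrite -[sym_pair e.+2]/(let: (a, b) := q in (b, [seq (nbr_sum (entry b) j - entry a j)%N | j <- rho_0 :: labels7])).
    by case: q.
  by case: i'.
elim/ltn_ind: d i => -[|[|d]] IH i d19.
- rewrite (qdeg0 qm i (trunc_no_degree d19)); by case: i.
- rewrite -(qdeg_count0 qm i (trunc_no_degree d19)) -nbr_sumE.
  by rewrite (eq_nbr_sum i (fun j => IH 0%N isT j isT)); case: i.
have d1 : (d.+1 < 19)%N := ltnW d19.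
have := qdeg_count qm i (trunc_no_degree d1) (trunc_no_degree d19).
rewrite -nbr_sumE (eq_nbr_sum i (fun j => IH d.+1 (ltnSn _) j d1)) (IH d) //; last exact: ltnW d1.
by rewrite recE => ->; rewrite addnK.
Qed.

Hypothesis inv8 : forall h, h \in H -> act (rH h) f8 = f8.
Hypothesis inv12 : forall h, h \in H -> act (rH h) f12 = f12.

Lemma f12_neq0 : f12 != 0.
Proof.
rewrite /f12 expf_eq0 /=; apply/negP => /eqP e.
have e4 : x * (x ^+ 3) = y ^+ 4.
  apply: (mulfI (@X_neq0 C 0)); apply: (mulfI (@X_neq0 C 1)).
  by apply/eqP; rewrite -subr_eq0 -e; apply/eqP; ring.
have := congr1 (mcoeff (U_(1%R) *+ 4)%MM) e4; rewrite coefXM mulmnE mnm1E /=.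
by rewrite mpolyXn mcoeffX eqxx => /esym/eqP; rewrite oner_eq0.
Qed.

Lemma f12_klein : klein_ideal f12.
Proof.
exists (x ^+ 2 * y ^+ 2), (- 16%:R), 0; split; first by case: (@mpow_ideal C 18).
by rewrite f12E; ring.
Qed.

Lemma f12_hom : f12 \is 12.-homog.
Proof.
rewrite f12E; apply: rpredB; first exact: (dhomogM (dhomogM (homXn _ 0 2) (homXn _ 1 2)) (f8_hom C)).
by rewrite mulr_natl rpredMn // e12_hom.
Qed.

(** Invariants occur only in degrees 8, 12 and 16 in this range, once in each;
    f8, f12 and f8^2 account for them. *)
Lemma sym_mult0 d : (0 < d < 18)%N -> sym_mult d rho_0 = ((d == 8) || (d == 12) || (d == 16)) :> nat.
Proof. by do 18?[case: d => [|d]; first by vm_compute]. Qed.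

Lemma trunc_inv1 d f G : (d < 18)%N -> sym_mult d rho_0 = 1%N -> hpart d f = f -> hpart d G = G ->
    (forall h, h \in H -> act (rH h) f = f) -> (forall h, h \in H -> act (rH h) G = G) ->
    G != 0 -> exists c, f = c *: G.
Proof.
move=> d18 m1 ef eG invf invG G0; have d19 : (d < 19)%N := ltnW d18.
have := trunc_mult rho_0 d19; rewrite m1 => dim1.
have inT g : hpart d g = g -> (forall h, h \in H -> act (rH h) g = g) ->
    p g *m ones \in HomTo Q (V rho_0) (qdeg d).
  move=> eg invg; apply/in_HomTo; split.
    by apply: inv_hom => h Hh; rewrite -(qm_act qm) // invg.
  by apply/inv_into/(in_qdeg qm); exists g.
have uG : p G *m ones != 0.
  by apply: contraNneq G0 => /inv_neq0/(trunc_eq0 d19 eG) ->.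
have : p f *m ones \in <[p G *m ones]>%VS.
  suff -> : <[p G *m ones]>%VS = HomTo Q (V rho_0) (qdeg d) by apply: inT.
  by apply/eqP; rewrite eqEdim -memvE inT //= -/(mult _ _ _) dim1 dim_vline uG.
move=> /vlineP[c e]; exists c; apply/eqP; rewrite -subr_eq0; apply/eqP.
apply: (trunc_eq0 d19); first by rewrite linearB linearZ /= ef eG.
apply: inv_neq0; rewrite linearB linearZ /= mulmxBl -scalemxAl e subrr //.
Qed.

Lemma inv_degree d f : (0 < d < 18)%N -> hpart d f = f ->
  (forall h, h \in H -> act (rH h) f = f) -> klein_ideal f.
Proof.
move=> d018 ef invf; have /andP[d0 d18] := d018; have [k0 kD kM] := klein_is_ideal C.
have [_ _ klZ _ _] := ideal_sub (klein_is_ideal C).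
have k8 : klein_ideal f8.
  by exists 1, 0, 0; split; [case: (@mpow_ideal C 18)|ring].
have := sym_mult0 d018; case: (boolP (_ || _)) => [d8|_ m0]; last first.
  suff -> : f = 0 by [].
  have d19 := ltnW d18; apply: (trunc_eq0 d19 ef); apply: inv_neq0; apply/eqP.
  rewrite -memv0; have <- : HomTo Q (V rho_0) (qdeg d) = 0%VS.
    by apply/eqP; rewrite -dimv_eq0 -/(mult _ _ _) (trunc_mult _ d19) m0.
  apply/in_HomTo; split; first by apply: inv_hom => h Hh; rewrite -(qm_act qm) // invf.
  by apply/inv_into/(in_qdeg qm); exists f.
move=> m1; case/orP: d8 => [/orP[/eqP e|/eqP e]|/eqP e]; rewrite e in ef m1.
- have [|c ->] := trunc_inv1 _ m1 ef (pihomog_dE (f8_hom C)) invf inv8 (f8_neq0 C) => //.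
  exact: klZ.
- have [|c ->] := trunc_inv1 _ m1 ef (pihomog_dE f12_hom) invf inv12 f12_neq0 => //.
  exact/klZ/f12_klein.
have h16 : f8 * f8 \is 16.-homog by apply: (dhomogM (f8_hom C) (f8_hom C)).
have n16 : f8 * f8 != 0 by rewrite mulf_eq0 negb_or f8_neq0.
have inv16 h : h \in H -> act (rH h) (f8 * f8) = f8 * f8 by move=> Hh; rewrite actM inv8.
have [c ->] := trunc_inv1 (isT : (16 < 18)%N) m1 ef (pihomog_dE h16) invf inv16 n16.
by apply: klZ; apply: (kM _ _ k8).
Qed.

Lemma meval0 (f : S) : f.@[fun=> 0] = f@_0%MM.
Proof.
have [|a [b e]] := @mpow1_split C (f - (f@_0%MM)%:MP).
  by rewrite mcoeffB mcoeffC eqxx mulr1 subrr.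
rewrite -[f in LHS](subrK (f@_0%MM)%:MP) e mevalD mevalC mevalD !mevalM !mevalXU.
by rewrite !mul0r !add0r.
Qed.

(** Separate degrees: below 18 the invariants are the multiples of f8, f12 and
    f8^2. *)
Lemma inv_klein f : (forall h, h \in H -> act (rH h) f = f) -> f.@[fun=> 0] = 0 -> klein_ideal f.
Proof.
rewrite meval0 => invf f0; have [k0 kD kM] := klein_is_ideal C.
have -> : f = \sum_(d < 18) hpart d f + (f - \sum_(d < 18) hpart d f) by rewrite addrC subrK.
apply: (kD _ _); last first.
  exists 0, 0, (f - \sum_(d < 18) hpart d f); rewrite !mulr0 !add0r; split=> // e e18.
  rewrite linearB /= hpart_sum (bigD1 (Ordinal e18)) //= hpartK eqxx big1 ?addr0 ?subrr // => j nj.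
  by rewrite hpartK; case: eqP => // ej; case/eqP: nj; apply: val_inj.
elim/big_ind: _ => [//|u v ku kv|d _]; first exact: (kD _ _ ku kv).
have [d0|d0] := posnP d.
  suff -> : hpart d f = 0 by [].
  by rewrite d0; have /mpow1 := f0; apply.
apply: (@inv_degree d); first by rewrite d0 ltn_ord.
  by rewrite hpartK eqxx.
by move=> h Hh; rewrite act_hpart invf.
Qed.

(** The Reynolds operator. *)
Definition reynolds f : S := #|H|%:R^-1 *: \sum_(h in H) act (rH h) f.

Lemma reynolds_inv f k : k \in H -> act (rH k) (reynolds f) = reynolds f.
Proof.
move=> Hk; rewrite /reynolds actZ act_sum; congr (_ *: _).
rewrite [RHS](reindex_inj (mulgI k)) /=.
rewrite [RHS](eq_bigl (mem H)) /= => [|h]; last by rewrite groupMl.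
apply: eq_bigr => h Hh; rewrite (repr_mxM rH Hk Hh); exact/esym/act_mul.
Qed.

Lemma reynolds_image (n' : nat) (p' : {linear S -> 'cV[C]_n'}) f :
  (forall h, h \in H -> p' (act (rH h) f) = p' f) -> p' (reynolds f) = p' f.
Proof.
move=> hf; rewrite /reynolds linearZ linear_sum (eq_bigr (fun=> p' f)) ?sumr_const //=.
by rewrite -scaler_nat scalerA mulVf ?cardH_neq0 ?scale1r.
Qed.

Lemma mul_matrix G : (forall h, h \in H -> act (rH h) G = G) ->
  exists F : 'M[C]_n, (forall f, p (G * f) = F *m p f) /\ hom Q Q F.
Proof.
move=> invG; have [_ _ mM] := @mpow_ideal C 19.
have linG : linear (fun f : S => G * f) by move=> a u v; rewrite mulrDr scalerAr.
have [F eF] := induced (qm_surj qm) (qm_ker qm) linG (fun f => mM G f).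
exists F; split=> // h Hh; apply: eq_colmx => v; have [f <-] := qm_surj qm v.
by rewrite -!mulmxA -eF -!(qm_act qm) // actM invG // eF.
Qed.

(** In degree 18 the images of the multiplications by f8 and f12 meet in 0, as
    f8 and x^6 y^6 are coprime. Counting multiplicities, their sum contains
    every V i except the trivial one as often as the whole space. Only
    invariants remain. *)
Lemma top_degree f : hpart 18 f = f ->
  exists a b g, (forall h, h \in H -> act (rH h) g = g) /\
    [/\ f = f8 * a + f12 * b + g & hpart 18 g = g].
Proof.
move=> ef; have [F8 [eF8 hF8]] := mul_matrix inv8; have [F12 [eF12 hF12]] := mul_matrix inv12.
have im (F : 'M[C]_n) d v : (v \in linfun (mulmx F) @: qdeg d)%VS <->
    exists a, hpart d a = a /\ v = F *m p a.
  split=> [/memv_imgP[w /(in_qdeg qm)[a [ea <-]] ->]|[a [ea ->]]]; first by exists a; rewrite lfunE.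
  by apply/memv_imgP; exists (p a); rewrite ?lfunE //; apply/(in_qdeg qm); exists a.
have h8 a : hpart 10 a = a -> hpart 18 (f8 * a) = f8 * a.
  by move=> ea; rewrite (hpart_homM _ _ (f8_hom C)) /= ea.
have h12 a : hpart 6 a = a -> hpart 18 (f12 * a) = f12 * a.
  by move=> ea; rewrite (hpart_homM _ _ f12_hom) /= ea.
have inj8 a : hpart 10 a = a -> F8 *m p a = 0 -> a = 0.
  move=> ea; rewrite -eF8 => /(trunc_eq0 (isT : (18 < 19)%N) (h8 a ea))/eqP.
  by rewrite mulf_eq0 (negPf (f8_neq0 C)) => /eqP.
have inj12 a : hpart 6 a = a -> F12 *m p a = 0 -> a = 0.
  move=> ea; rewrite -eF12 => /(trunc_eq0 (isT : (18 < 19)%N) (h12 a ea))/eqP.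
  by rewrite mulf_eq0 (negPf f12_neq0) => /eqP.
(* an injective equivariant map preserves multiplicities *)
have mul_mult (F : 'M[C]_n) d i : hom Q Q F -> (d < 19)%N ->
    (forall a, hpart d a = a -> F *m p a = 0 -> a = 0) ->
    mult Q (V i) (linfun (mulmx F) @: qdeg d)%VS = sym_mult d i.
  move=> hF d19 injF; rewrite -(trunc_mult i d19).
  apply/esym; rewrite (@mult_exact _ _ _ _ Q _ Q F (qdeg d) 0%VS
    (linfun (mulmx F) @: qdeg d)%VS) ?mult0 //.
  - exact: (stab_qdeg qm).
  - move=> u; rewrite memv0; split=> [/eqP ->|[/(in_qdeg qm)[a [ea <-]] /injF]].
      by rewrite mulmx0 mem0v.
    by move=> ->; rewrite ?linear0.
  - by move=> u uq; apply/memv_imgP; exists u; rewrite ?lfunE.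
  - by move=> w /memv_imgP[u uq ->]; exists u; rewrite ?lfunE.
have stab_im (F : 'M[C]_n) d : hom Q Q F -> stab Q (linfun (mulmx F) @: qdeg d)%VS.
  move=> hF h _ Hh /memv_imgP[u uq ->]; apply/memv_imgP; exists (Q h *m u).
    exact: (stab_qdeg qm).
  by rewrite !lfunE /= !mulmxA hF.
pose W1 := (linfun (mulmx F8) @: qdeg 10)%VS; pose W2 := (linfun (mulmx F12) @: qdeg 6)%VS.
have W12 : (W1 :&: W2 = 0)%VS.
  apply/eqP; rewrite -subv0; apply/subvP=> v /memv_capP[/im[a [ea ->]] /im[b [eb e]]].
  rewrite memv0; suff -> : a = 0 by rewrite linear0 mulmx0.
  have e' : f8 * a = f12 * b.
    apply/eqP; rewrite -subr_eq0; apply/eqP; apply: (trunc_eq0 (isT : (18 < 19)%N)).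
      by rewrite linearB /= h8 // h12.
    by rewrite linearB /= eF8 eF12 e subrr.
  have e2 : f8 * (x ^+ 2 * y ^+ 2 * b - a) = e12 * (16%:R * b).
    by rewrite mulrBr e' f12E; ring.
  have [|b0 _] := f8_coprime _ e2.
    move=> d d8; rewrite mulr_natl raddfMn /= -eb hpartK; case: eqP => [ed|_]; last by rewrite mul0rn.
    by rewrite ed in d8.
  have {}b0 : b = 0.
    by move/eqP: b0; rewrite mulr_natl -scaler_nat scaler_eq0 pnatr_eq0 => /eqP.
  by apply: inj8 => //; rewrite e b0 linear0 mulmx0.
pose I := vs [set v : 'cV[C]_n | v \in qdeg 18 /\ forall h, h \in H -> Q h *m v = v].
have inI v : (v \in I) <-> v \in qdeg 18 /\ forall h, h \in H -> Q h *m v = v.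
  apply: in_vs; split=> [|a u w [uq hu] [wq hw]].
    by split=> [|h Hh]; rewrite ?mem0v ?mulmx0.
  split=> [|h Hh]; first by rewrite memvD ?memvZ.
  by rewrite mulmxDr -scalemxAr hu // hw.
have sI : stab Q I by move=> h v Hh vI; move: (vI) => /inI[_ /(_ h Hh) ->].
have W12q : (W1 + W2 <= qdeg 18)%VS.
  rewrite subv_add; apply/andP; split; apply/subvP=> v /im[a [ea ->]]; apply/(in_qdeg qm).
    by exists (f8 * a); rewrite h8 // eF8.
  by exists (f12 * a); rewrite h12 // eF12.
have sW12 : stab Q (W1 + W2)%VS by apply: stabD; apply: stab_im.
have sub18 : (qdeg 18 <= W1 + W2 + I)%VS.
  have sW : stab Q (W1 + W2 + I)%VS by exact: stabD.
  have sq : stab Q (qdeg 18) by exact: (stab_qdeg qm).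
  apply: (HomTo_sub hV sq sW) => i; have [->|i0] := eqVneq i rho_0.
    apply: subv_trans (HomToS _ _ (addvSr _ _)); apply/subvP=> A /in_HomTo[hA iA].
    apply/in_HomTo; split=> // v; apply/inI; split; first exact: iA.
    by move=> h Hh; apply: hom0_inv.
  apply: subv_trans (HomToS _ _ (addvSl _ _)).
  suff -> : HomTo Q (V i) (W1 + W2)%VS = HomTo Q (V i) (qdeg 18) by [].
  apply/eqP; rewrite eqEdim HomToS //= -!/(mult _ _ _).
  rewrite mult_add //; try by apply: stab_im.
  rewrite (mul_mult _ 10%N i hF8 isT inj8) (mul_mult _ 6%N i hF12 isT inj12).
  rewrite (trunc_mult i (isT : (18 < 19)%N)); by case: (i) i0.
have /(subvP sub18) : p f \in qdeg 18 by apply/(in_qdeg qm); exists f.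
move=> /memv_addP[_ /memv_addP[_ /im[a [ea ->]] [_ /im[b [eb ->]] ->]] [v /inI[vq hv] e]].
have [g0 [eg0 pg0]] := (in_qdeg qm 18 v).1 vq.
pose g := hpart 18 (reynolds g0).
have pg : p g = v.
  rewrite (qm_P qm) reynolds_image; first by rewrite -(qm_P qm) eg0.
  by move=> h Hh; rewrite (qm_act qm) // pg0 hv.
exists a, b, g; split; first by move=> h Hh; rewrite act_hpart reynolds_inv.
split; last by rewrite hpartK eqxx.
apply/eqP; rewrite -subr_eq0; apply/eqP; apply: (trunc_eq0 (isT : (18 < 19)%N)).
  by rewrite linearB !linearD /= ef h8 // h12 // hpartK eqxx.
by rewrite linearB !linearD /= eF8 eF12 pg e -!opprD subrr.
Qed.

End Truncation.

Lemma trunc_exists : exists n p Q X Y P, @quot_mod C gT H rH (mpow 19) n p Q X Y P.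
Proof.
apply: (@quot_mod_exists _ _ _ rH _ 19); first exact: mpow_ideal.
- by move=> h f Hh hf d d19; rewrite -act_hpart hf // act0.
- by move=> d f; apply: mpow_hpart.
- by [].
Qed.

Hypothesis inv8 : forall h, h \in H -> act (rH h) f8 = f8.
Hypothesis inv12 : forall h, h \in H -> act (rH h) f12 = f12.

Lemma inv_ideal_is_ideal : is_ideal (invariant_ideal rH).
Proof.
split.
- by move=> I [[I0 _ _] _].
- by move=> f g hf hg I hI; have [[_ ID _] _] := hI; apply: ID; [apply: hf|apply: hg].
- by move=> f g hg I hI; have [[_ _ IM] _] := hI; apply: IM; apply: hg.
Qed.

Lemma inv_in_ideal f : (forall h, h \in H -> act (rH h) f = f) -> f.@[fun=> 0] = 0 ->
  invariant_ideal rH f.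
Proof. by move=> invf f0 I [_]; apply. Qed.

Lemma meval0_hpart f d : hpart d.+1 f = f -> f.@[fun=> 0] = 0.
Proof. by move=> ef; rewrite meval0 -ef mcoeff_hpart mdeg0. Qed.

(** Degree 18 generates m^18. *)
Lemma mpow18_inv f : mpow 18 f -> invariant_ideal rH f.
Proof.
have [n0 nD nM] := inv_ideal_is_ideal.
have n8 : invariant_ideal rH f8.
  by apply: inv_in_ideal => //; apply: (@meval0_hpart _ 7); apply/pihomog_dE/f8_hom.
have n12 : invariant_ideal rH f12.
  by apply: inv_in_ideal => //; apply: (@meval0_hpart _ 11); apply/pihomog_dE/f12_hom.
have base g : hpart 18 g = g -> invariant_ideal rH g.
  have [n [p [Q [X [Y [P qm]]]]]] := trunc_exists.
  move=> /(top_degree qm inv8 inv12)[a [b [k [invk [-> ek]]]]].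
  apply: (nD _ _); first by apply: (nD _ _); rewrite mulrC; apply: nM.
  by apply: inv_in_ideal => //; apply: meval0_hpart ek.
have step d g : hpart (18 + d) g = g -> invariant_ideal rH g.
  elim: d g => [|d IH] g; first by rewrite addn0; apply: base.
  rewrite addnS => eg; have [a [b e]] : exists a b, g = x * a + y * b.
    by apply: mpow1_split; apply/mpow1 => -[|//] _; rewrite -eg hpartK.
  rewrite -eg e linearD /= !hpartX; apply: (nD _ _); apply: (nM _ _); apply: IH;
    by rewrite hpartK eqxx.
move=> hf; rewrite (pihomog_partitionE (leqnn (mmeasure mdeg f))).
elim/big_ind: _ => [//|u v hu hv|d _]; first exact: (nD _ _).
have [d18|d18] := ltnP d 18; first by rewrite hf.
by apply: (@step (d - 18)%N); rewrite subnKC // hpartK eqxx.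
Qed.

(** The invariants lie in the Klein ideal by inv_klein; conversely f8, f12 and
    m^18 lie in n. *)
Theorem invariant_idealE : invariant_ideal rH = klein_ideal (C := C).
Proof.
apply/seteqP; split=> f.
  apply; split; first exact: klein_is_ideal.
  move=> g [invg g0]; have [n [p [Q [X [Y [P qm]]]]]] := trunc_exists.
  exact: (inv_klein qm inv8 inv12).
have [n0 nD nM] := inv_ideal_is_ideal.
move=> [a [b [c [hc ->]]]]; apply: (nD _ _); last exact: mpow18_inv.
have n8 : invariant_ideal rH f8.
  by apply: inv_in_ideal => //; apply: (@meval0_hpart _ 7); apply/pihomog_dE/f8_hom.
have n12 : invariant_ideal rH f12.
  by apply: inv_in_ideal => //; apply: (@meval0_hpart _ 11); apply/pihomog_dE/f12_hom.
apply: (nD _ _); first by rewrite mulrC; apply: (nM _ _).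
rewrite mulrC; apply: (nM _ _).
have -> : e12 = 16%:R^-1 *: (x ^+ 2 * y ^+ 2 * f8) + - (16%:R^-1) *: f12.
  rewrite f12E scaleNr -scalerBr opprB addrC subrK mulr_natl -scaler_nat scalerA.
  by rewrite mulVf ?scale1r // pnatr_eq0.
have [_ _ nZ _ _] := ideal_sub inv_ideal_is_ideal.
by apply: (nD _ _); apply: (nZ _ _) => //; apply: (nM _ _).
Qed.

End Invariants.

(** * The module m/n *)

Section Coinvariants.
Variables (C : numClosedFieldType) (gT : finGroupType) (H : {group gT}).
Local Notation rep := (mx_representation C H).
Local Notation S := {mpoly C[2]}.
Local Notation hpart := (@pihomog 2 C mdeg).
Local Notation x := ('X_(0 : 'I_2) : S).
Local Notation y := ('X_(1 : 'I_2) : S).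
Local Notation klein := (@klein_ideal C).
Variable rH : rep 2.
Hypothesis det_rH : forall h, h \in H -> \det (rH h) = 1.
Variable V : E7label -> representation C H.
Hypothesis hV : E7_labelling rH V.
Hypothesis inv8 : forall h, h \in H -> act (rH h) (f8 C) = f8 C.
Hypothesis inv12 : forall h, h \in H -> act (rH h) (f12 C) = f12 C.

Let nE : invariant_ideal rH = klein := invariant_idealE det_rH hV inv8 inv12.

(** The columns of this matrix are invariant, so it would give a map between V
    i and the trivial representation. *)
Lemma sum_irr (i : E7label) : i != rho_0 -> \sum_(h in H) V i h = 0.
Proof.
move=> i0; apply: eq_colmx => v; rewrite mul0mx; apply: (inv_neq0 hV).
have hA : hom (V i) (V rho_0) ((\sum_(h in H) V i h) *m v *m ones V).
  apply: (inv_hom hV) => k Hk; rewrite mulmxA; congr (_ *m _).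
  rewrite mulmx_sumr [RHS](reindex_inj (mulgI k)) /=.
  rewrite [RHS](eq_bigl (mem H)) /= => [|h]; last by rewrite groupMl.
  by apply: eq_bigr => h Hh; rewrite repr_mxM.
apply: contrapT => A0; have := schur_sim (V_irr hV i) (V_irr hV rho_0) hA A0.
by case: hV => _ inj _ _ _ /inj e; rewrite e in i0.
Qed.

Lemma klein_inv f : (forall h, h \in H -> act (rH h) f = f) -> f.@[fun=> 0] = 0 -> klein f.
Proof. by rewrite -nE; apply: inv_in_ideal. Qed.

Lemma klein_act h f : h \in H -> klein f -> klein (act (rH h) f).
Proof.
move=> Hh; rewrite -nE => nf; apply: (nf [set g | invariant_ideal rH (act (rH h) g)]).
have [n0 nD nM] := inv_ideal_is_ideal rH.
split; first split => /=; first by rewrite act0.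
- by move=> a b; rewrite actD; apply: nD.
- by move=> a b; rewrite actM; apply: nM.
by move=> g [invg g0]; rewrite /= invg //; apply: inv_in_ideal.
Qed.

(** The polynomials of this form are an ideal containing the invariants: a
    constant multiple of an invariant is an invariant, and the other multiples
    lie in x n + y n. *)
Lemma klein_split f : klein f -> exists g a b,
  [/\ forall h, h \in H -> act (rH h) g = g, klein a, klein b & f = g + (x * a + y * b)].
Proof.
have [n0 nD nM] := klein_is_ideal C; have [_ _ nZ _ _] := ideal_sub (klein_is_ideal C).
pose T := [set f | klein f /\ exists g a b,
  [/\ forall h, h \in H -> act (rH h) g = g, klein a, klein b & f = g + (x * a + y * b)]].
move=> nf; suff [] : T f by [].
move: nf; rewrite -nE; apply; split; first split.
- split=> //; exists 0, 0, 0; split=> // [h Hh|]; first by rewrite act0.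
  by rewrite !mulr0 !addr0.
- move=> f1 f2 [k1 [g1 [a1 [b1 [i1 ka1 kb1 e1]]]]] [k2 [g2 [a2 [b2 [i2 ka2 kb2 e2]]]]].
  split; first exact: nD.
  exists (g1 + g2), (a1 + a2), (b1 + b2); split; try exact: nD; last by rewrite e1 e2; ring.
  by move=> h Hh; rewrite actD i1 ?i2.
- move=> u f1 [k1 [g1 [a1 [b1 [i1 ka1 kb1 e1]]]]]; split; first exact: nM.
  have [|s [t e]] := @mpow1_split C (u - (u@_0%MM) *: 1).
    by rewrite mcoeffB mcoeffZ mcoeff1 eqxx mulr1 subrr.
  exists (u@_0%MM *: g1), (u@_0%MM *: a1 + s * f1), (u@_0%MM *: b1 + t * f1); split.
  + by move=> h Hh; rewrite actZ i1.
  + by apply: nD; [apply: nZ|apply: nM].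
  + by apply: nD; [apply: nZ|apply: nM].
  set c := u@_0%MM in e *.
  have hu : u * f1 = c *: f1 + (x * (s * f1) + y * (t * f1)).
    rewrite -[u in LHS](subrK (c *: 1)) e mulrDl -scalerAl mul1r; ring.
  have hc : c *: f1 = c *: g1 + (x * (c *: a1) + y * (c *: b1)).
    by rewrite {1}e1 !scalerDr !scalerAr.
  rewrite hu hc; ring.
move=> g [invg g0]; split; first exact: klein_inv.
by exists g, 0, 0; split=> //; rewrite !mulr0 !addr0.
Qed.

Variables (n : nat) (p : {linear S -> 'cV[C]_n}) (Q : rep n).
Variables (X Y : 'M[C]_n) (P : nat -> 'M[C]_n).
Hypothesis qm : quot_mod rH klein p Q X Y P.
Local Notation qdeg d := (degpart P fullv d).
Local Notation hP := (qm_hP qm).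

Let k18 f : mpow 18 f -> klein f.
Proof. by move=> hf; exists 0, 0, f; rewrite !mulr0 !add0r. Qed.

(** The image of m in the quotient by n, where P 0 reads off the constant
    term. *)
Definition aug : {vspace 'cV[C]_n} := vs [set v : 'cV[C]_n | P 0%N *m v = 0].

Lemma in_aug (v : 'cV[C]_n) : (v \in aug) <-> P 0%N *m v = 0.
Proof.
apply: in_vs; split=> [|a u w eu ew]; first by rewrite /= mulmx0.
by rewrite /= mulmxDr -scalemxAr eu ew scaler0 addr0.
Qed.

Lemma lift_lin k (f : 'M[C]_(n, k)) : exists a : {linear 'cV[C]_k -> S}, forall v, p (a v) = f *m v.
Proof.
apply: (@lin_choice C S k (fun v u => p u = f *m v)) => [v|a v v' u u' e e'|].
- exact: (qm_surj qm).
- by rewrite linearP /= e e' mulmxDr scalemxAr.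
- by rewrite linear0 mulmx0.
Qed.

(** Lift f and g to polynomials a and b. Then v |-> W v = x a(v) + y b(v)
    takes its values in n and is equivariant modulo n' = x n + y n. As n / n'
    is spanned by invariants and V i is not trivial, W v lies in n'. So x
    (a(v) - s) + y (b(v) - t) = 0 for some s and t in n, and the Koszul
    complex of x and y is exact. *)
Lemma coinv_koszul (i : E7label) f g : i != rho_0 ->
  hom (twist rH Q) (V i) (col_mx f g) -> X *m f + Y *m g = 0 ->
  exists w, f = Y *m w /\ g = - (X *m w).
Proof.
move=> i0 hfg e; have [n0 nD nM] := klein_is_ideal C.
have [_ _ nZ nB _] := ideal_sub (klein_is_ideal C).
have [a ea] := lift_lin f; have [b eb] := lift_lin g.
pose W (v : 'cV[C]_(rdegree (V i))) : S := x * a v + y * b v.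
pose np := [set k : S | exists s t, [/\ klein s, klein t & k = x * s + y * t]].
have npD k l : np k -> np l -> np (k + l).
  move=> [s [t [ks kt ->]]] [s' [t' [ks' kt' ->]]].
  by exists (s + s'), (t + t'); split; [exact: nD|exact: nD|ring].
have npZ c k : np k -> np (c *: k).
  move=> [s [t [ks kt ->]]]; exists (c *: s), (c *: t).
  by split; [exact: nZ|exact: nZ|rewrite scalerDr !scalerAr].
have npsum (F : gT -> S) : (forall h, h \in H -> np (F h)) -> np (\sum_(h in H) F h).
  move=> hF; elim/big_ind: _ => [|k l|h Hh]; [|exact: npD|exact: hF].
  by exists 0, 0; rewrite !mulr0 addr0.
have npW v h : h \in H -> np (act (rH h) (W v) - W (V i h *m v)).
  move=> Hh; have /(congr1 (fun A => A *m v)) := hfg h Hh.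
  rewrite /= /twist_mx mul_block_col mul_col_mx mul_col_mx -!scalemxAl.
  rewrite mul_col_mx => /eq_col_mx[e1 e2].
  exists (rH h 0 0 *: act (rH h) (a v) + rH h 0 1 *: act (rH h) (b v) - a (V i h *m v)),
    (rH h 1 0 *: act (rH h) (a v) + rH h 1 1 *: act (rH h) (b v) - b (V i h *m v)).
  split.
  - apply/(qm_ker qm); rewrite linearB linearD !linearZ /= !(qm_act qm) // ea eb ea [f *m (_ *m _)]mulmxA -e1.
    by rewrite mulmxDl -!scalemxAl !mulmxA subrr.
  - apply/(qm_ker qm); rewrite linearB linearD !linearZ /= !(qm_act qm) // ea eb eb [g *m (_ *m _)]mulmxA -e2.
    by rewrite mulmxDl -!scalemxAl !mulmxA subrr.
  rewrite /W actD !actM !actX !big_ord_recl !big_ord0 !addr0.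
  have -> : lift ord0 ord0 = 1 :> 'I_2 by apply: val_inj.
  rewrite -!mul_mpolyC; ring.
have npact h k : h \in H -> np k -> np (act (rH h) k).
  move=> Hh [s [t [ks kt ->]]]; rewrite actD !actM !actX !big_ord_recl !big_ord0 !addr0.
  have -> : lift ord0 ord0 = 1 :> 'I_2 by apply: val_inj.
  exists (rH h 0 0 *: act (rH h) s + rH h 0 1 *: act (rH h) t),
    (rH h 1 0 *: act (rH h) s + rH h 1 1 *: act (rH h) t).
  split; try by apply: nD; apply: nZ; apply: klein_act.
  rewrite -!mul_mpolyC; ring.
have Wn v : np (W v).
  have /klein_split[k [s [t [invk ks kt eW]]]] : klein (W v).
    apply/(qm_ker qm); rewrite linearD /= (qm_X qm) (qm_Y qm) ea eb !mulmxA -mulmxDl e.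
    by rewrite mul0mx.
  have nst : np (x * s + y * t) by exists s, t.
  rewrite eW; apply: (npD _ _) => //.
  (* average the equivariance of W over H: the terms W (V i h v) add up to 0 *)
  have -> : k = #|H|%:R^-1 *: (\sum_(h in H) (act (rH h) (W v) - W (V i h *m v))
      + - 1 *: \sum_(h in H) act (rH h) (x * s + y * t)).
    rewrite sumrB.
    have -> : \sum_(h in H) W (V i h *m v) = 0.
      rewrite /W big_split /= -!mulr_sumr -!linear_sum /= -!mulmx_suml sum_irr //.
      by rewrite !mul0mx !linear0 !mulr0 addr0.
    rewrite subr0 scaleN1r -sumrB.
    have -> : \sum_(h in H) (act (rH h) (W v) - act (rH h) (x * s + y * t)) = \sum_(h in H) k.
      by apply: eq_bigr => h Hh; rewrite eW actD invk // addrK.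
    by rewrite sumr_const -scaler_nat scalerA mulVf ?cardH_neq0 // scale1r.
  apply: (npZ _ _); apply: (npD _ _); first by apply: npsum => h Hh; apply: npW.
  by apply: (npZ _ _); apply: npsum => h Hh; apply: npact.
pose Rel (v : 'cV[C]_(rdegree (V i))) (w : 'cV[C]_n) := f *m v = Y *m w /\ g *m v = - (X *m w).
have [v|c v v' w w' [h1 h2] [h3 h4]||w wP] := @lin_choice C _ _ Rel.
- have [s [t [ks kt eW]]] := Wn v.
  have [|k [ek1 ek2]] := @koszul_xy C (a v - s) (t - b v).
    apply/eqP; rewrite -subr_eq0; apply/eqP; move: eW; rewrite /W => /eqP.
    rewrite -subr_eq0 => /eqP eW; rewrite -[RHS]oppr0 -eW; ring.
  exists (p k); split.
    by rewrite -(qm_Y qm) -ek2 -ea linearB /= ((qm_ker qm s).2 ks) subr0.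
  by rewrite -(qm_X qm) -ek1 -eb linearB /= ((qm_ker qm t).2 kt) sub0r opprK.
- by split; rewrite !mulmxDr -!scalemxAr ?h1 ?h3 // h2 h4 opprD scalerN.
- by split; rewrite ?mulmx0 ?oppr0.
exists (colmx w); split; apply: eq_colmx => v; have [h1 h2] := wP v.
  by rewrite -mulmxA colmxE.
by rewrite mulNmx -mulmxA colmxE.
Qed.

Lemma P0_triv h (v : 'cV[C]_n) : h \in H -> Q h *m (P 0%N *m v) = P 0%N *m v.
Proof.
move=> Hh; have [f <-] := qm_surj qm v; rewrite -(qm_P qm) -(qm_act qm) //.
by rewrite act_deg0 // hpartK eqxx.
Qed.

(** H acts trivially on the constants. *)
Lemma coinv_homM (i : E7label) u : i != rho_0 -> hom Q (V i) u -> into aug u.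
Proof.
move=> i0 hu v; apply/in_aug; rewrite mulmxA; set A := P 0%N *m u.
have hA h : h \in H -> A *m V i h = A.
  move=> Hh; rewrite -mulmxA -hu // mulmxA -hP // -mulmxA.
  by apply: eq_colmx => w; rewrite -!mulmxA P0_triv.
suff -> : A = 0 by rewrite mul0mx.
have : \sum_(h in H) (A *m V i h) = 0 by rewrite -mulmx_sumr sum_irr // mulmx0.
rewrite (eq_bigr (fun=> A)) // sumr_const -scaler_nat => /eqP.
by rewrite scaler_eq0 (negPf (cardH_neq0 _ _)) => /eqP.
Qed.

(** An invariant of the quotient comes from an invariant polynomial, and those
    without constant term lie in n. *)
Lemma coinv_mult0M : mult Q (V rho_0) aug = 0%N.
Proof.
apply/eqP; rewrite dimv_eq0 -subv0; apply/subvP=> A /in_HomTo[hA iA].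
rewrite memv0; apply/eqP; apply: eq_colmx => v; rewrite mul0mx.
have /in_aug := iA v; set m := A *m v => m0.
have invm h : h \in H -> Q h *m m = m by move=> Hh; apply: (hom0_inv hV).
have [f ef] := qm_surj qm m.
have pf : p (reynolds rH f) = m.
  by rewrite reynolds_image // => h Hh; rewrite (qm_act qm) // ef invm.
set g := reynolds rH f in pf.
have invg h : h \in H -> act (rH h) g = g by move=> Hh; apply: reynolds_inv.
have invc h : h \in H -> act (rH h) (hpart 0 g) = hpart 0 g.
  by move=> Hh; rewrite act_deg0 // hpartK eqxx.
have : klein (g - hpart 0 g).
  apply: klein_inv; first by move=> h Hh; rewrite /act linearB /= -!/(act _ _) invg // invc.
  by rewrite meval0 mcoeffB mcoeff_hpart mdeg0 subrr.
by move/(qm_eq qm); rewrite pf (qm_P qm) pf m0.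
Qed.

Lemma klein_no_degree d : (d < 8)%N -> no_degree klein d.
Proof.
move=> d8 f kf; have [a [b ->]] := klein_homog (ltn_trans d8 (isT : (8 < 18)%N)) kf.
have d12 := ltn_trans d8 (isT : (8 < 12)%N).
by rewrite /hsub leqNgt d8 leqNgt d12 !mulr0 addr0.
Qed.

Lemma coinv_Psoc v : v \in soc X Y -> P 17%N *m v = v.
Proof.
move=> /in_soc[Xv Yv].
have P0 d : (d < 17)%N -> P d *m v = 0.
  move=> d17; have [f ef] := qm_surj qm v; rewrite -ef -(qm_P qm); apply/(qm_ker qm).
  apply: (klein_socle d17); first by rewrite hpartK eqxx.
    by apply/(qm_ker qm); rewrite (qm_X qm) (qm_P qm) mulmxA -(qm_PX qm) -mulmxA ef Xv mulmx0.
  by apply/(qm_ker qm); rewrite (qm_Y qm) (qm_P qm) mulmxA -(qm_PY qm) -mulmxA ef Yv mulmx0.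
rewrite -[RHS]mul1mx -(qm_sumP qm k18) mulmx_suml (bigD1 (inord 17)) //= inordK //.
rewrite big1 ?addr0 // => d nd; rewrite P0 //.
have := ltn_ord d; rewrite leq_eqVlt => /orP[/eqP[ed]|//].
by case/eqP: nd; apply: val_inj; rewrite /= inordK.
Qed.

(** Below degree 17 the quotient has no socle. *)
Lemma coinv_count (i : E7label) d : i != rho_0 -> (d < 17)%N ->
  (\sum_(j <- E7neighbours i) mult Q (V j) (qdeg d.+1)
    = mult Q (V i) (qdeg d.+2) + mult Q (V i) (qdeg d))%N.
Proof.
move=> i0 d17; have cap0 : (qdeg d :&: soc X Y = 0)%VS.
  apply/eqP; rewrite -subv0; apply/subvP=> v /memv_capP[/in_deg[_ ev] /coinv_Psoc e17].
  rewrite -e17 -ev mulmxA (qm_PP qm); case: eqP d17 => [<-|]; first by rewrite ltnn.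
  by rewrite mul0mx mem0v.
rewrite -(qdeg_mulV qm d.+1).
have := @koszul_count _ _ _ _ det_rH _ hV _ Q X Y (qm_XY qm) (qm_QX qm) (qm_QY qm) i
  (qdeg d.+1) (qdeg d).
rewrite cap0 mult0 addn0; apply; try exact: (stab_qdeg qm).
  apply/subvP=> v /in_deg[_ e]; apply/in_colon.
  by split; apply/in_deg; rewrite memvf mulmxA ?(qm_PX qm) ?(qm_PY qm) -mulmxA e.
move=> f g hfg fA gA e; have [w [ef eg]] := coinv_koszul i0 hfg e.
exists (P d *m w); split.
- by move=> v; apply/in_deg; rewrite memvf !mulmxA (qm_PP qm) eqxx.
- rewrite mulmxA -(qm_PY qm) -mulmxA -ef; apply: eq_colmx => v.
  by rewrite -mulmxA; have /in_deg[_ ->] := fA v.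
rewrite mulmxA -(qm_PX qm) -mulmxA -mulmxN -eg; apply: eq_colmx => v.
by rewrite -mulmxA; have /in_deg[_ ->] := gA v.
Qed.

Lemma deg_aug d : degpart P aug d = if d == 0%N then 0%VS else qdeg d.
Proof.
apply/vspaceP=> v; apply/idP/idP.
  move=> /in_deg[/in_aug v0 e]; case: eqP => [d0|_]; last by apply/in_deg; rewrite memvf.
  by rewrite -e d0 v0 mem0v.
case: eqP => [_|d0 /in_deg[_ e]]; first by rewrite memv0 => /eqP ->; rewrite mem0v.
apply/in_deg; split=> //; apply/in_aug; rewrite -e mulmxA (qm_PP qm).
by case: eqP d0 => [<-|]; rewrite ?mul0mx.
Qed.

Lemma coinv_mult_rho0 d : coinv_mult rho_0 d = 0%N.
Proof. by do 18?[case: d => [|d]; first by vm_compute]; rewrite /coinv_mult nth_default. Qed.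

Lemma coinv_rec (i : E7label) d : i != rho_0 -> (d < 16)%N ->
  nbr_sum (fun j => coinv_mult j d.+1) i = (coinv_mult i d.+2 + coinv_mult i d)%N.
Proof. by case: i => // _; do 16?[case: d => [|d]; first by vm_compute]. Qed.

Lemma coinv_multM (i : E7label) d : i != rho_0 -> mult Q (V i) (degpart P aug d) = coinv_mult i d.
Proof.
have base j : mult Q (V j) (qdeg 0) = (j == rho_0).
  exact: (qdeg0 hV qm j (klein_no_degree (isT : (0 < 8)%N))).
have tr d' : (0 < d')%N -> mult Q (V rho_0) (qdeg d') = 0%N.
  move=> d0; apply/eqP; rewrite -leqn0; apply: leq_trans (eq_leq coinv_mult0M).
  by have := deg_aug d'; rewrite gtn_eqF // => <-; apply/multS/subvP=> v /in_deg[].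
rewrite deg_aug; elim/ltn_ind: d i => -[|[|d]] IH i i0.
- by rewrite mult0; case: (i) i0.
- rewrite /= -(qdeg_count0 det_rH hV qm i (klein_no_degree (isT : (1 < 8)%N))) -nbr_sumE.
  by rewrite (eq_nbr_sum i base); case: (i) i0.
have IH' j e : (e < d.+2)%N -> (0 < e)%N -> mult Q (V j) (qdeg e) = coinv_mult j e.
  move=> ed e0; have [->|j0] := eqVneq j rho_0; first by rewrite tr // coinv_mult_rho0.
  by have := IH e ed j j0; rewrite gtn_eqF.
have [d16|d16] := ltnP d 16; last first.
  suff -> : qdeg d.+2 = 0%VS by rewrite mult0 /coinv_mult nth_default //.
  apply/eqP; rewrite -subv0; apply/subvP=> v /in_deg[_ <-].
  by rewrite (qm_PD qm k18) // mul0mx mem0v.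
have := coinv_count i0 (ltnW d16).
rewrite -nbr_sumE (eq_nbr_sum i (fun j => IH' j d.+1 (ltnSn _) isT)).
have -> : mult Q (V i) (qdeg d) = coinv_mult i d.
  case: d IH' {IH d16} => [|d] IH'; last exact: IH'.
  by rewrite base (negPf i0); case: (i) i0.
by rewrite coinv_rec // => /addIn.
Qed.

(** The multiplicities of m/n in each degree follow from the Koszul count, and
    the socle is the degree 17 part. *)
Theorem klein_coinv : coinv_module rH V Q X Y aug P.
Proof.
have PD := qm_PD qm k18.
split.
- exact: (qm_XY qm).
- exact: (qm_QX qm).
- exact: (qm_QY qm).
- move=> h v Hh /in_aug e; apply/in_aug.
  by rewrite mulmxA -(hP 0) // -mulmxA e mulmx0.
- apply/subvP=> _ /in_mulV[a [b [_ _ ->]]]; apply/in_aug.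
  by rewrite mulmxDr !mulmxA (qm_P0X qm) (qm_P0Y qm) !mul0mx addr0.
- exact: coinv_homM.
- exact: coinv_koszul.
- exact: coinv_mult0M.
- move=> i i0; have -> : soc X Y = qdeg 17.
    apply/vspaceP=> v; apply/idP/idP => [vs|/in_deg[_ e]].
      by apply/in_deg; rewrite memvf coinv_Psoc.
    by apply/in_soc; rewrite -e !mulmxA -(qm_PX qm) -(qm_PY qm) !PD // !mul0mx.
  have := coinv_multM 17 i0; rewrite deg_aug /= => ->.
  by case: (i) i0.
- exact: hP.
- exact: (qm_PP qm).
- exact: (qm_PX qm).
- exact: (qm_PY qm).
- exact: (qm_P0X qm).
- exact: (qm_P0Y qm).
- exact: PD.
- exact: (qm_sumP qm k18).
- exact: coinv_Psoc.
- move=> d v /in_aug e; apply/in_aug; rewrite mulmxA (qm_PP qm).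
  by case: eqP => [_|]; rewrite ?mul0mx.
- exact: coinv_multM.
Qed.

End Coinvariants.

(** * The exceptional locus and the submodules of m/n *)

Section Bridge.
Variables (C : numClosedFieldType) (gT : finGroupType) (H : {group gT}).
Local Notation rep := (mx_representation C H).
Local Notation S := {mpoly C[2]}.
Local Notation hpart := (@pihomog 2 C mdeg).
Local Notation x := ('X_(0 : 'I_2) : S).
Local Notation y := ('X_(1 : 'I_2) : S).
Local Notation klein := (@klein_ideal C).
Variable rH : rep 2.
Hypothesis det_rH : forall h, h \in H -> \det (rH h) = 1.
Variable V : E7label -> representation C H.
Hypothesis hV : E7_labelling rH V.
Hypothesis inv8 : forall h, h \in H -> act (rH h) (f8 C) = f8 C.
Hypothesis inv12 : forall h, h \in H -> act (rH h) (f12 C) = f12 C.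
Variables (n : nat) (p : {linear S -> 'cV[C]_n}) (Q : rep n).
Variables (X Y : 'M[C]_n) (P : nat -> 'M[C]_n).
Hypothesis qm : quot_mod rH klein p Q X Y P.
Local Notation mu i U := (mult Q (V i) U).
Local Notation M := (aug P).
Local Notation sub := (sub Q X Y M).
Local Notation exc := (exc V Q X Y M).
Local Notation on_curve := (on_curve V Q X Y M).

Let nE : invariant_ideal rH = klein := invariant_idealE det_rH hV inv8 inv12.
Let cm : coinv_module rH V Q X Y M P := klein_coinv det_rH hV inv8 inv12 qm.
Let k18 f : mpow 18 f -> klein f.
Proof. by move=> hf; exists 0, 0, f; rewrite !mulr0 !add0r. Qed.

(** Add up the multiplicities of the degrees. *)
Lemma mult_aug (i : E7label) : mu i M = if i == rho_0 then 0%N else (E7dim i).*2.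
Proof.
have [->|i0] := eqVneq i rho_0; first exact: (cm_mult0M cm).
(* the filtration of M by the parts of degree at least k *)
pose T k := vs [set v | v \in M /\ forall d, (d < k)%N -> P d *m v = 0].
have inT k v : (v \in T k) <-> v \in M /\ forall d, (d < k)%N -> P d *m v = 0.
  apply: in_vs; split=> [|a u w [h1 e1] [h2 e2]]; first by split=> [|d _]; rewrite ?mem0v ?mulmx0.
  by split=> [|d dk]; rewrite ?memvD ?memvZ // mulmxDr -scalemxAr e1 ?e2 // scaler0 addr0.
have sT k : stab Q (T k).
  move=> h v Hh /inT[vM v0]; apply/inT; split=> [|d dk]; first exact: (cm_stabM cm).
  by rewrite mulmxA -(qm_hP qm) // -mulmxA v0 // mulmx0.
have step k : mu i (T k) = (mu i (T k.+1) + coinv_mult i k)%N.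
  rewrite -(cm_multM cm _ i0); apply: (@mult_exact _ _ _ _ _ _ Q (P k)).
  - exact: (qm_hP qm).
  - exact: sT.
  - move=> u; split=> [/inT[uM u0]|[/inT[uM u0] uk]].
      by split; [apply/inT; split=> // d dk; apply/u0/ltnW|apply: u0].
    by apply/inT; split=> // d; rewrite ltnS leq_eqVlt => /orP[/eqP ->|/u0].
  - move=> u /inT[uM _]; apply/in_deg; split; first exact: (cm_gradedM cm).
    by rewrite mulmxA (qm_PP qm) eqxx.
  - move=> w /in_deg[wM ew]; exists w => //; apply/inT; split=> // d dk.
    by rewrite -ew mulmxA (qm_PP qm); case: eqP dk => [->|]; rewrite ?ltnn ?mul0mx.
have -> : M = T 0%N.
  by apply/vspaceP=> v; apply/idP/idP => [vM|/inT[]//]; apply/inT.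
have tot k : mu i (T 0%N) = (mu i (T k) + \sum_(d < k) coinv_mult i d)%N.
  elim: k => [|k IH]; first by rewrite big_ord0 addn0.
  by rewrite big_ord_recr /= IH step -addnA (addnC (coinv_mult i k)).
rewrite (tot 18%N).
have -> : T 18 = 0%VS.
  apply/eqP; rewrite -subv0; apply/subvP=> v /inT[_ v0].
  rewrite -[v]mul1mx -(cm_sumP cm) mulmx_suml big1 ?mem0v // => d _; exact: v0.
by rewrite mult0 add0n !big_ord_recr big_ord0; case: (i) i0.
Qed.

Lemma mult_full (i : E7label) : mu i fullv = (if i == rho_0 then 1 else (E7dim i).*2)%N.
Proof.
rewrite (@mult_exact _ _ _ _ _ _ Q (P 0%N) fullv M (degpart P fullv 0)).
- rewrite (qdeg0 hV qm i (klein_no_degree (isT : (0 < 8)%N))) mult_aug.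
  by case: (i).
- exact: (qm_hP qm).
- exact: stabf.
- by move=> u; split=> [/in_aug|[_ /in_aug]]; rewrite ?memvf.
- by move=> u _; apply/in_deg; rewrite memvf mulmxA (qm_PP qm).
- by move=> w /in_deg[_ ew]; exists w; rewrite ?memvf.
Qed.

(** The ideal containing n whose image in the quotient is U. *)
Definition preim (U : {vspace 'cV[C]_n}) : set S := [set f | p f \in U].

Lemma preim_inj U W : preim U = preim W -> U = W.
Proof.
move=> e; apply/vspaceP=> v; have [f <-] := qm_surj qm v.
by have /(congr1 (fun A => A f)) := e; rewrite /preim /= => ef; apply/idP/idP; rewrite ?ef // -ef.
Qed.

Lemma mem_mulV U v : (mulV X Y U <= U)%VS -> v \in U -> X *m v \in U /\ Y *m v \in U.
Proof.
by move=> /subvP mU vU; split; apply: mU; [apply: mulV_X|apply: mulV_Y].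
Qed.

Lemma preim_ideal U : (mulV X Y U <= U)%VS -> is_ideal (preim U).
Proof.
move=> mU; split=> [|f g|f g]; rewrite /preim /=; first by rewrite linear0 mem0v.
  by rewrite linearD; apply: memvD.
move=> gU; rewrite [f]mpolyE mulr_suml linear_sum; apply: memv_suml => m _.
rewrite -scalerAl linearZ; apply: memvZ; rewrite mpolyXE_id big_ord_recl big_ord1 -mulrA.
have hx (i : 'I_2) k h : p h \in U -> p ('X_i ^+ k * h) \in U.
  move=> hU; elim: k => [|k IH]; first by rewrite mul1r.
  rewrite exprS -mulrA; have [X1 Y1] := mem_mulV mU IH.
  case: (ord2 i) X1 Y1 => -> X1 Y1; first by rewrite (qm_X qm).
  by rewrite (qm_Y qm).
by apply: (hx _ _ _ (hx _ _ _ gU)).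
Qed.

Lemma klein_preim U f : klein f -> preim U f.
Proof. by move=> /(qm_ker qm) e; rewrite /preim /= e mem0v. Qed.

Lemma mpow1X (i : 'I_2) : mpow 1 ('X_i : S).
Proof. by rewrite -['X_i]mulr1; apply: mpowX => d; rewrite ltn0. Qed.

Lemma maxidealE : @maxideal C = mpow 1.
Proof.
apply/seteqP; split=> f.
  apply; split; first exact: mpow_ideal.
  by move=> _ [i _ <-]; apply: mpow1X.
move=> /mpow1 f0 I [[I0 ID IM] Ig]; have [a [b ->]] := mpow1_split f0.
by apply: (ID _ _); rewrite mulrC; apply: (IM _ _); apply: Ig; [exists 0|exists 1].
Qed.

(** For I = preim N the space V(I) = I / (m I + n) is N / (x, y) N. *)
Lemma preim_denom N : (mulV X Y N <= N)%VS ->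
  denomV rH (preim N) = preim (mulV X Y N).
Proof.
move=> mN; apply/seteqP; split=> f.
  move=> [g hg [k nk <-]]; rewrite nE in nk.
  have idD : is_ideal (preim (mulV X Y N)) by apply/preim_ideal/mulVS.
  have [_ ID _] := idD; apply: (ID _ _); last exact: klein_preim.
  apply: hg; split=> // _ [a ma [b nbr_sum <-]].
  move: ma; rewrite maxidealE => /mpow1/mpow1_split[s [t ->]].
  have [_ _ NM] := preim_ideal mN.
  apply/in_mulV; exists (p (s * b)), (p (t * b)); split; try exact: NM.
  by rewrite mulrDl -!mulrA linearD /= (qm_X qm) (qm_Y qm).
move=> /in_mulV[v [w [vN wN e]]].
have [a ea] := qm_surj qm v; have [b eb] := qm_surj qm w.
exists (x * a + y * b).
  move=> I [[I0 ID IM] Ig]; apply: (ID _ _); apply: Ig.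
    by exists x; [rewrite maxidealE; apply: mpow1X|exists a => //; rewrite /preim /= ea].
  by exists y; [rewrite maxidealE; apply: mpow1X|exists b => //; rewrite /preim /= eb].
exists (f - (x * a + y * b)); last by rewrite addrC subrK.
rewrite nE; apply/(qm_eq qm); rewrite e -ea -eb linearD /=.
by rewrite (qm_X qm) (qm_Y qm).
Qed.

(** A linear map which is equivariant modulo D can be made equivariant by
    averaging; by irreducibility it is injective modulo D as soon as it does
    not map into D. *)
Lemma embedsP (i : E7label) U D : stab Q U -> stab Q D ->
  (exists u, embeds_by (r := V i) rH (preim U) (preim D) u) <->
  exists A, [/\ hom Q (V i) A, into U A & ~ into D A].
Proof.
move=> sU sD; split.
  move=> [u [iu hu ju]]; pose B := colmx (p \o u).
  have eB v : B *m v = p (u v) by rewrite colmxE.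
  have BU : into U B by move=> v; rewrite eB; apply: iu.
  exists (avg Q (V i) B); split; [exact: avg_hom|exact: avg_into|].
  move=> AD; have BD : into D B.
    have := @avg_mod _ _ _ _ Q _ (V i) D B; move=> hav v.
    rewrite -[B *m v](subKr (avg Q (V i) B *m v)) memvB //.
    rewrite -mulmxBl; apply: hav => h Hh w; rewrite mulmxBl -!mulmxA !eB.
    by rewrite -memvN opprB -(qm_act qm) // -linearB; apply: hu.
  have d0 : (0 < rdegree (V i))%N by rewrite (V_deg hV); case: (i).
  have := ju (delta_mx (Ordinal d0) 0); rewrite /preim /= -eB => /(_ (BD _)).
  move=> /matrixP/(_ (Ordinal d0) 0); rewrite !mxE !eqxx => /eqP.
  by rewrite oner_eq0.
move=> [A [hA iA nA]]; have [a ea] := lift_lin qm A.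
exists a; split=> [v|h v Hh|v]; rewrite /preim /=; first by rewrite ea.
  by rewrite linearB (qm_act qm) //= !ea mulmxA -hA // mulmxA subrr mem0v.
by rewrite ea; apply: irr_inj hA sD nA v; apply: V_irr hV i.
Qed.

Lemma homTo_neqE (i : E7label) A B : (A <= B)%VS ->
  (mu i A < mu i B)%N <-> exists u, [/\ hom Q (V i) u, into B u & ~ into A u].
Proof.
move=> AB; split; first exact: homTo_neq.
move=> [u [hu uB uA]]; rewrite ltn_neqAle multS // andbT; apply/eqP => e.
apply: uA; have /in_HomTo[] : u \in HomTo Q (V i) A; last by [].
suff -> : HomTo Q (V i) A = HomTo Q (V i) B by apply/in_HomTo.
by apply/eqP; rewrite eqEdim HomToS //= -!/(mult _ _ _) e.
Qed.

Lemma factor_matrix m (pi : {linear S -> 'cV[C]_m}) : (forall f, klein f -> pi f = 0) ->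
  exists F : 'M[C]_(m, n), forall f, pi f = F *m p f.
Proof.
move=> pi0; have [v|a v v' u u' hu hu' f ef||g gP] :=
  @lin_choice C _ n (fun v u => forall f, p f = v -> pi f = u).
- have [f ef] := qm_surj qm v; exists (pi f) => g eg.
  apply/eqP; rewrite -subr_eq0 -linearB; apply/eqP/pi0/(qm_eq qm).
  by rewrite eg ef.
- have [k ek] := qm_surj qm v.
  have e' : p (f - a *: k) = v' by rewrite linearB linearZ /= ek ef addrC addKr.
  by rewrite -(hu _ ek) -(hu' _ e') linearB linearZ /= addrC subrK.
- by move=> f /(qm_ker qm)/pi0.
by exists (colmx g) => f; rewrite colmxE (gP (p f) f).
Qed.

Lemma mult_reg (i : E7label) : mult (regular_repr C H) (V i) fullv = E7dim i.
Proof. by rewrite mult_regular (V_deg hV). Qed.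

(** The regular representation has a line of invariants. *)
Lemma regular_inv1 (v w : 'cV[C]_#|H|) : v <> 0 ->
    (forall h, h \in H -> regular_repr C H h *m v = v) ->
    (forall h, h \in H -> regular_repr C H h *m w = w) ->
  exists c, w = c *: v.
Proof.
move=> v0 iv iw; pose T := HomTo (regular_repr C H) (V rho_0) fullv.
have inT u : (forall h, h \in H -> regular_repr C H h *m u = u) -> u *m ones V \in T.
  by move=> iu; apply/in_HomTo; split; [exact: (inv_hom hV)|move=> z; apply: memvf].
have : w *m ones V \in <[v *m ones V]>%VS.
  suff -> : <[v *m ones V]>%VS = T by apply: inT.
  apply/eqP; rewrite eqEdim -memvE inT //= -/(mult _ _ _) mult_reg dim_vline.
  by case: eqP => // /(inv_neq0 hV).
move=> /vlineP[c e]; exists c; apply/eqP; rewrite -subr_eq0; apply/eqP/(inv_neq0 hV).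
by rewrite mulmxBl -scalemxAl e subrr.
Qed.

(** An invariant f is a scalar in S / I = C[H], because the invariants of C[H]
    are a line, which contains the image of 1; if f vanishes at the origin
    then so does the scalar, since the origin is a zero of I. So n is
    contained in I. As S / I is the regular representation, which contains V i
    as often as its dimension, half of the V i of m/n are in I/n. *)
Lemma exc_of I : exceptional rH I -> exists2 N, exc N & I = preim N.
Proof.
move=> [[[idI HI] [pi [spi kpi api]]] zI]; have [I0 ID IM] := idI.
have ev0 f : I f -> f.@[fun=> 0] = 0.
  have : zero_locus I (fun=> 0) by rewrite zI.
  by apply.
have pi1 : pi 1 <> 0.
  by move=> /kpi/ev0/eqP; rewrite meval1 oner_eq0.
(* an invariant acts on S / I as a scalar, which is its value at the origin *)
have inv_I f : (forall h, h \in H -> act (rH h) f = f) -> f.@[fun=> 0] = 0 -> I f.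
  move=> invf f0; have [h Hh|h Hh|c ec] := @regular_inv1 (pi 1) (pi f) pi1.
  - by rewrite -api // act_deg0 // pihomog_dE // dhomog1.
  - by rewrite -api // invf.
  have If : I (f - c *: 1) by apply/kpi; rewrite linearB linearZ ec subrr.
  have := ev0 _ If; rewrite mevalB mevalZ f0 meval1 mulr1 sub0r => /eqP.
  by rewrite oppr_eq0 => /eqP c0; rewrite c0 scale0r subr0 in If.
have nI f : klein f -> I f by rewrite -nE; apply; split=> // g [ig g0]; apply: inv_I.
have actI h f : h \in H -> I f -> I (act (rH h) f).
  by move=> Hh If; rewrite -(HI h Hh); apply: imageP.
have [_ _ IZ IB _] := ideal_sub idI.
pose N := proj_image p I.
have inN v : (v \in N) <-> exists2 f, I f & p f = v by exact: in_proj_image.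
have eI : I = preim N.
  apply/seteqP; split=> f; first by move=> If; apply/inN; exists f.
  move=> /inN[g Ig /esym/(qm_eq qm)/nI h]; rewrite -[f](subrK g); exact: ID.
have sN : stab Q N.
  move=> h _ Hh /inN[f If <-]; apply/inN; exists (act (rH h) f); first exact: actI.
  by rewrite (qm_act qm).
have NM : (N <= M)%VS.
  apply/subvP=> _ /inN[f /ev0 f0 <-]; apply/in_aug; rewrite -(qm_P qm).
  have -> : hpart 0 f = 0; last by rewrite linear0.
  by have /mpow1 := etrans (esym (meval0 f)) f0; apply.
exists N => //; split; first split=> //.
  apply/subvP=> _ /in_mulV[_ [_ [/inN[f If <-] /inN[g Ig <-] ->]]].
  apply/inN; exists (x * f + y * g); first by apply: (ID _ _); apply: IM.
  by rewrite linearD /= (qm_X qm) (qm_Y qm).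
move=> i; have [->|i0] := eqVneq i rho_0; first exact: (mu0 cm NM).
have [F eF] := factor_matrix (fun f kf => (kpi f).2 (nI f kf)).
have : mu i fullv = (mu i N + mult (regular_repr C H) (V i) fullv)%N.
  apply: (@mult_exact _ _ _ _ _ _ (regular_repr C H) F).
  - move=> h Hh; apply: eq_colmx => v; have [f <-] := qm_surj qm v.
    by rewrite -!mulmxA -(qm_act qm) // -!eF api.
  - exact: stabf.
  - move=> u; have [f <-] := qm_surj qm u; rewrite -eF; split=> [|[_ /kpi]].
      by rewrite memvf => pfN; split=> //; apply/kpi; rewrite eI.
    by rewrite eI.
  - by move=> u _; rewrite memvf.
  - move=> w _; have [f ef] := spi w; exists (p f); first exact: memvf.
    by rewrite -eF.
rewrite mult_full mult_reg (negPf i0) /dimv (negPf i0); lia.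
Qed.

(** A complement of N has the multiplicities of the regular representation,
    hence is isomorphic to it. The ideal contains m^18 and is contained in m,
    so that its only zero is the origin. *)
Lemma exceptional_of N : exc N -> exceptional rH (preim N).
Proof.
move=> [[sN NM mN] dN]; have idN := preim_ideal mN; have [I0 ID IM] := idN.
have actN h f : h \in H -> preim N f -> preim N (act (rH h) f).
  by move=> Hh fN; rewrite /preim /= (qm_act qm) //; apply: sN.
split; first split.
- split=> // h Hh; apply/seteqP; split=> [_ [f fN <-]|f fN]; first exact: actN.
  exists (act (rH h^-1%g) f); first by apply: actN; rewrite ?groupV.
  by rewrite -act_mul -repr_mxM ?groupV // mulgV repr_mx1 act1.
- have [T [hT iT idT]] := maschke sN.
  pose D := vs [set v : 'cV[C]_n | T *m v = 0].
  have inD v : (v \in D) <-> T *m v = 0.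
    apply: in_vs; split=> [|a u w eu ew]; first by rewrite /= mulmx0.
    by rewrite /= mulmxDr -scalemxAr eu ew scaler0 addr0.
  have sD : stab Q D.
    by move=> h v Hh /inD e; apply/inD; rewrite mulmxA -hT // -mulmxA e mulmx0.
  have multD i : mu i D = mult (regular_repr C H) (V i) fullv.
    have : mu i fullv = (mu i D + mu i N)%N.
      apply: (@mult_exact _ _ _ _ _ _ Q T) => //.
      - exact: stabf.
      - by move=> u; split=> [/inD|[_ /inD]]; rewrite ?memvf.
      - by move=> w wN; exists w; rewrite ?memvf ?idT.
    rewrite mult_full mult_reg dN /dimv; case: eqP => [->|_] /=; lia.
  have [F [hF iF sF kF]] := iso_of_mult hV sD (@stabf _ _ _ _ (regular_repr C H)) multD.
  pose G := F *m (1%:M - T).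
  have lG : linear (fun f : S => G *m p f).
    by move=> a f g; rewrite linearP mulmxDr scalemxAr.
  pose GL : {linear S -> 'cV[C]_#|H|} :=
    HB.pack (fun f : S => G *m p f) (GRing.isLinear.Build _ _ _ _ (fun f : S => G *m p f) lG).
  have inD' v : (1%:M - T) *m v \in D.
    by apply/inD; rewrite mulmxBl mul1mx mulmxBr (idT (T *m v)) ?subrr //; apply: iT.
  exists GL; split=> /=.
  + move=> v; have [u uD eu] := sF v (memvf v); have [f ef] := qm_surj qm u.
    by exists f; rewrite ef /G -mulmxA mulmxBl mul1mx ((inD u).1 uD) subr0.
  + move=> f; rewrite /G -mulmxA; split=> [/kF|fN].
      move=> /(_ (inD' _))/eqP; rewrite mulmxBl mul1mx subr_eq0 => /eqP e.
      by rewrite /preim /= e; apply: iT.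
    by rewrite mulmxBl mul1mx idT // subrr mulmx0.
  + move=> h f Hh; rewrite (qm_act qm) // /G !mulmxA hF //; congr (_ *m _).
    by rewrite -!mulmxA; congr (F *m _); rewrite mulmxBl mulmxBr mul1mx mulmx1 hT.
apply/seteqP; split=> z /=.
  move=> z0; apply/funext => i.
  have : preim N ('X_i ^+ 18).
    apply/klein_preim/k18 => d d18; rewrite -(pihomog_dE (homXn C i 18)) hpartK.
    by case: eqP d18 => // ->.
  by move=> /z0; rewrite rmorphXn /= mevalXU => /eqP; rewrite expf_eq0 => /andP[_ /eqP].
move=> -> f fN; rewrite meval0.
have /in_aug := subvP NM _ fN; rewrite -(qm_P qm) => /(qm_ker qm)/(klein_no_degree (isT : (0 < 8)%N)).
by rewrite hpartK eqxx => f0; apply/mpow1 => -[|//] _.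
Qed.

(** The point lies on E(r) when V r is among its generators. *)
Lemma EcurveP (i : E7label) I :
  Ecurve rH (V i) I <-> exists2 N, on_curve i N & I = preim N.
Proof.
split=> [[/exc_of[N eN eI] hu]|[N [eN lt] ->]].
  exists N => //; split=> //; have [[sN NM mN] _] := eN.
  apply/(homTo_neqE _ mN)/embedsP => //; first exact: (stab_mulV (cm_QX cm) (cm_QY cm)).
  by rewrite -preim_denom // -eI.
have [[sN NM mN] _] := eN; split; first exact: exceptional_of.
rewrite preim_denom //; apply/embedsP => //; first exact: (stab_mulV (cm_QX cm) (cm_QY cm)).
exact/(homTo_neqE _ mN).
Qed.

Lemma p_scale c f : p (act (c%:M : 'M[C]_2) f) = Zmx P c *m p f.
Proof.
have hsplit g : p g = p (\sum_(d < 18) hpart d g).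
  rewrite linear_sum /= -[p g]mul1mx -(cm_sumP cm) mulmx_suml.
  by apply: eq_bigr => d _; rewrite (qm_P qm).
rewrite hsplit /Zmx mulmx_suml linear_sum; apply: eq_bigr => d _.
by rewrite -act_hpart (act_scalar _ (pihomogP _ _ _)) linearZ /= -scalemxAl (qm_P qm).
Qed.

End Bridge.

(** * Neighbourhoods of the points of a curve *)

Lemma poly_nonroot (C : numFieldType) (q : {poly C}) : q != 0 -> exists t, q.[t] != 0.
Proof.
move=> q0; apply: contrapT => nt.
pose s := [seq k%:R : C | k <- iota 0 (size q)].
have us : uniq s.
  by rewrite map_inj_uniq ?iota_uniq // => a b /eqP; rewrite eqr_nat => /eqP.
have rs : all (root q) s.
  by apply/allP=> t _; rewrite /root; apply/negPn/negP => qt; apply: nt; exists t.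
by have := max_poly_roots q0 rs us; rewrite size_map size_iota ltnn.
Qed.

(** Multiply by the denominator to the power of the degree. *)
Lemma clear_denom (C : fieldType) m (P : {mpoly C[m]}) (a : 'I_m -> {poly C}) (b : {poly C}) :
  exists q : {poly C}, forall t, b.[t] != 0 ->
    q.[t] = b.[t] ^+ msize P * P.@[fun k => (a k).[t] / b.[t]].
Proof.
exists (\sum_(e <- msupp P) P@_e *: (\prod_k a k ^+ e k * b ^+ (msize P - mdeg e))).
move=> t bt; rewrite horner_sum mevalE mulr_sumr !big_seq; apply: eq_bigr => e eP.
rewrite hornerZ hornerM horner_prod horner_exp [RHS]mulrCA; congr (_ * _).
have de : (mdeg e <= msize P)%N by apply/ltnW/msize_mdeg_lt.
rewrite -[in RHS](subnK de) exprD -mulrA mulrC; congr (_ * _).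
rewrite mdegE -prodrXr -big_split; apply: eq_bigr => k _ /=.
by rewrite horner_exp expr_div_n mulrC divfK // expf_neq0.
Qed.

Section Isolation.
Variables (C : numClosedFieldType) (gT : finGroupType) (H : {group gT}).
Local Notation rep := (mx_representation C H).
Local Notation S := {mpoly C[2]}.
Local Notation klein := (@klein_ideal C).
Variable rH : rep 2.
Hypothesis det_rH : forall h, h \in H -> \det (rH h) = 1.
Variable V : E7label -> representation C H.
Hypothesis hV : E7_labelling rH V.
Hypothesis inv8 : forall h, h \in H -> act (rH h) (f8 C) = f8 C.
Hypothesis inv12 : forall h, h \in H -> act (rH h) (f12 C) = f12 C.
Variables (n : nat) (p : {linear S -> 'cV[C]_n}) (Q : rep n).
Variables (X Y : 'M[C]_n) (P : nat -> 'M[C]_n).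
Hypothesis qm : quot_mod rH klein p Q X Y P.
Local Notation M := (aug P).
Local Notation preim := (preim p).
Local Notation Epencil r := (@Epencil C gT H V n Q X Y M P r).
Let cm : coinv_module rH V Q X Y M P := klein_coinv det_rH hV inv8 inv12 qm.

(** The coordinates modulo preim U form a matrix F with kernel U. *)
Lemma basis_matrix N (b : 'I_N -> S) U : is_basis_mod b (preim U) ->
  exists F : 'M[C]_(N, n), (forall v, v \in U <-> F *m v = 0) /\
    forall j, F *m p (b j) = delta_mx j 0.
Proof.
move=> hb; pose comb (c : 'cV[C]_N) := \sum_j c j 0 *: b j.
have combE c : \sum_j c^T 0 j *: b j = comb c by apply: eq_bigr => j _; rewrite mxE.
have combL a c c' : comb (a *: c + c') = a *: comb c + comb c'.
  rewrite /comb scaler_sumr -big_split; apply: eq_bigr => j _ /=.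
  by rewrite !mxE scalerDl scalerA.
have uniq f c c' : p f - p (comb c) \in U -> p f - p (comb c') \in U -> c = c'.
  move=> h h'; have [d [_ ud]] := hb f.
  have ec z : p f - p (comb z) \in U -> d = z^T.
    by move=> hz; apply: ud; rewrite combE /preim /= linearB.
  by apply: trmx_inj; rewrite -(ec c h) -(ec c' h').
pose Rel (v : 'cV[C]_n) (c : 'cV[C]_N) := v - p (comb c) \in U.
have [v|a v v' c c' h h'||F FP] := @lin_choice C _ n Rel.
- have [f <-] := qm_surj qm v; have [d [hd _]] := hb f; exists d^T.
  by rewrite /Rel -linearB -combE trmxK.
- rewrite /Rel combL linearP opprD addrACA -scalerBr; exact: memvD (memvZ _ h) h'.
- rewrite /Rel /comb big1 ?linear0 ?addr0 ?mem0v // => j _; by rewrite mxE scale0r.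
have comb0 : comb 0 = 0 by rewrite /comb big1 // => j _; rewrite mxE scale0r.
exists (colmx F); split=> [v|j]; rewrite colmxE.
  have [f ef] := qm_surj qm v; split=> [vU|e].
    by apply: (uniq f); rewrite ef; [apply: FP|rewrite comb0 linear0 subr0].
  by have := FP v; rewrite /Rel e comb0 linear0 subr0.
apply: (uniq (b j)); first exact: FP.
suff -> : comb (delta_mx j 0) = b j by rewrite subrr mem0v.
rewrite /comb (bigD1 j) //= !mxE !eqxx scale1r big1 ?addr0 // => k kj.
by rewrite mxE (negPf kj) scale0r.
Qed.

(** Conversely, if F has kernel U then b is a basis when the images F (p b_j)
    are the columns of an invertible matrix B, and the coordinates of f are
    B^-1 F (p f). *)
Lemma matrix_basis N (b : 'I_N -> S) (U : {vspace 'cV[C]_n}) (F : 'M[C]_(N, n)) :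
    (forall v, v \in U <-> F *m v = 0) ->
    let B := \matrix_(i, j) (F *m p (b j)) i 0 in B \in unitmx ->
  is_basis_mod b (preim U) /\
  forall f, preim U (f - \sum_j (invmx B *m (F *m p f)) j 0 *: b j).
Proof.
move=> UF B uB.
have FB c : F *m p (\sum_j c j *: b j) = B *m (\col_j c j).
  rewrite linear_sum /= mulmx_sumr; apply/matrixP=> i z; rewrite ord1 summxE [RHS]mxE.
  apply: eq_bigr => j _; rewrite linearZ /= -scalemxAr [LHS]mxE mulrC.
  by rewrite /B !mxE.
have colK (v : 'cV[C]_N) : \col_j v j 0 = v by apply/matrixP=> i j; rewrite mxE ord1.
have ex f : preim U (f - \sum_j (invmx B *m (F *m p f)) j 0 *: b j).
  apply/UF; rewrite linearB mulmxBr FB (colK (invmx B *m _)) mulmxA mulmxV // mul1mx.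
  by rewrite subrr.
split=> // f; exists (invmx B *m (F *m p f))^T; split.
  set c := invmx B *m _.
  have -> : \sum_j c^T 0 j *: b j = \sum_j c j 0 *: b j by apply: eq_bigr => j _; rewrite mxE.
  exact: ex.
move=> d /UF; rewrite linearB mulmxBr FB => /eqP; rewrite subr_eq0 => /eqP ->.
by rewrite mulmxA mulVmx // mul1mx; apply/matrixP=> i j; rewrite ord1 !mxE.
Qed.

(** Project away from E equivariantly and invert the resulting injection on
    the left. *)
Lemma lambda_exists (r : E7label) E w : stab Q E -> hom Q (V r) w -> ~ into E w ->
  exists L : 'M[C]_(rdegree (V r), n), (forall v, v \in E -> L *m v = 0) /\ L *m w = 1%:M.
Proof.
move=> sE hw nE; have [T [hT iT idT]] := maschke sE.
have hA : hom Q (V r) ((1%:M - T) *m w).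
  move=> h Hh; rewrite mulmxBl mul1mx mulmxBr mulmxBl hw // !mulmxA hT //.
  by rewrite -[T *m Q h *m w]mulmxA hw // mulmxA.
have [|L [hL eL]] := left_inverse (V_irr hV r) hA.
  move=> /eqP; rewrite mulmxBl mul1mx subr_eq0 => /eqP e; apply: nE => v.
  by rewrite e -mulmxA; apply: iT.
exists (L *m (1%:M - T)); split=> [v vE|]; last by rewrite -mulmxA.
by rewrite -mulmxA mulmxBl mul1mx idT // subrr mulmx0.
Qed.

(** Let N_t = K + img (w0 + t w1) be the points of the pencil near w0, and let L
    be a linear map from the quotient to V r that vanishes on K and img w1 and
    inverts w0 on the left.  Then g_t = 1 + t w1 L is a one-parameter group with
    g_t N_0 = N_t.  If F gives the coordinates modulo N_0, then F g_(-t), which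
    is affine in t, has kernel N_t.  So the coordinates modulo N_t of a fixed
    polynomial are rational functions of t, defined at 0, and the conditions
    defining the open set hold for some t other than 0. *)
Theorem pencil_nbhs (r : E7label) K ua ub x0 y0 k N (b : 'I_N -> S) (fs : 'I_k -> S) D :
    Epencil r K ua ub -> (x0 != 0) || (y0 != 0) ->
    basic_open b fs D (preim (K + img (x0 *: ua + y0 *: ub))%VS) ->
  exists x1 y1, [/\ (x1 != 0) || (y1 != 0),
    basic_open b fs D (preim (K + img (x1 *: ua + y1 *: ub))%VS)
    & preim (K + img (x1 *: ua + y1 *: ub))%VS <> preim (K + img (x0 *: ua + y0 *: ub))%VS].
Proof.
move=> pK xy0 [hb [c0 hc0 Dc0]].
have [sK _ _] := pencil_sub pK.
(* a second point of the pencil, so that w0 and w1 are independent modulo K *)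
have [x1 [y1 [xy1 ind]]] : exists x1 y1 : C, (x1 != 0) || (y1 != 0) /\
    forall s t, s * x1 = t * x0 -> s * y1 = t * y0 -> s = 0 /\ t = 0.
  have [e|x00] := eqVneq x0 0.
    rewrite e eqxx /= in xy0; exists 1, 0; rewrite oner_eq0; split=> // s t.
    rewrite e mulr1 !mulr0 => -> /esym/eqP; rewrite mulf_eq0 (negPf xy0) orbF.
    by move=> /eqP.
  exists 0, 1; rewrite oner_eq0 eqxx; split=> // s t.
  rewrite mulr1 mulr0 => /esym/eqP; rewrite mulf_eq0 (negPf x00) orbF => /eqP -> ->.
  by rewrite mul0r.
set w0 := x0 *: ua + y0 *: ub in hb hc0 *; set w1 := x1 *: ua + y1 *: ub.
have hw0 : hom Q (V r) w0 by apply: homD; [exact: pencil_homa pK|exact: pencil_homb pK].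
have hw1 : hom Q (V r) w1 by apply: homD; [exact: pencil_homa pK|exact: pencil_homb pK].
have n01 : ~ into (K + img w1)%VS w0.
  move=> /(pencil_inj hV pK xy1 xy0)[s [ex ey]].
  have [_ /eqP] : s = 0 /\ (1 : C) = 0 by apply: ind; rewrite mul1r.
  by rewrite oner_eq0.
have [L [LE Lw0]] := lambda_exists (stabD sK (stab_img hw1)) hw0 n01.
have LK v : v \in K -> L *m v = 0 by move=> vK; apply: LE; rewrite -[v]addr0 memv_add ?mem0v.
have Lw1 : L *m w1 = 0.
  apply: eq_colmx => v; rewrite mul0mx -mulmxA; apply: LE; rewrite -[_ *m v]add0r.
  by rewrite memv_add ?mem0v //; apply/in_img; exists v.
pose g (t : C) := 1%:M + t *: (w1 *m L).
have gN s t : g s *m g t = g (s + t).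
  rewrite /g mulmxDl mul1mx mulmxDr mulmx1 -scalemxAl -scalemxAr mulmxA.
  by rewrite -[w1 *m L *m w1]mulmxA Lw1 mulmx0 mul0mx !scaler0 addr0 scalerDl addrAC addrA.
have g0 : g 0 = 1%:M by rewrite /g scale0r addr0.
pose Nt t := (K + img ((x0 + t * x1) *: ua + (y0 + t * y1) *: ub))%VS.
have wt t : (x0 + t * x1) *: ua + (y0 + t * y1) *: ub = w0 + t *: w1.
  by rewrite /w0 /w1 scalerDr !scalerA !scalerDl addrACA.
have gw t : g t *m w0 = w0 + t *: w1.
  by rewrite /g mulmxDl mul1mx -scalemxAl -mulmxA Lw0 mulmx1.
have gK t v : v \in K -> g t *m v = v.
  by move=> vK; rewrite /g mulmxDl mul1mx -scalemxAl -mulmxA LK // mulmx0 scaler0 addr0.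
have [F0 [F0P F0b]] := basis_matrix hb.
have NtP t v : v \in Nt t <-> F0 *m g (- t) *m v = 0.
  rewrite -mulmxA; split=> [/memv_addP[a aK [_ /in_img[z ->] ->]]|/F0P].
    apply/F0P; rewrite wt -gw mulmxDr gK // -[_ *m z]mulmxA mulmxA gN addNr g0 mul1mx.
    by rewrite memv_add //; apply/in_img; exists z.
  have {2}-> : v = g t *m (g (- t) *m v) by rewrite mulmxA gN subrr g0 mul1mx.
  move=> /memv_addP[a aK [_ /in_img[z ->] ->]]; rewrite mulmxDr gK // mulmxA gw -wt.
  by rewrite memv_add //; apply/in_img; exists z.
(* F0 g_(-t) as a matrix of polynomials in t *)
pose pF : 'M[{poly C}]_(N, n) := map_mx polyC F0 - 'X *: map_mx polyC (F0 *m (w1 *m L)).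
have pFE t : map_mx (fun q : {poly C} => q.[t]) pF = F0 *m g (- t).
  rewrite /g mulmxDr mulmx1 -scalemxAr scaleNr /pF; move: (F0 *m (w1 *m L)) => A.
  by apply/matrixP=> i j; rewrite !mxE !hornerE.
pose pB : 'M[{poly C}]_N := pF *m \matrix_(i, j) (p (b j) i 0)%:P.
pose B t : 'M[C]_N := \matrix_(i, j) (F0 *m g (- t) *m p (b j)) i 0.
have evM (t : C) m1 m2 m3 (A : 'M[{poly C}]_(m1, m2)) (A' : 'M[{poly C}]_(m2, m3)) :
    map_mx (horner^~ t) (A *m A') = map_mx (horner^~ t) A *m map_mx (horner^~ t) A'.
  by rewrite -[LHS]/(map_mx (horner_eval t) (A *m A')) map_mxM.
have BE t : map_mx (horner^~ t) pB = B t.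
  rewrite evM pFE; apply/matrixP=> i j; rewrite !mxE.
  by apply: eq_bigr => l _; rewrite !mxE hornerC.
pose de := \det pB.
have deE t : de.[t] = \det (B t) by rewrite -BE -[LHS]/(horner_eval t _) -det_map_mx.
have B0 : B 0 = 1%:M.
  apply/matrixP=> i j; rewrite /B oppr0 g0 mulmx1 mxE F0b !mxE eqxx andbT.
  by rewrite eq_sym.
have de0 : de.[0] = 1 by rewrite deE B0 det1.
pose pc : 'M[{poly C}]_(k, N) :=
  ((\adj pB) *m (pF *m \matrix_(i, j) (p (fs j) i 0)%:P))^T.
have basisT t : de.[t] != 0 -> is_basis_mod b (preim (Nt t)) /\
    coords_mod b fs (preim (Nt t)) (\matrix_(i, j) ((pc i j).[t] / de.[t])).
  move=> dt; have uB : B t \in unitmx by rewrite unitmxE -deE unitfE.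
  have [hbt hft] := matrix_basis (NtP t) uB; split=> // i.
  have := hft (fs i); rewrite (eq_bigr (fun j => (\matrix_(i, j) ((pc i j).[t] / de.[t])) i j *: b j)) //.
  move=> j _; congr (_ *: _); rewrite -/(B t) /invmx uB -scalemxAl !mxE -deE mulrC; congr (_ / _).
  rewrite horner_sum; apply: eq_bigr => l _; rewrite hornerM; congr (_ * _).
    by rewrite -BE -[RHS]/(horner_eval t _) !mxE /cofactor rmorphM rmorph_sign -det_map_mx /=; congr (_ * \det _); apply/matrixP=> ? ?; rewrite !mxE.
  by rewrite -pFE !mxE horner_sum; apply: eq_bigr => z _; rewrite !mxE hornerM hornerC.
have [q qE] := clear_denom D (fun z => mxvec pc 0 z) de.
have vecE t : (fun z => (mxvec pc 0 z).[t] / de.[t]) =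
    (fun z => mxvec (\matrix_(i, j) ((pc i j).[t] / de.[t])) 0 z).
  by apply/funext=> z; case/mxvec_indexP: z => i j; rewrite !mxvecE mxE.
have d00 : de.[0] != 0 by rewrite de0 oner_eq0.
have N0 : Nt 0 = (K + img w0)%VS by rewrite /Nt !mul0r !addr0.
have q0 : q.[0] != 0.
  rewrite qE // de0 expr1n mul1r -de0 vecE.
  have [_ hc] := basisT 0 d00; rewrite N0 in hc.
  suff -> : \matrix_(i, j) ((pc i j).[0] / de.[0]) = c0 by [].
  apply/matrixP=> i j; have [d [_ ud]] := hb (fs i).
  set A := \matrix_(i, j) _; have /rowP/(_ j) : row i A = row i c0; last by rewrite !mxE.
  transitivity d; [apply/esym|]; apply: ud.
    by under eq_bigr do rewrite mxE; apply: hc.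
  by under eq_bigr do rewrite mxE; apply: hc0.
(* t must differ from 0, and neither the determinant nor D may vanish at t *)
have [t qt] : exists t, (q * de * 'X).[t] != 0.
  apply: poly_nonroot; rewrite !mulf_neq0 ?polyX_eq0 //.
    by apply: contraNneq q0 => ->; rewrite horner0.
  by apply: contraNneq d00 => ->; rewrite horner0.
move: qt; rewrite !hornerM hornerX !mulf_eq0 !negb_or => /andP[/andP[qt dt] t0].
exists (x0 + t * x1), (y0 + t * y1); split.
- rewrite -negb_and; apply/negP => /andP[/eqP ex /eqP ey].
  have [|| _ /eqP] := ind t (- 1); last by rewrite oppr_eq0 oner_eq0.
    by rewrite mulN1r; apply/eqP; rewrite -addr_eq0 addrC ex.
  by rewrite mulN1r; apply/eqP; rewrite -addr_eq0 addrC ey.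
- have [hbt hct] := basisT t dt; split=> //.
  exists (\matrix_(i, j) ((pc i j).[t] / de.[t])) => //.
  by move: qt; rewrite qE // mulf_eq0 negb_or -vecE => /andP[].
move=> /(preim_inj qm) eN.
have hx : into (K + img w0)%VS ((x0 + t * x1) *: ua + (y0 + t * y1) *: ub).
  by move=> v; rewrite -eN -[_ *m v]add0r memv_add ?mem0v //; apply/in_img; exists v.
have [|s [ex ey]] := pencil_inj hV pK xy0 _ hx.
  rewrite -negb_and; apply/negP => /andP[/eqP ex /eqP ey].
  have [|| _ /eqP] := ind t (- 1); last by rewrite oppr_eq0 oner_eq0.
    by rewrite mulN1r; apply/eqP; rewrite -addr_eq0 addrC ex.
  by rewrite mulN1r; apply/eqP; rewrite -addr_eq0 addrC ey.
have [|| t00 _] := ind t (s - 1); last by rewrite t00 eqxx in t0.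
  by rewrite mulrBl mul1r -ex addrAC subrr add0r.
by rewrite mulrBl mul1r -ey addrAC subrr add0r.
Qed.

Lemma basis_notin N (b : 'I_N -> S) (J : set S) k : is_ideal J -> is_basis_mod b J -> ~ J (b k).
Proof.
move=> [J0 _ _] hb Jk; have [c [_ uc]] := hb (b k).
have e1 : c = 0 by apply: uc; rewrite big1 ?subr0 // => j _; rewrite mxE scale0r.
have /esym : c = delta_mx 0 k.
  apply: uc; rewrite (bigD1 k) //= mxE !eqxx scale1r big1 ?addr0 ?subrr // => j jk.
  by rewrite mxE (negPf jk) andbF scale0r.
by rewrite e1 => /matrixP/(_ 0 k); rewrite !mxE !eqxx => /eqP; rewrite oner_eq0.
Qed.

(** Replace by q an element of a basis on which q has a nonzero coordinate. *)
Lemma extend_basis N (J : set S) (pi : {linear S -> 'cV[C]_N}) q :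
    (forall v, exists f, pi f = v) -> (forall f, pi f = 0 <-> J f) -> ~ J q ->
  exists b : 'I_N -> S, is_basis_mod b J /\ exists k, b k = q.
Proof.
move=> spi kpi nq; have [k vk] : exists k, pi q k 0 != 0.
  apply: contrapT => nk; apply/nq/kpi/matrixP=> i j; rewrite ord1 mxE.
  by apply/eqP; apply: contrapT => /negP h; apply: nk; exists i.
have [e eP] := choice (fun j => spi (delta_mx j 0)).
pose b j := if j == k then q else e j; exists b; split; last by exists k; rewrite /b eqxx.
have piE (c : 'rV[C]_N) i : (pi (\sum_j c 0 j *: b j)) i 0 =
    c 0 k * pi q i 0 + (if i == k then 0 else c 0 i).
  rewrite linear_sum summxE (bigD1 k) //= linearZ mxE /b eqxx; congr (_ + _).
  case: eqP => [->|/eqP ik].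
    rewrite big1 // => j jk; rewrite linearZ mxE (negPf jk) eP mxE eq_sym (negPf jk).
    by rewrite mulr0.
  rewrite (bigD1 i) //= linearZ mxE (negPf ik) eP mxE !eqxx mulr1 big1 ?addr0 //.
  move=> j /andP[jk ji]; rewrite linearZ mxE (negPf jk) eP mxE eq_sym (negPf ji).
  by rewrite mulr0.
move=> f; pose ck := pi f k 0 / pi q k 0.
exists (\row_j if j == k then ck else pi f j 0 - ck * pi q j 0); split.
  apply/kpi; rewrite linearB; apply/matrixP=> i j; rewrite ord1 [LHS]mxE [X in _ + X]mxE piE !mxE eqxx.
  case: eqP => [->|_]; first by rewrite addr0 divfK // subrr.
  by rewrite addrCA subrr addr0 subrr.
move=> c /kpi; rewrite linearB => /eqP; rewrite subr_eq0 => /eqP ef.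
have ck0 : c 0 k = ck.
  by rewrite /ck ef piE eqxx addr0 mulfK.
apply/rowP=> j; rewrite mxE; case: eqP => [->|/eqP jk]; first by rewrite ck0.
by rewrite ef piE (negPf jk) ck0 addrAC subrr add0r.
Qed.

End Isolation.

(** * The action of a scalar matrix on the exceptional curves *)

Section Fixed.
Variables (C : numClosedFieldType) (gT : finGroupType) (H : {group gT}).
Local Notation rep := (mx_representation C H).
Local Notation S := {mpoly C[2]}.
Local Notation klein := (@klein_ideal C).
Variable rH : rep 2.
Hypothesis det_rH : forall h, h \in H -> \det (rH h) = 1.
Variable V : E7label -> representation C H.
Hypothesis hV : E7_labelling rH V.
Hypothesis inv8 : forall h, h \in H -> act (rH h) (f8 C) = f8 C.
Hypothesis inv12 : forall h, h \in H -> act (rH h) (f12 C) = f12 C.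
Variables (n : nat) (p : {linear S -> 'cV[C]_n}) (Q : rep n).
Variables (X Y : 'M[C]_n) (P : nat -> 'M[C]_n).
Hypothesis qm : quot_mod rH klein p Q X Y P.
Local Notation M := (aug P).
Local Notation preim := (preim p).
Local Notation Epencil r := (@Epencil C gT H V n Q X Y M P r).
Local Notation on_curve := (on_curve V Q X Y M).
Let cm : coinv_module rH V Q X Y M P := klein_coinv det_rH hV inv8 inv12 qm.
Let nE : invariant_ideal rH = klein := invariant_idealE det_rH hV inv8 inv12.
Local Notation EcP := (EcurveP det_rH hV inv8 inv12 qm).

Lemma Ecurve_pencil r K ua ub I : Epencil r K ua ub ->
  Ecurve rH (V r) I <-> exists x y, (x != 0) || (y != 0) /\
    I = preim (K + img (x *: ua + y *: ub))%VS.
Proof.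
move=> pK; split=> [/EcP[N /(pencilE pK)[x [y [xy ->]]] ->]|[x [y [xy ->]]]].
  by exists x, y.
by apply/EcP; eexists; [apply: (pencil_exc pK xy)|].
Qed.

Variable c : C.
Hypothesis c2 : c ^+ 2 = -1.
Local Notation actc := (act_ideal (c%:M : 'M[C]_2)).

Let c4 : c ^+ 4 = 1.
Proof. by rewrite -[4%N]/(2 * 2)%N exprM c2 sqrrN expr1n. Qed.

Let c0 : c != 0.
Proof. by apply/eqP => e; move/eqP: c4; rewrite e expr0n eq_sym oner_eq0. Qed.

(** The fixed locus of A, which acts through the scalar matrix c. *)
Definition scalar_fixed : set (set S) := [set I | exceptional rH I /\ actc I = I].

Lemma act_c4 f : act (c%:M : 'M[C]_2) (act ((c ^+ 3)%:M : 'M[C]_2) f) = f.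
Proof. by rewrite -act_mul -scalar_mxM -exprS c4 act1. Qed.

Lemma scale_pencil_sub r K ua ub d x y f : r != rho_0 -> Epencil r K ua ub ->
  preim (K + img (x *: ua + y *: ub))%VS f ->
  preim (K + img ((x * d ^+ lowdeg r) *: ua + (y * d ^+ highdeg r) *: ub))%VS
    (act (d%:M : 'M[C]_2) f).
Proof.
move=> r0 pK; rewrite /preim /= (p_scale det_rH hV inv8 inv12 qm).
move=> /memv_addP[a aK [_ /in_img[z ->] ->]]; rewrite mulmxDr memv_add //.
  exact: Zmx_graded (pencil_graded pK) aK.
by apply/in_img; exists z; rewrite mulmxA (Zmx_pencil cm d x y r0 pK).
Qed.

(** The scalar matrix c acts on the projective line E(r) by the diagonal
    matrix (c^lowdeg r, c^highdeg r). *)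
Lemma scale_pencil r K ua ub x y : r != rho_0 -> Epencil r K ua ub ->
  actc (preim (K + img (x *: ua + y *: ub))%VS) =
  preim (K + img ((x * c ^+ lowdeg r) *: ua + (y * c ^+ highdeg r) *: ub))%VS.
Proof.
move=> r0 pK; apply/seteqP; split=> [_ [f fN <-]|f fN]; first exact: scale_pencil_sub.
exists (act ((c ^+ 3)%:M : 'M[C]_2) f); last exact: act_c4.
have := scale_pencil_sub (c ^+ 3) r0 pK fN.
have e k (z : C) : z * c ^+ k * (c ^+ 3) ^+ k = z.
  by rewrite -mulrA -exprMn -exprS c4 expr1n mulr1.
by rewrite !e.
Qed.

Lemma scale_Ecurve r : r != rho_0 -> actc @` Ecurve rH (V r) = Ecurve rH (V r).
Proof.
move=> r0; have [K [ua [ub pK]]] := pencil_exists det_rH hV cm r0.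
have EP I := Ecurve_pencil I pK.
have nz k z : z * c ^+ k != 0 = (z != 0) by rewrite mulf_eq0 expf_eq0 (negPf c0) andbF orbF.
apply/seteqP; split=> [_ [I /EP[x [y [xy ->]]] <-]|I /EP[x [y [xy ->]]]].
  by apply/EP; rewrite (scale_pencil x y r0 pK); do 2!eexists; split; last reflexivity; rewrite !nz.
pose l := lowdeg r; pose h := highdeg r.
have xy' : (x / c ^+ l != 0) || (y / c ^+ h != 0) by rewrite -!exprVn !mulf_eq0 !expf_eq0 !invr_eq0 (negPf c0) !andbF !orbF.
exists (preim (K + img ((x / c ^+ l) *: ua + (y / c ^+ h) *: ub))%VS).
  by apply/EP; exists (x / c ^+ l), (y / c ^+ h).
by rewrite (scale_pencil _ _ r0 pK) !divfK // expf_neq0.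
Qed.

Lemma img_scale m (u : 'M[C]_(n, m)) a : a != 0 -> img (a *: u) = img u.
Proof.
move=> a0; apply/vspaceP=> v; apply/idP/idP => /in_img[w ->]; apply/in_img.
  by exists (a *: w); rewrite -scalemxAl scalemxAr.
by exists (a^-1 *: w); rewrite -scalemxAl -scalemxAr scalerA mulfV // scale1r.
Qed.

(** The degrees are (7, 11), (7, 11) and (9, 9). *)
Lemma low_high_eq r : r \in [:: rho_2; rho_2'; rho_4] -> c ^+ lowdeg r = c ^+ highdeg r.
Proof.
have e : c ^+ 11 = c ^+ 7 by rewrite -[11%N]/(4 + 7)%N exprD c4 mul1r.
by case: r.
Qed.

Lemma fixed_curve r I : r \in [:: rho_2; rho_2'; rho_4] -> Ecurve rH (V r) I -> actc I = I.
Proof.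
move=> hr; have r0 : r != rho_0 by case: (r) hr.
have [K [ua [ub pK]]] := pencil_exists det_rH hV cm r0.
move=> /(Ecurve_pencil _ pK)[x [y [xy ->]]]; rewrite (scale_pencil _ _ r0 pK).
rewrite -low_high_eq // ![_ * c ^+ _]mulrC -!scalerA -scalerDr img_scale //.
by rewrite expf_neq0.
Qed.

(** The degrees are (6, 12) or (8, 10). *)
Lemma low_high_neq r : r \in [:: rho_1'; rho_2''; rho_3; rho_3'] -> c ^+ lowdeg r <> c ^+ highdeg r.
Proof.
have n11 : (1 : C) <> -1.
  by move=> /eqP; rewrite -subr_eq0 opprK -[1 + 1]/(2%:R) pnatr_eq0.
have e6 : c ^+ 6 = -1 by rewrite -[6%N]/(4 + 2)%N exprD c4 mul1r c2.
have e8 : c ^+ 8 = 1 by rewrite -[8%N]/(4 * 2)%N exprM c4 expr1n.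
have e10 : c ^+ 10 = -1 by rewrite -[10%N]/(8 + 2)%N exprD e8 mul1r c2.
have e12 : c ^+ 12 = 1 by rewrite -[12%N]/(4 * 3)%N exprM c4 expr1n.
by case: r => // _; rewrite /= ?e6 ?e8 /highdeg /= ?e10 ?e12 // => /esym.
Qed.

(** A diagonal matrix with two distinct entries fixes two points of the
    projective line. *)
Lemma fixed_points r K ua ub : r \in [:: rho_1'; rho_2''; rho_3; rho_3'] -> Epencil r K ua ub ->
  Ecurve rH (V r) `&` scalar_fixed = [set preim (K + img ua)%VS; preim (K + img ub)%VS].
Proof.
move=> hr pK; have r0 : r != rho_0 by case: (r) hr.
have EP I := Ecurve_pencil I pK.
have fixa : actc (preim (K + img ua)%VS) = preim (K + img ua)%VS.
  have := scale_pencil 1 0 r0 pK; rewrite mul0r mul1r !scale0r !addr0 scale1r => ->.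
  by rewrite img_scale // expf_neq0.
have fixb : actc (preim (K + img ub)%VS) = preim (K + img ub)%VS.
  have := scale_pencil 0 1 r0 pK; rewrite mul0r mul1r !scale0r !add0r scale1r => ->.
  by rewrite img_scale // expf_neq0.
apply/seteqP; split=> I.
  move=> [/EP[x [y [xy ->]]] [_ fI]].
  have [||x0|y0] := (pencil_fixed hV cm r0 pK c0 xy).1.
  - move=> v; have [f <-] := qm_surj qm v => fN.
    have : preim (K + img (x *: ua + y *: ub))%VS (act (c%:M : 'M[C]_2) f).
      by rewrite -fI; exists f.
    by rewrite /preim /= (p_scale det_rH hV inv8 inv12 qm).
  - by move=> e; case: (low_high_neq hr e).
  - by move: xy; rewrite x0 scale0r add0r eqxx /= => y0; right; rewrite img_scale.
  - by move: xy; rewrite y0 scale0r addr0 eqxx orbF => x0; left; rewrite img_scale.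
have Ea : Ecurve rH (V r) (preim (K + img ua)%VS) by apply/EcP; eexists; first exact: pencil_a pK.
have Eb : Ecurve rH (V r) (preim (K + img ub)%VS) by apply/EcP; eexists; first exact: pencil_b pK.
case=> ->; split; [exact: Ea| |exact: Eb|]; split; [by case: Ea|exact: fixa|by case: Eb|exact: fixb].
Qed.

Lemma fixed_distinct r K ua ub : Epencil r K ua ub ->
  preim (K + img ua)%VS <> preim (K + img ub)%VS.
Proof.
move=> pK /(preim_inj qm) e; apply: (pencil_ab hV pK) => v.
by rewrite e -[_ *m v]add0r memv_add ?mem0v //; apply/in_img; exists v.
Qed.

Local Notation isolated := (isolated_in #|H| (HHilb rH) scalar_fixed).

(** All the points of the curve are fixed, and every neighbourhood of one of
    them contains others. *)
Lemma fixed_curve_not_isolated r I : r \in [:: rho_2; rho_2'; rho_4] ->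
  Ecurve rH (V r) I -> ~ isolated I.
Proof.
move=> hr; have r0 : r != rho_0 by case: (r) hr.
have [K [ua [ub pK]]] := pencil_exists det_rH hV cm r0.
have EP I' := Ecurve_pencil I' pK.
move=> /EP[x0 [y0 [xy0 ->]]] [_ [U [UY openU] eU]].
set I0 := preim _ in eU; have [UI0 _] : (U `&` scalar_fixed) I0 by rewrite eU.
have [k [b [fs [D [hb hU]]]]] := openU _ UI0.
have [x1 [y1 [xy1 hb1 ne]]] := pencil_nbhs hV qm pK xy0 hb.
set I1 := preim _ in hb1 ne; have E1 : Ecurve rH (V r) I1 by apply/EP; exists x1, y1.
have exc1 : exceptional rH I1 by case: E1.
apply: ne; have : (U `&` scalar_fixed) I1; last by rewrite eU.
split; first by apply: hU; split=> //; case: exc1.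
by split=> //; apply: (fixed_curve hr E1).
Qed.

Lemma meet_not_isolated r K ua ub u a r' d : r != rho_0 -> Epencil r K ua ub ->
    r' \in [:: rho_2; rho_2'; rho_4] -> d != 17%N ->
    u = ua /\ a = lowdeg r \/ u = ub /\ a = highdeg r ->
    (nbr_sum (fun j => shift_degs r a j d.+1) r' < shift_degs r a r' d.+2 + shift_degs r a r' d)%N ->
  ~ isolated (preim (K + img u)%VS).
Proof.
move=> r0 pK hr' d17 hu lt; have r0' : r' != rho_0 by case: (r') hr'.
apply: (fixed_curve_not_isolated hr'); apply/EcP; exists (K + img u)%VS => //.
apply: (pencil_meet det_rH hV cm pK r0' d17 _ _ _ _ lt).
- by case: hu => -[-> _]; [exact: pencil_a pK|exact: pencil_b pK].
- by case: hu => -[-> _]; [exact: pencil_homa pK|exact: pencil_homb pK].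
- by case: hu => -[-> ->]; [exact: pencil_dega pK|exact: pencil_degb pK].
- by case: hu => -[-> _]; [exact: (pencil_na pK)|exact: (pencil_nb pK)].
Qed.

(** The point of degree 8 lies on E(rho_2) or E(rho_2'), that of degree 10 on
    E(rho_4). *)
Lemma isolated_E3 r : r \in [:: rho_3; rho_3'] -> Ecurve rH (V r) `&` isolated = set0.
Proof.
move=> hr; have r0 : r != rho_0 by case: (r) hr.
have [K [ua [ub pK]]] := pencil_exists det_rH hV cm r0.
have hr' : r \in [:: rho_1'; rho_2''; rho_3; rho_3'] by case: (r) hr.
apply/seteqP; split=> // I [EI isoI]; have [fI _] := isoI.
have : (Ecurve rH (V r) `&` scalar_fixed) I by [].
rewrite (fixed_points hr' pK) => -[eI|eI]; move: isoI; rewrite eI.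
  apply: (@meet_not_isolated r K ua ub ua (lowdeg r) (if r == rho_3 then rho_2 else rho_2') 9 r0 pK) => //.
  - by case: (r).
  - by left.
  - by case: (r) hr => // _; vm_compute.
apply: (@meet_not_isolated r K ua ub ub (highdeg r) rho_4 7 r0 pK) => //.
- by right.
- by case: (r) hr => // _; vm_compute.
Qed.

(** Let q be a lift of a nonzero vector of img ub. The other fixed points of
    E(r), and all the points of the other curves, contain img ub. So the
    ideals modulo which q is part of a given basis form a neighbourhood that
    contains no other fixed point; the basis need only be chosen for K + img
    ua, which does not contain q. *)
Lemma isolated_low r K ua ub : r \in [:: rho_1'; rho_2''] -> Epencil r K ua ub ->
  isolated (preim (K + img ua)%VS).
Proof.
move=> hr pK; have r0 : r != rho_0 by case: (r) hr.
have hr' : r \in [:: rho_1'; rho_2''; rho_3; rho_3'] by case: (r) hr.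
set I := preim _; have [EI fI] : (Ecurve rH (V r) `&` scalar_fixed) I.
  by rewrite (fixed_points hr' pK); left.
split=> //; have excI : exceptional rH I by case: EI.
have d0 : (0 < rdegree (V r))%N by rewrite (V_deg hV); case: (r).
have [q eq] := qm_surj qm (ub *m delta_mx (Ordinal d0) 0).
have nq : ~ I q.
  have [[[sN _ _] _] _] := pencil_a pK.
  rewrite /I /preim /= eq => /(irr_inj (V_irr hV r) (pencil_homb pK) sN (pencil_ab hV pK)).
  by move=> /matrixP/(_ (Ordinal d0) 0); rewrite !mxE !eqxx => /eqP; rewrite oner_eq0.
have [[_ [pi [spi kpi _]]] _] := excI.
have [b [hb [k bk]]] := extend_basis spi kpi nq.
(* the open set is the whole chart of b *)
pose fs (i : 'I_0) : S := 0.
have open_in J : is_basis_mod b J -> basic_open b fs 1 J.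
  move=> hJ; split=> //; exists 0; first by case.
  by rewrite meval1 oner_eq0.
exists (basic_open b fs 1 `&` HHilb rH).
  split=> [J []//|J [hJ _]].
  by exists 0%N, b, fs, 1; split.
apply/seteqP; split=> [J [[[hJ _] _] [excJ fJ]]|_ ->]; last first.
  by split=> //; split; [exact: open_in|case: excI].
have [N excN eJ] := exc_of det_rH hV inv8 inv12 qm excJ.
have idJ : is_ideal J by case: excJ => [[[]]].
have nJ : ~ into N ub.
  move=> iN; apply: (basis_notin idJ hJ (k := k)); rewrite bk eJ /preim /= eq.
  exact: iN.
have [i i0 hi] := exc_top hV cm excN.
have [ri|ri] := eqVneq r i; last first.
  by case: nJ; exact: (high_in_other det_rH hV cm hr pK i0 ri hi).
have : (Ecurve rH (V r) `&` scalar_fixed) J by split=> //; apply/EcP; exists N; rewrite ?ri.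
rewrite (fixed_points hr' pK) => -[//|e]; case: nJ.
have -> : N = (K + img ub)%VS by apply: (preim_inj qm); rewrite -eJ.
by move=> v; rewrite -[_ *m v]add0r memv_add ?mem0v //; apply/in_img; exists v.
Qed.

(** The point K + img ub lies on E(rho_2') if r is rho_1', on E(rho_4) if r is
    rho_2''. *)
Theorem isolated_points r K ua ub : r \in [:: rho_1'; rho_2''] -> Epencil r K ua ub ->
  Ecurve rH (V r) `&` isolated = [set preim (K + img ua)%VS].
Proof.
move=> hr pK; have r0 : r != rho_0 by case: (r) hr.
have hr' : r \in [:: rho_1'; rho_2''; rho_3; rho_3'] by case: (r) hr.
apply/seteqP; split=> I.
  move=> [EI isoI]; have [fI _] := isoI.
  have : (Ecurve rH (V r) `&` scalar_fixed) I by [].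
  rewrite (fixed_points hr' pK) => -[//|eI]; exfalso; move: isoI; rewrite eI.
  apply: (@meet_not_isolated r K ua ub ub (highdeg r) (if r == rho_1' then rho_2' else rho_4)
    (if r == rho_1' then 5 else 7)%N r0 pK).
  - by case: (r) hr.
  - by case: (r) hr.
  - by right.
  - by case: (r) hr => // _; vm_compute.
move=> ->; split; last exact: isolated_low pK.
by apply/EcP; eexists; first exact: pencil_a pK.
Qed.

Lemma submodule_gen_preim (A : set S) U : stab Q U -> (forall a, A a -> p a \in U) ->
    (forall W, stab Q W -> (forall a, A a -> p a \in W) -> (U <= W)%VS) ->
  submodule_gen rH A = preim U.
Proof.
move=> sU AU minU; apply/seteqP; split=> f.
  apply; split.
    split; rewrite /preim /=.
    - by rewrite linear0 mem0v.
    - by move=> a b; rewrite linearD; apply: memvD.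
    - by move=> a b; rewrite linearZ; apply: memvZ.
    - by move=> h a Hh aU; rewrite (qm_act qm) //; apply: sU.
  by move=> a [|/AU//]; rewrite nE => ka; exact: (klein_preim qm).
move=> fU Z [[Z0 ZD ZZ ZH] Zg]; pose W := proj_image p Z.
have inW v : (v \in W) <-> exists2 z, Z z & p z = v by exact: in_proj_image.
have sW : stab Q W.
  move=> h _ Hh /inW[z Zz <-]; apply/inW; exists (act (rH h) z); first exact: ZH.
  by rewrite (qm_act qm).
have AW a : A a -> p a \in W by move=> Aa; apply/inW; exists a => //; apply: Zg; right.
have /inW[z Zz /esym/(qm_eq qm) k] := subvP (minU W sW AW) _ fU.
by rewrite -[f](subrK z); apply: (ZD _ _) => //; apply: Zg; left; rewrite nE.
Qed.

Lemma degree_partE d : (0 < d)%N -> degree_part rH d = preim (degpart P M d).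
Proof.
move=> d0; apply/seteqP; split=> f.
  move=> [g [_ hg] [k nk <-]]; rewrite nE in nk; rewrite /preim /=.
  rewrite linearD /= ((qm_ker qm k).2 nk) addr0.
  have e : p g = P d *m p g by rewrite -(qm_P qm) pihomog_dE.
  apply/in_deg; rewrite -e; split=> //; apply/in_aug; rewrite e mulmxA (qm_PP qm).
  by case: eqP d0 => [<-|]; rewrite ?mul0mx.
move=> /in_deg[_ e]; exists (pihomog mdeg d f).
  split; last exact: pihomogP.
  by rewrite maxidealE => -[|//] _; rewrite hpartK; case: eqP d0 => [<-|].
exists (f - pihomog mdeg d f); last by rewrite addrC subrK.
by rewrite nE; apply/(qm_eq qm); rewrite (qm_P qm) e.
Qed.

Lemma coinv_low r : r \in [:: rho_1'; rho_2''] -> coinv_mult r (lowdeg r) = 1%N.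
Proof. by case: r. Qed.

Lemma ua_low r K ua ub : Epencil r K ua ub -> ua \in HomTo Q (V r) (degpart P M (lowdeg r)).
Proof.
move=> pK; apply/HomTo_deg; split; last exact: pencil_dega pK.
have [[[_ KM _] _] _] := pencil_a pK.
apply/in_HomTo; split; first exact: pencil_homa pK.
by apply/img_into; apply: subv_trans KM; apply: addvSr.
Qed.

Lemma ua_neq0 r K ua ub : Epencil r K ua ub -> ua <> 0.
Proof. by move=> pK e; apply: (pencil_na pK) => v; rewrite e mul0mx mem0v. Qed.

Lemma low_line r K ua ub u : r \in [:: rho_1'; rho_2''] -> Epencil r K ua ub ->
  u \in HomTo Q (V r) (degpart P M (lowdeg r)) -> exists s, u = s *: ua.
Proof.
move=> hr pK hu; have r0 : r != rho_0 by case: (r) hr.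
have : u \in <[ua]>%VS.
  suff -> : <[ua]>%VS = HomTo Q (V r) (degpart P M (lowdeg r)) by [].
  apply/eqP; rewrite eqEdim -memvE (ua_low pK) /= -/(mult _ _ _).
  by rewrite (cm_multM cm _ r0) coinv_low // dim_vline; case: eqP (ua_neq0 pK).
by move/vlineP.
Qed.

(** In degree lowdeg r there is only one copy of V r. *)
Lemma Vdeg_low r K ua ub : r \in [:: rho_1'; rho_2''] -> Epencil r K ua ub ->
  Vdeg rH (lowdeg r) (V r) = preim (img ua).
Proof.
move=> hr pK; have l0 : (0 < lowdeg r)%N by case: (r) hr.
have nP : invariant_ideal rH = preim 0%VS.
  rewrite nE; apply/seteqP; split=> f; rewrite /preim /= memv0.
    by move=> /(qm_ker qm) ->.
  by move=> /eqP/(qm_ker qm).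
apply: submodule_gen_preim; first exact: stab_img (pencil_homa pK).
  move=> _ [u [v [[iu hu _] ->]]]; pose B := colmx (p \o u).
  have eB w : B *m w = p (u w) by rewrite colmxE.
  have hB : B \in HomTo Q (V r) (degpart P M (lowdeg r)).
    apply/in_HomTo; split=> [h Hh|w]; last first.
      by rewrite eB; have := iu w; rewrite degree_partE.
    apply: eq_colmx => w; rewrite -!mulmxA !eB -(qm_act qm) //.
    by apply/esym/(qm_eq qm); have := hu h w Hh; rewrite nE.
  have [s e] := low_line hr pK hB; rewrite -eB e; apply/in_img; exists (s *: v).
  by rewrite -scalemxAl scalemxAr.
move=> W sW AW; apply/subvP=> _ /in_img[v ->].
have [a ea] := lift_lin qm ua; rewrite -ea; apply: AW; exists a, v; split=> //.
have ha := pencil_homa pK; rewrite degree_partE // nP.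
split=> [w|h w Hh|w]; rewrite /preim /=.
- by rewrite ea; have /in_HomTo[_] := ua_low pK; apply.
- by rewrite linearB (qm_act qm) //= !ea mulmxA -ha // mulmxA subrr mem0v.
rewrite ea; apply: (irr_inj (V_irr hV r) ha (@stab0 _ _ _ _ Q)).
by move=> i0; apply: (ua_neq0 pK); apply: eq_colmx => z; rewrite mul0mx; apply/eqP; rewrite -memv0.
Qed.

Lemma point_low r K ua ub : r \in [:: rho_1'; rho_2''] -> Epencil r K ua ub ->
  point_of rH (preim (img ua)) = preim (K + img ua)%VS.
Proof.
move=> hr pK; have [[[_ KM mN] _] _] := pencil_a pK.
apply/seteqP; split=> f.
  apply; split; first exact: (preim_ideal qm).
  move=> g [|gU]; first by rewrite nE => ka; exact: (klein_preim qm).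
  by rewrite /preim /= -[p g]add0r memv_add ?mem0v.
move=> fN J [idJ Jg]; have [J0 JD JM] := idJ; have [_ _ JZ _ _] := ideal_sub idJ.
pose W := proj_image p J.
have inW v : (v \in W) <-> exists2 z, J z & p z = v by exact: in_proj_image.
have mW : (mulV X Y W <= W)%VS.
  apply/subvP=> _ /in_mulV[_ [_ [/inW[a Ja <-] /inW[b Jb <-] ->]]].
  apply/inW; exists ('X_0 * a + 'X_1 * b); first by apply: (JD _ _); apply: JM.
  by rewrite linearD /= (qm_X qm) (qm_Y qm).
have iW : into W ua.
  move=> v; have [g eg] := qm_surj qm (ua *m v); rewrite -eg; apply/inW; exists g => //.
  by apply: Jg; right; rewrite /preim /= eg; apply/in_img; exists v.
have /inW[z Jz /esym/(qm_eq qm) k] := subvP (low_generates det_rH hV cm hr pK mW iW) _ fN.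
by rewrite -[f](subrK z); apply: (JD _ _) => //; apply: Jg; left; rewrite nE.
Qed.

(** In degree lowdeg r every irreducible constituent of m/n other than V r has
    a larger dimension than V r; here these are V rho_3 and V rho_3'. *)
Lemma low_submodule r K ua ub U : r \in [:: rho_1'; rho_2''] -> Epencil r K ua ub ->
    stab Q U -> (U <= degpart P M (lowdeg r))%VS -> U <> 0%VS -> (\dim U <= E7dim r)%N ->
  U = img ua.
Proof.
move=> hr pK sU Ul U0 dU; have [i /mult_pos[u [hu iu u0]]] := V_exists hV sU U0.
have inj (v : 'cV[C]_(rdegree (V i))) : u *m v \in 0%VS -> v = 0.
  apply: (irr_inj (V_irr hV i) hu (@stab0 _ _ _ _ Q)) => iu0; apply: u0.
  by apply: eq_colmx => z; rewrite mul0mx; apply/eqP; rewrite -memv0.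
have dimu : \dim (img u) = E7dim i.
  rewrite /img limg_dim_eq ?dimvf /dim /=; first by rewrite muln1 (V_deg hV).
  apply/eqP; rewrite -subv0; apply/subvP=> v /memv_capP[_]; rewrite memv_ker lfunE /=.
  by move=> /eqP e; rewrite memv0; apply/eqP/inj; rewrite memv0 e.
have uU : (img u <= U)%VS by apply/img_into.
have le : (E7dim i <= E7dim r)%N by rewrite -dimu; apply: leq_trans dU; apply: dimvS.
have uM : u \in HomTo Q (V i) (degpart P M (lowdeg r)).
  by apply/in_HomTo; split=> // v; apply: (subvP Ul).
have ir : i = r.
  have i0 : i != rho_0.
    apply: contra_notN u0 => /eqP i0; apply/eqP; rewrite -memv0.
    have /eqP : mult Q (V rho_0) M = 0%N := cm_mult0M cm.
    rewrite dimv_eq0 -i0 => /eqP <-; apply: subvP uM; apply: HomToS.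
    by apply/subvP=> v /in_deg[].
  have : (0 < coinv_mult i (lowdeg r))%N.
    rewrite -(cm_multM cm _ i0) /mult lt0n dimv_eq0; apply: contra_notN u0 => /eqP e.
    by apply/eqP; rewrite -memv0 -e.
  by case: (r) hr le => // _; case: (i) i0.
subst i; have [s e] := low_line hr pK uM.
have s0 : s != 0 by apply: contra_notN u0 => /eqP s0; rewrite e s0 scale0r.
rewrite -(img_scale ua s0) -e; apply/eqP; rewrite eq_sym eqEdim uU dimu; exact: dU.
Qed.

Lemma low_gen r K ua ub (A : set S) U : r \in [:: rho_1'; rho_2''] -> Epencil r K ua ub ->
    stab Q U -> (U <= degpart P M (lowdeg r))%VS -> U <> 0%VS -> (\dim U <= E7dim r)%N ->
    (forall a, A a -> p a \in U) ->
    (forall W : {vspace 'cV[C]_n}, (forall a, A a -> p a \in W) -> (U <= W)%VS) ->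
  Vdeg rH (lowdeg r) (V r) = submodule_gen rH A.
Proof.
move=> hr pK sU Ul U0 dU AU minU; rewrite (Vdeg_low hr pK).
rewrite -(low_submodule hr pK sU Ul U0 dU); apply/esym/submodule_gen_preim => //.
by move=> W _; apply: minU.
Qed.

End Fixed.

(** * The semi-invariants of the generators *)

Section Polynomials.
Variable C : numClosedFieldType.
Local Notation S := {mpoly C[2]}.
Local Notation x := ('X_(0 : 'I_2) : S).
Local Notation y := ('X_(1 : 'I_2) : S).
Variables rt eps omega : C.
Hypothesis rt2 : 2%:R * rt ^+ 2 = 1.
Hypothesis epsilon4 : eps ^+ 4 = -1.
Hypothesis omega_eq : omega ^+ 2 + omega + 1 = 0.
Local Notation om := (omega%:MP_[2] : S).
Local Notation r := (rt%:MP_[2] : S).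
Local Notation e := (eps%:MP_[2] : S).

(** The polynomials phi and psi are the values at omega and omega^2. *)
Definition quartic (k : C) : S := (x ^+ 2 + y ^+ 2) ^+ 2 + (4 * k) *: (x ^+ 2 * y ^+ 2).
Definition sextic : S := x ^+ 5 * y - x * y ^+ 5.
Local Notation T := sextic.
Local Notation phi := (quartic omega).
Local Notation psi := (quartic (omega ^+ 2)).

Definition mat2 (a b c d : C) : 'M[C]_2 :=
  \matrix_(i, j) if i == 0 then (if j == 0 then a else b)
                 else (if j == 0 then c else d).
Local Notation ms := (mat2 1 0 0 (-1)).
Local Notation mt := (rt *: mat2 1 (-1) (-1) (-1)).
Local Notation mu := (mat2 0 eps (eps ^+ 7) 0).

Lemma mat2E (a b c d a' b' c' d' : C) :
  mat2 a b c d *m mat2 a' b' c' d' =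
  mat2 (a * a' + b * c') (a * b' + b * d') (c * a' + d * c') (c * b' + d * d').
Proof.
apply/matrixP=> i j; rewrite !mxE !big_ord_recl big_ord0 addr0 !mxE /=.
by case: (ord2 i) => ->; case: (ord2 j) => ->.
Qed.

Lemma mat2_scale (k a b c d : C) : k *: mat2 a b c d = mat2 (k * a) (k * b) (k * c) (k * d).
Proof. by apply/matrixP=> i j; rewrite !mxE; do 2!case: ifP. Qed.

Lemma mat2_scalar (a : C) : mat2 a 0 0 a = a%:M.
Proof.
by apply/matrixP=> i j; rewrite !mxE; case: (ord2 i) => ->; case: (ord2 j) => ->; rewrite /= ?mulr1n ?mulr0n.
Qed.

(** The matrix m has trace c = a - b and determinant -1, and c^2 = -1; by the
    Cayley-Hamilton theorem m^3 = m (c m + 1) = c. *)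
Lemma stu_cube (a b : C) : 2%:R * (a * b) = 1 -> a ^+ 2 + b ^+ 2 = 0 ->
  let m := mat2 (- b) a b a in m *m m *m m = (a - b)%:M.
Proof.
move=> ab aabb m; rewrite /m !mat2E -mat2_scalar; congr mat2.
- transitivity (a - b + (2%:R * (a * b) - 1) * (a - b) - b * (a ^+ 2 + b ^+ 2)); first by ring.
  by rewrite ab aabb; ring.
- transitivity (a * (a ^+ 2 + b ^+ 2)); first by ring.
  by rewrite aabb mulr0.
- transitivity (b * (a ^+ 2 + b ^+ 2)); first by ring.
  by rewrite aabb mulr0.
transitivity (a - b + (2%:R * (a * b) - 1) * (a - b) + a * (a ^+ 2 + b ^+ 2)); first by ring.
by rewrite ab aabb; ring.
Qed.

Lemma act_exp (g : 'M[C]_2) (f : S) k : act g (f ^+ k) = act g f ^+ k.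
Proof. by elim: k => [|k IH]; rewrite ?exprS ?actM ?IH // /act comp_mpoly1. Qed.

Lemma act_const (g : 'M[C]_2) (a : C) : act g (a%:MP) = a%:MP.
Proof. by rewrite /act comp_mpolyC. Qed.

Lemma act_nat (g : 'M[C]_2) k : act g (k%:R : S) = k%:R.
Proof. by elim: k => [|k IH]; rewrite ?act0 // -natr1 actD IH /act comp_mpoly1. Qed.

Lemma act_x (a b c d : C) : act (mat2 a b c d) x = a%:MP * x + c%:MP * y.
Proof.
rewrite actX !big_ord_recl big_ord0 addr0 !mxE /= !mul_mpolyC.
by congr (_ + _ *: 'X_ _); apply: val_inj.
Qed.

Lemma act_y (a b c d : C) : act (mat2 a b c d) y = b%:MP * x + d%:MP * y.
Proof.
rewrite actX !big_ord_recl big_ord0 addr0 !mxE /= !mul_mpolyC.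
by congr (_ + _ *: 'X_ _); apply: val_inj.
Qed.

Lemma quarticE k : quartic k = (x ^+ 2 + y ^+ 2) ^+ 2 + 4%:R * k%:MP * (x ^+ 2 * y ^+ 2).
Proof. by rewrite /quartic -mul_mpolyC rmorphM /= rmorph_nat. Qed.

Lemma om2 : om ^+ 2 = - om - 1.
Proof.
have := congr1 (@mpolyC 2 C) (omega_eq); rewrite !rmorphD rmorphXn rmorph1 rmorph0 /= => h.
by transitivity (om ^+ 2 + om + 1 - om - 1); [ring|rewrite h; ring].
Qed.

Lemma act_opp (g : 'M[C]_2) (f : S) : act g (- f) = - act g f.
Proof. by rewrite -scaleN1r actZ scaleN1r. Qed.

Lemma act_f8 g : act g (f8 C) =
  act g x ^+ 8 + 14%:R * (act g x ^+ 4 * act g y ^+ 4) + act g y ^+ 8.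
Proof.
rewrite /f8 actD; congr (_ + _); last exact: act_exp.
rewrite actD; congr (_ + _); first exact: act_exp.
rewrite actM; congr (_ * _); first exact: act_nat.
rewrite actM; congr (_ * _); exact: act_exp.
Qed.

Lemma act_sextic g : act g T = act g x ^+ 5 * act g y - act g x * act g y ^+ 5.
Proof.
rewrite /sextic actD act_opp.
congr (_ - _); rewrite actM; congr (_ * _); exact: act_exp.
Qed.

Lemma act_quartic g k : act g (quartic k) =
  (act g x ^+ 2 + act g y ^+ 2) ^+ 2 + 4%:R * k%:MP * (act g x ^+ 2 * act g y ^+ 2).
Proof.
rewrite quarticE actD; congr (_ + _).
  rewrite act_exp actD; congr ((_ + _) ^+ _); exact: act_exp.
rewrite actM; congr (_ * _); last by rewrite actM; congr (_ * _); exact: act_exp.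
by rewrite actM act_const; congr (_ * _); exact: act_nat.
Qed.

Lemma sx : act ms x = x. Proof. by rewrite act_x mpolyC1 mpolyC0; ring. Qed.
Lemma sy : act ms y = - y. Proof. by rewrite act_y mpolyCN mpolyC1 mpolyC0; ring. Qed.
Lemma tx : act mt x = r * (x - y).
Proof. by rewrite mat2_scale act_x mulr1 mulrN1 mpolyCN; ring. Qed.
Lemma ty : act mt y = - (r * (x + y)).
Proof. by rewrite mat2_scale act_y mulrN1 mpolyCN; ring. Qed.
Lemma ux : act mu x = e ^+ 7 * y.
Proof. by rewrite act_x mpolyC0 rmorphXn /=; ring. Qed.
Lemma uy : act mu y = e * x.
Proof. by rewrite act_y mpolyC0; ring. Qed.

Lemma r2 : 2%:R * r ^+ 2 = 1.
Proof. by rewrite -(rmorph_nat (@mpolyC 2 C)) -rmorphXn -rmorphM /= rt2 mpolyC1. Qed.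
Lemma e4 : e ^+ 4 = -1.
Proof. by rewrite -rmorphXn /= epsilon4 mpolyCN mpolyC1. Qed.

Lemma gen_f8 m : [\/ m = ms, m = mt | m = mu] -> act m (f8 C) = f8 C.
Proof.
rewrite act_f8 => -[] ->; rewrite ?sx ?sy ?tx ?ty ?ux ?uy.
- by rewrite /f8; ring.
- set w := f8 C; transitivity ((2%:R * r ^+ 2) ^+ 4 * w); last by rewrite r2 expr1n mul1r.
  by rewrite /w /f8; ring.
transitivity ((e ^+ 4) ^+ 14 * y ^+ 8 + 14%:R * (e ^+ 4) ^+ 8 * (x ^+ 4 * y ^+ 4) + (e ^+ 4) ^+ 2 * x ^+ 8).
  by ring.
by rewrite e4 /f8; ring.
Qed.

Lemma gen_sextic m : [\/ m = ms, m = mt | m = mu] -> act m T = T \/ act m T = - T.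
Proof.
rewrite act_sextic => -[] ->; rewrite ?sx ?sy ?tx ?ty ?ux ?uy /sextic.
- by right; ring.
- left; transitivity ((2%:R * r ^+ 2) ^+ 3 * T); last by rewrite r2 expr1n mul1r.
  by rewrite /sextic; ring.
left; transitivity ((e ^+ 4) ^+ 9 * (y ^+ 5 * x) - (e ^+ 4) ^+ 3 * (y * x ^+ 5)); first by ring.
by rewrite e4; ring.
Qed.

(** Each generator fixes or exchanges phi and psi up to scalars, because 1 +
    omega = - omega^2. *)
Lemma gen_span m : [\/ m = ms, m = mt | m = mu] ->
  (act m psi = psi /\ act m phi = phi) \/
  exists a b, act m psi = a%:MP * phi /\ act m phi = b%:MP * psi.
Proof.
rewrite !act_quartic !quarticE rmorphXn /= => -[] ->; [left|right|right].
- by rewrite sx sy; split; ring.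
- exists (- omega), (- (omega) ^+ 2).
  rewrite !mpolyCN rmorphXn /= !tx !ty.
  have ht : (r * (x - y)) ^+ 2 + (- (r * (x + y))) ^+ 2 = x ^+ 2 + y ^+ 2.
    transitivity (2%:R * r ^+ 2 * (x ^+ 2 + y ^+ 2)); first by ring.
    by rewrite r2 mul1r.
  have hp k : 4%:R * k * ((r * (x - y)) ^+ 2 * (- (r * (x + y))) ^+ 2) = k * (x ^+ 2 - y ^+ 2) ^+ 2.
    transitivity ((2%:R * r ^+ 2) ^+ 2 * k * (x ^+ 2 - y ^+ 2) ^+ 2); first by ring.
    by rewrite r2 expr1n mul1r.
  rewrite !ht !hp; set A := x ^+ 2; set B := y ^+ 2.
  split; apply/eqP; rewrite -subr_eq0; apply/eqP.
    transitivity ((om ^+ 2 + om + 1) * (A + B) ^+ 2); first by ring.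
    by rewrite om2; ring.
  transitivity ((om ^+ 2 + om + 1) * ((A + B) ^+ 2 + 4%:R * (A * B) * om * (om - 1))).
    by ring.
  by rewrite om2; ring.
exists (-1), (-1); rewrite mpolyCN mpolyC1 !ux !uy.
have hu : ((e ^+ 7 * y) ^+ 2 + (e * x) ^+ 2) ^+ 2 = - (x ^+ 2 - y ^+ 2) ^+ 2.
  transitivity (e ^+ 4 * ((e ^+ 4) ^+ 3 * y ^+ 2 + x ^+ 2) ^+ 2); first by ring.
  by rewrite e4; ring.
have hp : (e ^+ 7 * y) ^+ 2 * (e * x) ^+ 2 = x ^+ 2 * y ^+ 2.
  transitivity ((e ^+ 4) ^+ 4 * (x ^+ 2 * y ^+ 2)); first by ring.
  by rewrite e4; ring.
rewrite hu hp; set A := x ^+ 2; set B := y ^+ 2.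
split; apply/eqP; rewrite -subr_eq0; apply/eqP.
  by transitivity (4%:R * (A * B) * (om ^+ 2 + om + 1)); [ring|rewrite om2; ring].
by transitivity (4%:R * (A * B) * (om ^+ 2 + om + 1)); [ring|rewrite om2; ring].
Qed.

Lemma sextic_hom : T \is 6.-homog.
Proof.
by rewrite /sextic rpredB //; [apply: (dhomogM (homXn _ 0 5) (homX _ 1))|apply: (dhomogM (homX _ 0) (homXn _ 1 5))].
Qed.

Lemma quartic_hom k : quartic k ^+ 2 \is 8.-homog.
Proof.
have h2 : x ^+ 2 + y ^+ 2 \is 2.-homog by rewrite rpredD // homXn.
have h4 : quartic k \is 4.-homog.
  rewrite /quartic rpredD ?rpredZ //; first exact: (dhomogM h2 h2).
  exact: (dhomogM (homXn _ 0 2) (homXn _ 1 2)).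
exact: (dhomogM h4 h4).
Qed.

(** The ideal n has only multiples of f8 in degree 8, and psi^2 and f8 have
    the same value at (1, 0) but different values at (1, 1). *)
Lemma psi_notin : ~ klein_ideal (psi ^+ 2).
Proof.
move=> /(klein_homog (isT : (8 < 18)%N))[a [b]].
rewrite pihomog_dE ?quartic_hom // /hsub /= subnn mulr0 addr0.
rewrite (deg0_const (f := pihomog mdeg 0 a)); last by rewrite hpartK eqxx.
set k := _@_0%MM => ef.
pose ev (v w : C) (i : 'I_2) := if i == 0 then v else w.
have evn v w k' : (k'%:R : S).@[ev v w] = k'%:R.
  by elim: k' => [|k' IH]; rewrite ?raddf0 // -natr1 mevalD IH meval1 natr1.
have evf v w : (psi ^+ 2).@[ev v w] = ((v ^+ 2 + w ^+ 2) ^+ 2 + 4%:R * omega ^+ 2 * (v ^+ 2 * w ^+ 2)) ^+ 2.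
  rewrite quarticE rmorphXn; congr (_ ^+ _); rewrite [LHS]mevalD; congr (_ + _).
    rewrite rmorphXn; congr (_ ^+ _); rewrite [LHS]mevalD.
    by congr (_ + _); rewrite rmorphXn /= mevalXU.
  rewrite [LHS]mevalM; congr (_ * _); first by rewrite [LHS]mevalM mevalC evn.
  by rewrite [LHS]mevalM; congr (_ * _); rewrite rmorphXn /= mevalXU.
have ev8 v w : (f8 C).@[ev v w] = v ^+ 8 + 14%:R * (v ^+ 4 * w ^+ 4) + w ^+ 8.
  rewrite /f8 mevalD; congr (_ + _); last by rewrite rmorphXn /= mevalXU.
  rewrite [LHS]mevalD; congr (_ + _); first by rewrite rmorphXn /= mevalXU.
  rewrite [LHS]mevalM evn; congr (_ * _).
  by rewrite [LHS]mevalM; congr (_ * _); rewrite rmorphXn /= mevalXU.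
have evk v w : (f8 C * (k *: 1)).@[ev v w] = k * (f8 C).@[ev v w].
  by rewrite mevalM mevalZ meval1 mulr1 mulrC.
have := congr1 (meval (ev 1 0)) ef; rewrite evk evf ev8.
rewrite !expr1n !expr0n /= !mulr0 !addr0 !expr1n mulr1 => k1.
have := congr1 (meval (ev 1 1)) ef; rewrite evk evf ev8 -k1 !expr1n !mulr1 mul1r.
move=> eq; have w1 : omega ^+ 2 = 1.
  have n16 : 16%:R != 0 :> C by rewrite pnatr_eq0.
  apply: (mulfI n16); rewrite mulr1.
  transitivity (((1 + 1) ^+ 2 + 4%:R * omega ^+ 2) ^+ 2 + 16%:R * omega ^+ 2
     - 16%:R * (omega ^+ 2 + 1 - omega) * (omega ^+ 2 + omega + 1) - 16%:R * omega ^+ 2).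
    by ring.
  by rewrite eq omega_eq; ring.
have w2 : omega = - 2%:R.
  by have := omega_eq; rewrite w1 => e; apply/eqP; rewrite -subr_eq0 opprK -e; apply/eqP; ring.
have /eqP : 3%:R = 0 :> C.
  transitivity (omega ^+ 2 - 1); last by rewrite w1 subrr.
  by rewrite w2; ring.
by rewrite pnatr_eq0.
Qed.

End Polynomials.

(** * The group generated by the three reflections *)

Section Group.
Variables (C : numClosedFieldType) (gT : finGroupType) (G : {group gT}).
Variable rG : mx_representation C G 2.
Local Notation S := {mpoly C[2]}.
Variables rt eps omega : C.
Hypothesis rt2 : 2%:R * rt ^+ 2 = 1.
Hypothesis epsilon4 : eps ^+ 4 = -1.
Hypothesis omega_eq : omega ^+ 2 + omega + 1 = 0.
Variables s t u : gT.
Hypothesis defG : G :=: <<[set s; t; u]%SET>>%g.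
Local Notation ms := (mat2 1 0 0 (-1)).
Local Notation mt := (rt *: mat2 1 (-1) (-1) (-1)).
Local Notation mu := (mat2 0 eps (eps ^+ 7) 0).
Hypothesis rGs : rG s = ms.
Hypothesis rGt : rG t = mt.
Hypothesis rGu : rG u = mu.
Local Notation H := (SLpart_group rG).
Local Notation rH := (SLrepr rG).

(** A square root of -1. *)
Definition ci : C := rt * eps - rt * eps ^+ 7.

Lemma rt_eps : 2%:R * ((rt * eps) * (rt * eps ^+ 7)) = 1.
Proof.
have -> : 2%:R * ((rt * eps) * (rt * eps ^+ 7)) =
  (2%:R * rt ^+ 2) * (eps ^+ 4) ^+ 2 by ring.
by rewrite rt2 epsilon4 sqrrN expr1n mulr1.
Qed.

Lemma rt_eps2 : (rt * eps) ^+ 2 + (rt * eps ^+ 7) ^+ 2 = 0.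
Proof.
have -> : (rt * eps) ^+ 2 + (rt * eps ^+ 7) ^+ 2 =
  rt ^+ 2 * eps ^+ 2 * (1 + (eps ^+ 4) ^+ 3) by ring.
by rewrite epsilon4 -signr_odd /= expr1 subrr mulr0.
Qed.

Lemma ci2 : ci ^+ 2 = -1.
Proof.
rewrite /ci; set a := rt * _; set b := rt * _.
have -> : (a - b) ^+ 2 = a ^+ 2 + b ^+ 2 - 2%:R * (a * b) by ring.
by rewrite rt_eps2 rt_eps sub0r.
Qed.

Lemma gens_in : [/\ s \in G, t \in G & u \in G].
Proof. by rewrite defG; split; apply: mem_gen; rewrite !inE eqxx ?orbT. Qed.

Lemma G_ind (Pm : 'M[C]_2 -> Prop) : Pm 1%:M ->
    (forall A B, Pm A -> Pm B -> Pm (A *m B)) ->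
    (forall m, [\/ m = ms, m = mt | m = mu] -> Pm m) ->
  forall g, g \in G -> Pm (rG g).
Proof.
move=> P1 PM Pgen; pose A := [set g in G | `[<Pm (rG g)>]]%SET.
have [sG tG uG] := gens_in.
have gA : group_set A.
  apply/group_setP; split=> [|g h].
    by rewrite inE group1 /=; apply/asboolP; rewrite repr_mx1.
  rewrite !inE => /andP[Gg /asboolP Pg] /andP[Gh /asboolP Ph].
  by rewrite groupM //=; apply/asboolP; rewrite repr_mxM //; apply: PM.
have /fintype.subsetP sub : G \subset Group gA.
  rewrite {1}defG gen_subG; apply/fintype.subsetP=> g.
  rewrite !inE => /orP[/orP[]|] /eqP ->; rewrite ?sG ?tG ?uG; apply/asboolP/Pgen.
  - exact: Or31.
  - exact: Or32.
  - exact: Or33.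
by move=> g /sub; rewrite inE => /andP[_ /asboolP].
Qed.

Lemma det_G g : g \in G -> \det (rG g) = 1 \/ \det (rG g) = -1.
Proof.
apply: (G_ind (Pm := fun A => \det A = 1 \/ \det A = -1)); first by left; rewrite det1.
  by move=> A B [eA|eA] [eB|eB]; rewrite det_mulmx eA eB ?mulrNN ?mulr1 ?mul1r; [left|right|right|left].
move=> m [] ->; right; rewrite det2 !mxE /=; first by ring.
  by transitivity (- (2%:R * rt ^+ 2)); [ring|rewrite rt2].
by transitivity (- (eps ^+ 4) ^+ 2); [ring|rewrite epsilon4; ring].
Qed.

(** A generator of the centre of G, acting by a scalar matrix. *)
Definition scalar_elt := ((s * t * u) * (s * t * u) * (s * t * u))%g.

Lemma scalar_elt_in : scalar_elt \in G.
Proof. by have [sG tG uG] := gens_in; rewrite !groupM. Qed.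

Lemma rG_scalar_elt : rG scalar_elt = ci%:M.
Proof.
have [sG tG uG] := gens_in; have stG : (s * t)%g \in G by apply: groupM.
have stuG : (s * t * u)%g \in G by apply: groupM.
have e : rG (s * t * u)%g = mat2 (- (rt * eps ^+ 7)) (rt * eps) (rt * eps ^+ 7) (rt * eps).
  rewrite !repr_mxM // rGs rGt rGu mat2_scale !mat2E; congr mat2; ring.
rewrite /scalar_elt; move: (s * t * u)%g stuG e => w wG e.
rewrite !repr_mxM ?groupM // e; apply: stu_cube; last exact: rt_eps2.
exact: rt_eps.
Qed.

Lemma in_H g : (g \in H) = (g \in G) && (\det (rG g) == 1).
Proof. by rewrite inE. Qed.

Lemma H_G h : h \in H -> h \in G.
Proof. by rewrite in_H => /andP[]. Qed.

Lemma det_H h : h \in H -> \det (rH h) = 1.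
Proof. by rewrite in_H => /andP[_ /eqP]. Qed.

Lemma det_scalar_elt : \det (rG scalar_elt) = -1.
Proof. by rewrite rG_scalar_elt det_scalar ci2. Qed.

(** G is the union of H and its coset by the scalar matrix, as all
    determinants are 1 or -1 and that of the scalar matrix is -1. *)
Lemma act_G g I : g \in G -> H_invariant_ideal rH I ->
  act_ideal (rG g) I = if \det (rG g) == 1 then I else act_ideal ci%:M I.
Proof.
move=> Gg [_ HI]; case: ifP => [/eqP dg|/eqP ndg].
  by apply: (HI g); rewrite in_H Gg dg eqxx.
have [e|dg] := det_G Gg; first by case: ndg.
have zG := scalar_elt_in.
pose h := (scalar_elt^-1 * g)%g; have hG : h \in G by rewrite groupM ?groupV.
have eg : rG g = rG scalar_elt *m rG h by rewrite -repr_mxM // mulKVg.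
have Hh : h \in H.
  rewrite in_H hG /=; apply/eqP; have := dg; rewrite eg det_mulmx det_scalar_elt mulN1r.
  by move=> /oppr_inj.
rewrite eg -[in RHS](HI h Hh) rG_scalar_elt; apply/seteqP; split.
  by move=> _ [f fI <-]; rewrite act_mul; exists (act (rG h) f); [exists f|].
move=> _ [_ [f fI <-] <-]; exists f; first exact: fI.
exact: act_mul.
Qed.

Lemma repr_in (a : coset_of H) : a \in (G / H)%g -> repr a \in G.
Proof.
case/morphimP=> g Ng Gg -> /=.
have := mem_repr_coset (coset H g); rewrite val_coset // => /rcosetP[h Hh ->].
by rewrite groupM // H_G.
Qed.

Lemma actA_G a I : a \in (G / H)%g -> H_invariant_ideal rH I ->
  actA a I = I \/ actA a I = act_ideal ci%:M I.
Proof.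
move=> aG hI; rewrite /actA (act_G (repr_in aG) hI).
by case: ifP; [left|right].
Qed.

Lemma G_norm g : g \in G -> g \in 'N(H)%g.
Proof.
move=> Gg; rewrite inE; apply/fintype.subsetP=> _ /imsetP[h Hh ->].
have hG := H_G Hh; rewrite in_H groupJ // conjgE !repr_mxM ?groupM ?groupV //.
rewrite !det_mulmx mulrCA -det_mulmx -repr_mxM ?groupV // mulVg.
by rewrite repr_mx1 det1 mulr1; apply/eqP/(det_H Hh).
Qed.

Lemma actA_ex : exists2 a : coset_of H, a \in (G / H)%g &
  forall I, H_invariant_ideal rH I -> actA a I = act_ideal ci%:M I.
Proof.
have nz : scalar_elt \in 'N(H)%g by apply/G_norm/scalar_elt_in.
exists (coset H scalar_elt); first by rewrite mem_quotient ?scalar_elt_in.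
move=> I hI; rewrite /actA act_G //; last by rewrite repr_in // mem_quotient ?scalar_elt_in.
have := mem_repr_coset (coset H scalar_elt); rewrite val_coset // => /rcosetP[h Hh ->].
rewrite repr_mxM ?scalar_elt_in ?H_G // det_mulmx det_scalar_elt (det_H Hh : \det (rG h) = 1) mul1r.
case: eqP => // /eqP; rewrite eq_sym -subr_eq0 opprK -[1 + 1]/(2%:R) pnatr_eq0 //.
Qed.

Lemma exc_fixedE : exc_fixed rG = scalar_fixed rH ci.
Proof.
apply/seteqP; split=> I [eI hI]; have [[iI _] _] := eI; (split; first exact: eI).
  by have [a aG ea] := actA_ex; rewrite -ea // hI.
by move=> a aG; have [->|->] := actA_G aG iI.
Qed.

Lemma inv8_G g : g \in G -> act (rG g) (f8 C) = f8 C.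
Proof.
apply: (G_ind (Pm := fun m => act m (f8 C) = f8 C)); [exact: act1| |exact: gen_f8].
by move=> A B eA eB; rewrite act_mul eB eA.
Qed.

Lemma sextic_G g : g \in G -> act (rG g) (sextic C) = sextic C \/ act (rG g) (sextic C) = - sextic C.
Proof.
apply: (G_ind (Pm := fun m => act m (sextic C) = sextic C \/ act m (sextic C) = - sextic C)).
- by left; apply: act1.
- by move=> A B [eA|eA] [eB|eB]; rewrite act_mul eB ?act_opp eA ?opprK; [left|right|right|left].
exact: gen_sextic.
Qed.

Lemma inv12_G g : g \in G -> act (rG g) (f12 C) = f12 C.
Proof.
move=> Gg; rewrite -[f12 C]/(sextic C ^+ 2) act_exp.
by have [->|->] := sextic_G Gg; rewrite ?sqrrN.
Qed.

Local Notation phi := (quartic omega).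
Local Notation psi := (quartic (omega ^+ 2)).

Definition psi_phi_span (f : S) : Prop := exists a b : C, f = a *: psi ^+ 2 + b *: phi ^+ 2.

Lemma psi_phi_span_G g : g \in G -> forall f, psi_phi_span f -> psi_phi_span (act (rG g) f).
Proof.
apply: (G_ind (Pm := fun m => forall f, psi_phi_span f -> psi_phi_span (act m f))).
- by move=> f'; rewrite act1.
- by move=> A B hA hB f' /hB/hA; rewrite act_mul.
move=> m hm _ [a [b ->]]; rewrite actD !actZ !act_exp.
have [[-> ->]|[k [l [-> ->]]]] := gen_span rt2 epsilon4 omega_eq hm; first by exists a, b.
exists (b * l ^+ 2), (a * k ^+ 2).
by rewrite !exprMn -!rmorphXn /= !mul_mpolyC !scalerA addrC.
Qed.

Variable V : E7label -> representation C H.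
Hypothesis hV : E7_labelling rH V.

Theorem G13_main :
  let E := fun i => Ecurve rH (V i) in
  let Fix := exc_fixed rG in
  let Isolated := exc_isolated rG in
  [/\
    forall i a, i <> rho_0 -> a \in (G / H)%g -> actA a @` E i = E i,
    forall i a I, [\/ i = rho_2, i = rho_2' | i = rho_4] ->
      a \in (G / H)%g -> E i I -> actA a I = I,
    forall i, [\/ i = rho_1', i = rho_2'', i = rho_3 | i = rho_3'] ->
      exists I1 I2, I1 <> I2 /\ E i `&` Fix = [set I1; I2]
  & [/\ E rho_1' `&` Isolated = [set point_of rH (Vdeg rH 6 (V rho_1'))],
        Vdeg rH 6 (V rho_1') = submodule_gen rH [set sextic C],
        E rho_2'' `&` Isolated = [set point_of rH (Vdeg rH 8 (V rho_2''))],
        Vdeg rH 8 (V rho_2'') = submodule_gen rH [set psi ^+ 2; - phi ^+ 2]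
      & E rho_3 `&` Isolated = set0 /\ E rho_3' `&` Isolated = set0]].
Proof.
have i8 h : h \in H -> act (rH h) (f8 C) = f8 C by move=> Hh; apply: inv8_G (H_G Hh).
have i12 h : h \in H -> act (rH h) (f12 C) = f12 C by move=> Hh; apply: inv12_G (H_G Hh).
have [n [p [Q [X [Y [P qm]]]]]] : exists n p Q X Y P, quot_mod rH (@klein_ideal C) (n := n) p Q X Y P.
  apply: (@quot_mod_exists _ _ _ rH _ 18); first exact: klein_is_ideal.
  - by move=> h f; apply: (klein_act det_H hV i8 i12).
  - by move=> d f; apply: klein_hpart.
  - by move=> f hf; exists 0, 0, f; rewrite !mulr0 !add0r.
have cm := klein_coinv det_H hV i8 i12 qm.
have pen r : r != rho_0 -> _ := fun r0 => pencil_exists det_H hV cm (r := r) r0.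
have isoE : exc_isolated rG = isolated_in #|H| (HHilb rH) (scalar_fixed rH ci).
  by rewrite /exc_isolated exc_fixedE.
have invE i I : Ecurve rH (V i) I -> H_invariant_ideal rH I by case=> [[[]]].
have hci := ci2.
rewrite /= isoE exc_fixedE; split.
- move=> i a /eqP i0 aG; have [//|e] := pselect (forall I, Ecurve rH (V i) I -> actA a I = I).
    move=> h; apply/seteqP; split=> [_ [I EI <-]|I EI]; first by rewrite h.
    by exists I => //; apply: h.
  have dg : forall I, Ecurve rH (V i) I -> actA a I = act_ideal ci%:M I.
    have := det_G (repr_in aG) => -[d1|d1] I /invE hI.
      exfalso; apply: e => J /invE hJ; by rewrite /actA (act_G (repr_in aG) hJ) d1 eqxx.
    rewrite /actA (act_G (repr_in aG) hI) d1; case: eqP => // /eqP.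
    by rewrite eq_sym -subr_eq0 opprK -[1 + 1]/(2%:R) pnatr_eq0.
  rewrite -[RHS](scale_Ecurve det_H hV i8 i12 qm hci i0).
  by apply: eq_imagel => I EI; exact: dg.
- move=> i a I hi aG EI; have hi' : i \in [:: rho_2; rho_2'; rho_4] by case: hi => ->.
  have [->//|->] := actA_G aG (invE _ _ EI).
  exact: (fixed_curve det_H hV i8 i12 qm hci hi' EI).
- move=> i hi; have hi' : i \in [:: rho_1'; rho_2''; rho_3; rho_3'] by case: hi => ->.
  have i0 : i != rho_0 by case: (i) hi'.
  have [K [ua [ub pK]]] := pen i i0.
  exists (preim p (K + img ua)%VS), (preim p (K + img ub)%VS); split.
    exact: (fixed_distinct hV qm pK).
  exact: (fixed_points det_H hV i8 i12 qm hci hi' pK).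
have [K1 [ua1 [ub1 pK1]]] := pen rho_1' isT.
have [K2 [ua2 [ub2 pK2]]] := pen rho_2'' isT.
have h1 : rho_1' \in [:: rho_1'; rho_2''] by [].
have h2 : rho_2'' \in [:: rho_1'; rho_2''] by [].
have inM d f : (0 < d)%N -> f \is d.-homog -> p f \in degpart P (aug P) d.
  move=> d0 hf; have e : P d *m p f = p f by rewrite -(qm_P qm) pihomog_dE.
  apply/in_deg; split=> //; apply/in_aug; rewrite -e mulmxA (qm_PP qm).
  by case: eqP d0 => [<-|]; rewrite ?mul0mx.
split.
- rewrite (isolated_points det_H hV i8 i12 qm hci h1 pK1).
  by rewrite (Vdeg_low det_H hV i8 i12 qm h1 pK1) (point_low det_H hV i8 i12 qm h1 pK1).
- apply: (low_gen det_H hV i8 i12 qm (U := <[p (sextic C)]>%VS) h1 pK1).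
  + move=> h v Hh /vlineP[k ->]; rewrite -scalemxAr -(qm_act qm) //; apply: memvZ.
    by have [->|->] := sextic_G (H_G Hh); rewrite ?linearN ?memvN memv_line.
  + by rewrite -memvE inM ?sextic_hom.
  + move=> /eqP; rewrite -dimv_eq0 dim_vline; have [e _|//] := eqVneq (p (sextic C)) 0.
    have := klein_no_degree (isT : (6 < 8)%N) ((qm_ker qm _).1 e).
    rewrite pihomog_dE ?sextic_hom // => e'; have := f12_neq0 C.
    by rewrite -[f12 C]/(sextic C ^+ 2) e' expr0n eqxx.
  + by rewrite dim_vline leq_b1.
  + by move=> a ->; apply: memv_line.
  + by move=> W hW; rewrite -memvE; apply: hW.
- rewrite (isolated_points det_H hV i8 i12 qm hci h2 pK2).
  by rewrite (Vdeg_low det_H hV i8 i12 qm h2 pK2) (point_low det_H hV i8 i12 qm h2 pK2).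
- apply: (low_gen det_H hV i8 i12 qm (U := (<[p (psi ^+ 2)]> + <[p (phi ^+ 2)]>)%VS) h2 pK2).
  + move=> h v Hh; have inU w : (w \in (<[p (psi ^+ 2)]> + <[p (phi ^+ 2)]>)%VS) <-> exists2 f, psi_phi_span f & p f = w.
      split=> [/memv_addP[_ /vlineP[k ->] [_ /vlineP[l ->] ->]]|[_ [k [l ->]] <-]].
        by exists (k *: psi ^+ 2 + l *: phi ^+ 2); [exists k, l|rewrite linearD !linearZ].
      by rewrite linearD !linearZ memv_add // memvZ ?memv_line.
    move=> /inU[f hf <-]; apply/inU; exists (act (rG h) f); last by rewrite -(qm_act qm).
    exact: psi_phi_span_G (H_G Hh) _ hf.
  + by rewrite subv_add -!memvE !inM ?quartic_hom.
  + move=> e; apply: (psi_notin omega_eq); apply/(qm_ker qm)/eqP; rewrite -memv0 -e.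
    by apply: (subvP (addvSl _ _)); apply: memv_line.
  + apply: leq_trans (dimv_add_leqif _ _).1 _.
    by rewrite !dim_vline (leq_add (leq_b1 _) (leq_b1 _)).
  + move=> a [->|->]; rewrite ?linearN ?memvN.
      by apply: (subvP (addvSl _ _)); apply: memv_line.
    by apply: (subvP (addvSr _ _)); apply: memv_line.
  + move=> W hW; rewrite subv_add -!memvE hW /=; last by left.
    by rewrite -memvN -linearN; apply: hW; right.
by split; apply: (isolated_E3 det_H hV i8 i12 qm hci).
Qed.

End Group.

(** * The roots of unity over the reals *)

Section Constants.
Local Open Scope complex_scope.
Variable R : realType.
Local Notation C := R[i].

Lemma expi_mul (a b : R) : (cos a +i* sin a) * (cos b +i* sin b) = cos (a + b) +i* sin (a + b) :> C.
Proof. by rewrite cosD sinD; apply/eqP; rewrite eq_complex /= eqxx /=; apply/eqP; ring. Qed.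

(** The square of epsilon is i. *)
Lemma epsilon4 : epsilon R ^+ 4 = -1.
Proof.
have e2 : epsilon R ^+ 2 = 0 +i* 1.
  rewrite expr2 /epsilon /expi2pi expi_mul.
  have -> : 2 * pi / 8%:R + 2 * pi / 8%:R = pi / 2%:R :> R by field.
  by rewrite cos_pihalf sin_pihalf.
rewrite -[4%N]/(2 * 2)%N exprM e2; apply/eqP; rewrite eq_complex /=.
by rewrite !mul0r !mulr0 !mulr1 sub0r addr0 oppr0 !eqxx.
Qed.

(** omega is a cube root of 1 other than 1, its imaginary part being positive.
    *)
Lemma omega_eq : omega R ^+ 2 + omega R + 1 = 0.
Proof.
have e3 : omega R ^+ 3 = 1.
  rewrite exprS expr2 /omega /expi2pi !expi_mul.
  have -> : 2 * pi / 3%:R + (2 * pi / 3%:R + 2 * pi / 3%:R) = pi *+ 2 :> R.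
    by rewrite -mulr_natl; field.
  by rewrite cos2pi sin2pi.
have n1 : omega R - 1 != 0.
  rewrite subr_eq0; apply/negP; rewrite eq_complex /= => /andP[_ /eqP e].
  have : 0 < sin (2 * pi / 3%:R : R).
    apply: sin_gt0_pi; apply/andP; split; first by rewrite divr_gt0 ?mulr_gt0 ?pi_gt0.
    rewrite ltr_pdivrMr // mulrC ltr_pM2l ?pi_gt0 //; by rewrite ltr_nat.
  by rewrite e ltxx.
apply: (mulfI n1); rewrite mulr0.
have -> : (omega R - 1) * (omega R ^+ 2 + omega R + 1) = omega R ^+ 3 - 1 by ring.
by rewrite e3 subrr.
Qed.

Definition rt : C := (Num.sqrt 2)^-1%:C.

Lemma rt2 : 2%:R * rt ^+ 2 = 1.
Proof.
rewrite /rt -rmorphXn /= exprVn sqr_sqrtr ?ler0n //.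
have -> : 2%:R = (2%:R : R)%:C by rewrite rmorph_nat.
by rewrite -rmorphM /= mulfV ?rmorph1 // pnatr_eq0.
Qed.

End Constants.

Theorem propositionA4p1 (R : realType) (gT : finGroupType) (G : {group gT})
    (rG : mx_representation R[i] G 2) (hG : is_G13 rG)
    (V : E7label -> representation R[i] (SLpart_group rG))
    (hV : E7_labelling (SLrepr rG) V) :
  let H := SLpart_group rG in
  let rH := SLrepr rG in
  let E := fun i => Ecurve rH (V i) in
  let Fix := exc_fixed rG in
  let Isolated := exc_isolated rG in
  [/\
    (* a *)
    forall i a, i <> rho_0 -> a \in (G / H)%g -> actA a @` E i = E i,
    (* b *)
    forall i a I, [\/ i = rho_2, i = rho_2' | i = rho_4] ->
      a \in (G / H)%g -> E i I -> actA a I = I,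
    (* c: exactly two fixed points *)
    forall i, [\/ i = rho_1', i = rho_2'', i = rho_3 | i = rho_3'] ->
      exists I1 I2, I1 <> I2 /\ E i `&` Fix = [set I1; I2]
  & (* c: isolated points *)
    [/\ E rho_1' `&` Isolated = [set point_of rH (Vdeg rH 6 (V rho_1'))],
        Vdeg rH 6 (V rho_1') = submodule_gen rH [set T13 R],
        E rho_2'' `&` Isolated = [set point_of rH (Vdeg rH 8 (V rho_2''))],
        Vdeg rH 8 (V rho_2'')
          = submodule_gen rH [set psi13 R ^+ 2; - phi13 R ^+ 2]
      & E rho_3 `&` Isolated = set0 /\ E rho_3' `&` Isolated = set0]].
Proof.
have [_ [s [t [u [defG rGs rGt rGu]]]]] := hG.
exact: (G13_main (rt2 R) (epsilon4 R) (omega_eq R) defG rGs rGt rGu hV).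
Qed.
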